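(* Let $k$ be a commutative ring and let $\mathcal{A}$ be an essentially small additive category. Let $B, C:\mathcal{A}\times\mathcal{A}\to k\text{-}\mathbf{Mod}$ be bifunctors of AP-type, and let $B':\mathcal{A}^{\mathrm{op}}\times\mathcal{A}^{\mathrm{op}}\to k\text{-}\mathbf{Mod}$ be a bifunctor of AP-type contravariant in both variables. Let $\Delta:\mathcal{A}\to\mathcal{A}\times\mathcal{A}$, $\Delta(x)=(x,x)$, be the diagonal functor. Then the natural graded morphisms given by restriction along $\Delta$ $$\mathrm{res}^\Delta:\mathrm{Ext}^*_{k[\mathcal{A}\times\mathcal{A}]}(B,C)\to\mathrm{Ext}^*_{k[\mathcal{A}]}(\Delta^*B,\Delta^*C),$$ $$\mathrm{res}_\Delta:\mathrm{Tor}_*^{k[\mathcal{A}]}(\Delta^*B',\Delta^*C)\to\mathrm{Tor}_*^{k[\mathcal{A}\times\mathcal{A}]}(B',C)$$ are isomorphisms.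
   Context: Unadorned tensor products are over $k$. For an essentially small category $\mathcal{C}$, $k[\mathcal{C}]\text{-}\mathbf{Mod}$ is the abelian category of all functors $\mathcal{C}\to k\text{-}\mathbf{Mod}$ and natural transformations, and $\mathbf{Mod}\text{-}k[\mathcal{C}]=k[\mathcal{C}^{\mathrm{op}}]\text{-}\mathbf{Mod}$. $\mathrm{Ext}^*_{k[\mathcal{C}]}$ denotes Ext in these categories. For $F$ in $\mathbf{Mod}\text{-}k[\mathcal{C}]$ and $G$ in $k[\mathcal{C}]\text{-}\mathbf{Mod}$, $F\otimes_{k[\mathcal{C}]}G=\int^{c\in\mathcal{C}}F(c)\otimes G(c)$ (coend), and $\mathrm{Tor}^{k[\mathcal{C}]}_*(F,G)$ denotes its left derived functors. A functor $\phi:\mathcal{C}\to\mathcal{D}$ induces exact restriction functors $\phi^*$ (precomposition with $\phi$), and hence natural morphisms of $\delta$-functors $\mathrm{res}^\phi:\mathrm{Ext}^i_{k[\mathcal{D}]}(F,G)\to\mathrm{Ext}^i_{k[\mathcal{C}]}(\phi^*F,\phi^*G)$ and $\mathrm{res}_\phi:\mathrm{Tor}_i^{k[\mathcal{C}]}(\phi^*F,\phi^*G)\to\mathrm{Tor}_i^{k[\mathcal{D}]}(F,G)$. Thus $(\Delta^*B)(x)=B(x,x)$. Polynomial functors: for $F:\mathcal{A}\to k\text{-}\mathbf{Mod}$ and $d\ge1$ there is a unique (up to isomorphism) decomposition of functors of $d$ variables $F(x_1\oplus\cdots\oplus x_d)\simeq F(0)\oplus\bigoplus_\sigma F_\sigma(x_{\sigma_1},\dots,x_{\sigma_r})$,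 indexed by nonempty subsets $\sigma=\{\sigma_1,\dots,\sigma_r\}\subset\{1,\dots,d\}$, where each $F_\sigma$ vanishes whenever one of its variables is zero. The $d$-th cross-effect is $\mathrm{cr}_dF=F_{\{1,\dots,d\}}$. $F$ is polynomial of degree less than $d$ if $\mathrm{cr}_dF=0$, and polynomial if this holds for some positive integer $d$. Antipolynomial functors: an ideal $\mathcal{I}$ of $\mathcal{A}$ is a subfunctor of $\mathcal{A}(-,-):\mathcal{A}^{\mathrm{op}}\times\mathcal{A}\to\mathbf{Ab}$; $\mathcal{A}/\mathcal{I}$ has the same objects as $\mathcal{A}$ and morphisms $\mathcal{A}(x,y)/\mathcal{I}(x,y)$, with quotient functor $\pi_\mathcal{I}:\mathcal{A}\to\mathcal{A}/\mathcal{I}$. An additive category $\mathcal{B}$ is $k$-trivial if for all objects $x,y$ the group $\mathcal{B}(x,y)$ is finite and $k\otimes_\mathbb{Z}\mathcal{B}(x,y)=0$; $\mathcal{I}$ is $k$-cotrivial if $\mathcal{A}/\mathcal{I}$ is $k$-trivial. $F:\mathcal{A}\to k\text{-}\mathbf{Mod}$ is antipolynomial if it factors through $\pi_\mathcal{I}$ for some $k$-cotrivial ideal $\mathcal{I}$. A bifunctor $B:\mathcal{A}\times\mathcal{A}\to k\text{-}\mathbf{Mod}$ is of AP-type (antipolynomial-polynomial type) if for every object $x$ the functor $y\mapsto B(y,x)$ is antipolynomial and the functor $y\mapsto B(x,y)$ is polynomial. For contravariant bifunctors the same definitions are applied with the additive category $\mathcal{A}^{\mathrm{op}}$ in place of $\mathcal{A}$.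 *)

(* Defs.v *)
From HB Require Import structures.
From mathcomp Require Import all_boot all_algebra finmap.
From mathcomp Require Import generic_quotient ring_quotient.
From mathcomp Require Import boolp classical_sets functions cardinality fsbigop.

Set Implicit Arguments.
Unset Strict Implicit.
Unset Printing Implicit Defensive.

Import GRing.Theory.
Local Open Scope quotient_scope.
Local Open Scope ring_scope.

Section FreeModule.
Variables (k : comPzRingType) (T : Type).

Definition fin_supp : {pred T -> k^o} :=
  fun f => `[< finite_set [set t : {classic T} | f t <> 0]%classic >].

Lemma fin_supp_submod : submod_closed fin_supp.
Proof.
split=> [|a f g /asboolP ff /asboolP fg]; apply/asboolP.
  by apply: (sub_finite_set _ (finite_set0 {classic T})) => t /= /(_ erefl).
have ffg : finite_set ([set t : {classic T} | f t <> 0%R] `|`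
                       [set t : {classic T} | g t <> 0%R])%classic.
  by rewrite finite_setU.
apply: sub_finite_set ffg => t /= fgt.
have [f0|/eqP fn0] := eqVneq (f t) 0; last by left.
right=> g0; apply: fgt.
rewrite [LHS]/(a *: (f t : k^o) + (g t : k^o)) f0 g0 scaler0. exact: (addr0 (0 : k^o)).
Qed.

HB.instance Definition _ :=
  GRing.isSubmodClosed.Build k (T -> k^o) fin_supp fin_supp_submod.

Record free := Free { coef :> T -> k^o; coef_fin : coef \in fin_supp }.
HB.instance Definition _ := [isSub for coef].
HB.instance Definition _ := [Choice of free by <:].
HB.instance Definition _ := [SubChoice_isSubLmodule of free by <:].

Lemma delta_fin (t : T) : (fun s : {classic T} => (s == t)%:R) \in fin_supp.
Proof.
apply/asboolP; apply: (sub_finite_set _ (finite_set1 (t : {classic T}))) => s /=.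
by case: eqVneq.
Qed.
Definition delta (t : T) : free := Free (delta_fin t).


Lemma free_supp (f : free) :
  exists A : {fset {classic T}}, forall t, t \notin A -> f t = 0.
Proof.
have /asboolP /finite_fsetP[A eA] := coef_fin f.
exists A => t; apply: contraNeq => /eqP ft.
by have : ([set` A]%classic) t by rewrite -eA.
Qed.

Section Ext.
Variables (M : lmodType k) (h : T -> M).

Definition lin_ext (f : free) : M := \sum_(t \in [set: {classic T}]) (f t : k) *: h t.

Lemma lin_extE (A : {fset {classic T}}) (f : free) :
  (forall t, t \notin A -> f t = 0) -> lin_ext f = \sum_(t <- A) (f t : k) *: h t.
Proof. by move=> fA; apply: fsbigTE => t /fA ->; rewrite scale0r. Qed.

Lemma lin_ext_linear : linear lin_ext.
Proof.
move=> a f g; have [A fA] := free_supp f; have [B gB] := free_supp g.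
have fAB t : t \notin (A `|` B)%fset -> f t = 0.
  by rewrite inE negb_or => /andP[/fA].
have gAB t : t \notin (A `|` B)%fset -> g t = 0.
  by rewrite inE negb_or => /andP[_ /gB].
rewrite (lin_extE fAB) (lin_extE gAB) (@lin_extE (A `|` B)%fset).
  rewrite scaler_sumr -big_split /=; apply: eq_bigr => t _.
  by transitivity ((a * f t + g t : k) *: h t); rewrite // scalerDl scalerA.
move=> t tAB; transitivity (a * f t + g t : k) => //.
by rewrite fAB // gAB // mulr0 addr0.
Qed.
HB.instance Definition _ := GRing.isLinear.Build k free M _ lin_ext lin_ext_linear.

Lemma lin_ext_delta t : lin_ext (delta t) = h t.
Proof.
rewrite (@lin_extE [fset (t : {classic T})]%fset).
  by rewrite big_seq_fset1 /= eqxx scale1r.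
by move=> s; rewrite inE /= => /negPf ->.
Qed.

End Ext.

Lemma free_delta (f : free) : f = lin_ext delta f.
Proof.
have [A fA] := free_supp f; apply/val_inj/funext => s.
rewrite (lin_extE _ fA) raddf_sum /= fct_sumE.
have E (t : {classic T}) : val ((f t : k) *: delta t) s =
    (f t : k) * ((s : {classic T}) == t)%:R by [].
have [sA|sA] := boolP ((s : {classic T}) \in A).
  rewrite (big_fsetD1 _ sA) /= big1_fset ?[RHS]addr0.
    by rewrite [RHS]E eqxx; apply/esym/(mulr1 (f s : k)).
  move=> t; rewrite !inE => /andP[ts _] _; rewrite [LHS]E eq_sym (negPf ts).
  exact: (mulr0 (f t : k)).
rewrite fA // big1_fset // => t tA _; rewrite [LHS]E.
case: eqVneq tA => [<-|_ _]; first by rewrite (negPf sA).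
exact: (mulr0 (f t : k)).
Qed.

Lemma free_ext (M : lmodType k) (f g : {linear free -> M}) :
  (forall t, f (delta t) = g (delta t)) -> f =1 g.
Proof.
move=> fg x; rewrite (free_delta x); have [A xA] := free_supp x.
rewrite (lin_extE _ xA) !linear_sum; apply: eq_bigr => t _.
by rewrite !linearZ fg.
Qed.

End FreeModule.

Section QuotientModule.
Variables (k : comPzRingType) (M : lmodType k) (N : submodClosed M).

Definition submod_pred : {pred M} := N.
HB.instance Definition _ := GRing.isZmodClosed.Build M submod_pred
  (GRing.submod_closedB (submodClosedP N)).

Definition quotmod := Quotient.quot submod_pred.
HB.instance Definition _ := GRing.Zmodule.on quotmod.

Definition quot_pi (x : M) : quotmod := \pi x.

Lemma quot_piE x y : quot_pi x = quot_pi y <-> x - y \in N.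
Proof. by rewrite -[_ \in N]/(_ \in submod_pred) Quotient.idealrBE; split=> /eqP. Qed.

Lemma quot_surj (q : quotmod) : exists x, q = quot_pi x.
Proof. by exists (repr q); rewrite /quot_pi reprK. Qed.

Lemma quot_piD : {morph quot_pi : x y / x + y}.
Proof. by move=> x y; rewrite /quot_pi !piE. Qed.

Definition quot_scale (a : k) (q : quotmod) : quotmod := quot_pi (a *: repr q).

Lemma quot_scaleE a x : quot_scale a (quot_pi x) = quot_pi (a *: x).
Proof.
by apply/quot_piE; rewrite -scalerBr rpredZ // -quot_piE /quot_pi reprK.
Qed.

Lemma quot_scaleA a b q : quot_scale a (quot_scale b q) = quot_scale (a * b) q.
Proof. by have [x ->] := quot_surj q; rewrite !quot_scaleE scalerA. Qed.
Lemma quot_scale1 q : quot_scale 1 q = q.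
Proof. by have [x ->] := quot_surj q; rewrite quot_scaleE scale1r. Qed.
Lemma quot_scaleDr : right_distributive quot_scale +%R.
Proof.
move=> a q r; have [x ->] := quot_surj q; have [y ->] := quot_surj r.
by rewrite -quot_piD !quot_scaleE -quot_piD scalerDr.
Qed.
Lemma quot_scaleDl q : {morph quot_scale^~ q : a b / a + b}.
Proof.
move=> a b; have [x ->] := quot_surj q.
by rewrite !quot_scaleE -quot_piD scalerDl.
Qed.
HB.instance Definition _ := GRing.Zmodule_isLmodule.Build k quotmod
  quot_scaleA quot_scale1 quot_scaleDr quot_scaleDl.

Lemma quot_pi_linear : linear quot_pi.
Proof. by move=> a x y; rewrite quot_piD -quot_scaleE. Qed.
HB.instance Definition _ :=
  GRing.isLinear.Build k M quotmod _ quot_pi quot_pi_linear.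

Section Ext.
Variables (M' : lmodType k) (f : {linear M -> M'}).

Definition quot_ext of (forall x, x \in N -> f x = 0) : quotmod -> M' :=
  fun q => f (repr q).

Variable fN : forall x, x \in N -> f x = 0.

Lemma quot_extE x : quot_ext fN (quot_pi x) = f x.
Proof.
apply/eqP; rewrite -subr_eq0 -linearB; apply/eqP/fN.
by rewrite -quot_piE /quot_pi reprK.
Qed.

Lemma quot_ext_linear : linear (quot_ext fN).
Proof.
move=> a q r; have [x ->] := quot_surj q; have [y ->] := quot_surj r.
by rewrite -linearP !quot_extE linearP.
Qed.
HB.instance Definition _ :=
  GRing.isLinear.Build k quotmod M' _ (quot_ext fN) quot_ext_linear.

End Ext.
End QuotientModule.

(* The quotient of free k T by the submodule generated by rel. *)
Section Presentation.
Variables (k : comPzRingType) (T : Type) (rel : free k T -> Prop).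

Definition relators : {pred free k T} := fun x =>
  `[< forall N : submodClosed (free k T),
        (forall r, rel r -> r \in N) -> x \in N >].

Lemma relators_submod : submod_closed relators.
Proof.
split=> [|a f g /asboolP fN /asboolP gN]; apply/asboolP => N relN.
  exact: rpred0.
by rewrite rpredD ?rpredZ ?fN ?gN.
Qed.
HB.instance Definition _ :=
  GRing.isSubmodClosed.Build k (free k T) relators relators_submod.

Definition presented : lmodType k := quotmod relators.
Definition gen (t : T) : presented := quot_pi relators (delta k t).

Section Ext.
Variables (M : lmodType k) (h : T -> M).
Hypothesis hrel : forall r, rel r -> lin_ext h r = 0.

Definition kerm_pred : {pred free k T} := fun x => lin_ext h x == 0.
Lemma kerm_pred_submod : submod_closed kerm_pred.
Proof.
split=> [|a f g /eqP f0 /eqP g0]; apply/eqP; first exact: linear0.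
by rewrite linearP /= f0 g0 scaler0 addr0.
Qed.
HB.instance Definition _ :=
  GRing.isSubmodClosed.Build k (free k T) kerm_pred kerm_pred_submod.

Lemma presented_ext_subproof x : x \in relators -> lin_ext h x = 0.
Proof. by move=> /asboolP /(_ kerm_pred) xk; apply/eqP/xk => r /hrel /eqP. Qed.

Definition presented_ext : {linear presented -> M} :=
  quot_ext presented_ext_subproof.

Lemma presented_extE t : presented_ext (gen t) = h t.
Proof. by rewrite [LHS]quot_extE /= lin_ext_delta. Qed.
End Ext.

Lemma presented_rel x : rel x -> quot_pi relators x = 0.
Proof.
move=> rx; rewrite -(linear0 (quot_pi relators)); apply/quot_piE.
by rewrite subr0; apply/asboolP => N; apply.
Qed.

Lemma presented_eq (M : lmodType k) (f g : {linear presented -> M}) :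
  (forall t, f (gen t) = g (gen t)) -> f =1 g.
Proof.
move=> fg q; have [x ->] := quot_surj q.
have := @free_ext _ _ _ (f \o quot_pi relators) (g \o quot_pi relators).
by apply.
Qed.
End Presentation.

Section Tensor.
Variables (R : comPzRingType) (U V : lmodType R).
Local Notation "[: u , v ]" := (delta R (u, v)) (at level 0).

Inductive tensor_rel : free R (U * V) -> Prop :=
| TensorLl a u u' v : tensor_rel ([: a *: u + u', v] - (a *: [: u, v] + [: u', v]))
| TensorLr a u v v' : tensor_rel ([: u, a *: v + v'] - (a *: [: u, v] + [: u, v'])).

Definition tensor := presented tensor_rel.
Definition tens (u : U) (v : V) : tensor := gen tensor_rel (u, v).

Lemma tensLl a u u' v : tens (a *: u + u') v = a *: tens u v + tens u' v.
Proof.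
apply/eqP; rewrite -subr_eq0 -!linearP -linearB; apply/eqP.
by apply: presented_rel; exact: TensorLl.
Qed.
Lemma tensLr a u v v' : tens u (a *: v + v') = a *: tens u v + tens u v'.
Proof.
apply/eqP; rewrite -subr_eq0 -!linearP -linearB; apply/eqP.
by apply: presented_rel; exact: TensorLr.
Qed.
End Tensor.

Section TensorMap.
Variables (R : comPzRingType) (U U' V : lmodType R) (f : {linear U -> U'}).

Lemma tensor_mapl_subproof r : tensor_rel r ->
  lin_ext (fun uv : U * V => tens (f uv.1) uv.2) r = 0.
Proof.
case=> *; rewrite linearB linearP /= !lin_ext_delta /=.
  by rewrite linearP tensLl subrr.
by rewrite tensLr subrr.
Qed.

Definition tensor_mapl : {linear tensor U V -> tensor U' V} :=
  presented_ext tensor_mapl_subproof.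

Lemma tensor_maplE u v : tensor_mapl (tens u v) = tens (f u) v.
Proof. exact: presented_extE. Qed.
End TensorMap.

Section Homology.
Variables (k : comPzRingType).

Section Def.
Variables (L M N : lmodType k) (f : {linear L -> M}) (g : {linear M -> N}).

Definition cycle : {pred M} := fun x => g x == 0.
Lemma cycle_submod : submod_closed cycle.
Proof.
split=> [|a x y /eqP x0 /eqP y0]; apply/eqP; first exact: linear0.
by rewrite linearP x0 y0 scaler0 addr0.
Qed.
HB.instance Definition _ :=
  GRing.isSubmodClosed.Build k M cycle cycle_submod.

Record cycles := Cycle { cycle_val : M; cycleP : cycle_val \in cycle }.
HB.instance Definition _ := [isSub for cycle_val].
HB.instance Definition _ := [Choice of cycles by <:].
HB.instance Definition _ := [SubChoice_isSubLmodule of cycles by <:].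

Definition boundary : {pred cycles} := fun z => `[< exists y, f y = cycle_val z >].
Lemma boundary_submod : submod_closed boundary.
Proof.
split=> [|a x y /asboolP[x' ex] /asboolP[y' ey]]; apply/asboolP.
  by exists 0; rewrite linear0.
by exists (a *: x' + y'); rewrite linearP ex ey.
Qed.
HB.instance Definition _ :=
  GRing.isSubmodClosed.Build k cycles boundary boundary_submod.

(* Only used for g \o f = 0; in general, ker g modulo its intersection with the
   image of f. *)
Definition homology : lmodType k := quotmod boundary.
End Def.
Arguments boundary {L M N} f g _.

Section Map.
Variables (L M N L' M' N' : lmodType k).
Variables (f : {linear L -> M}) (g : {linear M -> N}).
Variables (f' : {linear L' -> M'}) (g' : {linear M' -> N'}).
Variable a : {linear M -> M'}.
Hypothesis aZ : forall x, g x = 0 -> g' (a x) = 0.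
Hypothesis aB : forall y, exists y', f' y' = a (f y).

Lemma homology_map_cycle (z : cycles g) : a (cycle_val z) \in cycle g'.
Proof. by apply/eqP/aZ/eqP/(cycleP z). Qed.

Definition homology_map_cycles (z : cycles g) : homology f' g' :=
  quot_pi (boundary f' g') (Cycle (homology_map_cycle z)).

Lemma homology_map_cycles_linear : linear homology_map_cycles.
Proof.
move=> c x y; rewrite -linearP; congr quot_pi.
by apply/val_inj; rewrite /= linearP.
Qed.
HB.instance Definition _ := GRing.isLinear.Build k (cycles g) (homology f' g') _
  homology_map_cycles homology_map_cycles_linear.

Lemma homology_map_subproof z :
  z \in boundary f g -> homology_map_cycles z = 0.
Proof.
move=> /asboolP[y ey]; rewrite -(linear0 (quot_pi (boundary f' g'))).
apply/quot_piE; rewrite subr0; apply/asboolP.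
by have [y' ey'] := aB y; exists y'; rewrite ey' ey.
Qed.

Definition homology_map : {linear homology f g -> homology f' g'} :=
  quot_ext homology_map_subproof.
End Map.
End Homology.

(* The objects form a type, so a category is small with respect to the universe
   in which the k-modules live. *)
Record category := Category {
  obj :> Type;
  hom : obj -> obj -> Type;
  idm : forall x, hom x x;
  compm : forall x y z, hom y z -> hom x y -> hom x z;
  comp1m : forall x y (f : hom x y), compm (idm y) f = f;
  compm1 : forall x y (f : hom x y), compm f (idm x) = f;
  compmA : forall x y z t (h : hom z t) (g : hom y z) (f : hom x y),
    compm h (compm g f) = compm (compm h g) f }.
Arguments hom {c} x y.
Arguments idm {c} x.
Arguments compm {c x y z} g f.

Notation "g \* f" := (compm g f) (at level 40, left associativity) : cat_scope.
Delimit Scope cat_scope with cat.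
Local Open Scope cat_scope.

Definition op (C : category) : category := {|
  obj := C;
  hom := fun x y => @hom C y x;
  idm := @idm C;
  compm := fun x y z g f => @compm C z y x f g;
  comp1m := fun x y f => @compm1 C y x f;
  compm1 := fun x y f => @comp1m C y x f;
  compmA := fun x y z t h g f => esym (@compmA C t z y x f g h) |}.

Section ProductCategory.
Variables C D : category.

Definition prod_hom (x y : C * D) : Type := (hom x.1 y.1 * hom x.2 y.2)%type.
Definition prod_comp x y z (g : prod_hom y z) (f : prod_hom x y) : prod_hom x z :=
  (g.1 \* f.1, g.2 \* f.2).

Lemma prod_comp1m x y (f : prod_hom x y) :
  prod_comp (idm y.1, idm y.2) f = f.
Proof. by case: f => f1 f2; rewrite /prod_comp /= !comp1m. Qed.
Lemma prod_compm1 x y (f : prod_hom x y) :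
  prod_comp f (idm x.1, idm x.2) = f.
Proof. by case: f => f1 f2; rewrite /prod_comp /= !compm1. Qed.
Lemma prod_compmA x y z t (h : prod_hom z t) (g : prod_hom y z)
    (f : prod_hom x y) :
  prod_comp h (prod_comp g f) = prod_comp (prod_comp h g) f.
Proof. by rewrite /prod_comp /= !compmA. Qed.

Definition prodC : category := Category prod_comp1m prod_compm1 prod_compmA.
End ProductCategory.

Section PowerCategory.
Variables (I : Type) (C : category).

Definition pow_hom (x y : I -> C) : Type := forall i, hom (x i) (y i).
Definition pow_comp x y z (g : pow_hom y z) (f : pow_hom x y) : pow_hom x z :=
  fun i => g i \* f i.

Lemma pow_comp1m x y (f : pow_hom x y) : pow_comp (fun i => idm (y i)) f = f.
Proof. by apply: functional_extensionality_dep => i; apply: comp1m. Qed.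
Lemma pow_compm1 x y (f : pow_hom x y) : pow_comp f (fun i => idm (x i)) = f.
Proof. by apply: functional_extensionality_dep => i; apply: compm1. Qed.
Lemma pow_compmA x y z t (h : pow_hom z t) (g : pow_hom y z)
    (f : pow_hom x y) : pow_comp h (pow_comp g f) = pow_comp (pow_comp h g) f.
Proof. by apply: functional_extensionality_dep => i; apply: compmA. Qed.

Definition powC : category := Category pow_comp1m pow_compm1 pow_compmA.
End PowerCategory.

Record cfunctor (C D : category) := CFunctor {
  cf_obj :> C -> D;
  cf_hom : forall x y : C, hom x y -> hom (cf_obj x) (cf_obj y);
  cf_id : forall x, cf_hom (idm x) = idm (cf_obj x);
  cf_comp : forall x y z (g : hom y z) (f : hom x y),
    cf_hom (g \* f) = cf_hom g \* cf_hom f }.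

Definition op_cfunctor C D (phi : cfunctor C D) : cfunctor (op C) (op D) :=
  @CFunctor (op C) (op D) phi (fun x y => @cf_hom C D phi y x)
    (cf_id phi) (fun x y z g f => @cf_comp C D phi z y x f g).

Definition diag (C : category) : cfunctor C (prodC C C) :=
  @CFunctor C (prodC C C) (fun x => (x, x)) (fun x y f => (f, f))
    (fun x => erefl) (fun x y z g f => erefl).

Definition insl (C D : category) (d : D) : cfunctor C (prodC C D) :=
  @CFunctor C (prodC C D) (fun c => (c, d)) (fun x y f => (f, idm d))
    (fun x => erefl)
    (fun x y z g f => congr1 (pair (g \* f)) (esym (comp1m (idm d)))).

Definition insr (C D : category) (c : C) : cfunctor D (prodC C D) :=
  @CFunctor D (prodC C D) (fun d => (c, d)) (fun x y f => (idm c, f))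
    (fun x => erefl)
    (fun x y z g f => congr1 (pair^~ (g \* f)) (esym (comp1m (idm c)))).

Definition pow_restr (I J : Type) (s : J -> I) (C : category) :
    cfunctor (powC I C) (powC J C) :=
  @CFunctor (powC I C) (powC J C) (fun x j => x (s j)) (fun x y f j => f (s j))
    (fun x => erefl) (fun x y z g f => erefl).

(* Objects of k[C]-Mod; those of Mod-k[C] are the functors k (op C). *)
Record functor (k : comPzRingType) (C : category) := Functor {
  fobj :> C -> lmodType k;
  fmap : forall x y : C, hom x y -> fobj x -> fobj y;
  fmap_linear : forall x y (u : hom x y), linear (fmap u);
  fmap1 : forall x v, fmap (idm x) v = v;
  fmapM : forall x y z (g : hom y z) (f : hom x y) v,
    fmap (g \* f) v = fmap g (fmap f v) }.
Arguments fmap {k C} _ [x y] u _.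

HB.instance Definition _ (k : comPzRingType) (C : category) (F : functor k C)
    (x y : C) (u : hom x y) :=
  GRing.isLinear.Build k (F x) (F y) _ (fmap F u) (@fmap_linear k C F x y u).

Definition restr (k : comPzRingType) (C D : category) (phi : cfunctor C D)
    (F : functor k D) : functor k C.
Proof.
refine (@Functor k C (fun x => F (phi x)) (fun x y u => fmap F (cf_hom phi u))
  _ _ _).
- by move=> x y u; apply: fmap_linear.
- by move=> x v; rewrite cf_id fmap1.
- by move=> x y z g f v; rewrite cf_comp fmapM.
Defined.

Definition const_functor (k : comPzRingType) (C : category) (M : lmodType k) :
    functor k C :=
  @Functor k C (fun=> M) (fun x y u v => v) (fun x y u a v w => erefl)
    (fun x v => erefl) (fun x y z g f v => erefl).

Section NaturalTransformations.
Variables (k : comPzRingType) (C : category).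

Record nattrans (F G : functor k C) := NatTrans {
  component :> forall x, F x -> G x;
  component_linear : forall x, linear (@component x);
  naturality : forall (x y : C) (u : hom x y) v,
    component (fmap F u v) = fmap G u (component v) }.

HB.instance Definition _ F G (a : nattrans F G) x :=
  GRing.isLinear.Build k (F x) (G x) _ (a x) (@component_linear F G a x).

Lemma nattransP F G (a b : nattrans F G) : (forall x v, a x v = b x v) -> a = b.
Proof.
case: a b => a a1 a2 [b b1 b2] /= ab.
have {}ab : a = b.
  by apply: functional_extensionality_dep => x; apply/funext => v; apply: ab.
by case: b / ab b1 b2 => b1 b2; congr NatTrans; apply: Prop_irrelevance.
Qed.

Definition ntcomp F G H (b : nattrans G H) (a : nattrans F G) : nattrans F H.
Proof.
refine (@NatTrans F H (fun x v => b x (a x v)) _ _).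
- by move=> x c v w; rewrite !linearP.
- by move=> x y u v; rewrite !naturality.
Defined.

Section Hom.
Variables F G : functor k C.

HB.instance Definition _ := gen_eqMixin (nattrans F G).
HB.instance Definition _ := gen_choiceMixin (nattrans F G).

Definition nt_zero : nattrans F G.
Proof.
refine (@NatTrans F G (fun x v => 0) _ _).
- by move=> x c v w; rewrite scaler0 addr0.
- by move=> x y u v; rewrite linear0.
Defined.

Definition nt_opp (a : nattrans F G) : nattrans F G.
Proof.
refine (@NatTrans F G (fun x v => - a x v) _ _).
- by move=> x c v w; rewrite linearP opprD scalerN.
- by move=> x y u v; rewrite naturality linearN.
Defined.

Definition nt_add (a b : nattrans F G) : nattrans F G.
Proof.
refine (@NatTrans F G (fun x v => a x v + b x v) _ _).
- by move=> x c v w; rewrite !linearP addrACA scalerDr.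
- by move=> x y u v; rewrite !naturality linearD.
Defined.

Definition nt_scale (c : k) (a : nattrans F G) : nattrans F G.
Proof.
refine (@NatTrans F G (fun x v => c *: a x v) _ _).
- by move=> x d v w; rewrite linearP scalerDr !scalerA mulrC.
- by move=> x y u v; rewrite naturality linearZ.
Defined.

Lemma nt_addA : associative nt_add.
Proof. by move=> a b c; apply: nattransP => x v; apply: addrA. Qed.
Lemma nt_addC : commutative nt_add.
Proof. by move=> a b; apply: nattransP => x v; apply: addrC. Qed.
Lemma nt_add0 : left_id nt_zero nt_add.
Proof. by move=> a; apply: nattransP => x v; apply: add0r. Qed.
Lemma nt_addN : left_inverse nt_zero nt_opp nt_add.
Proof. by move=> a; apply: nattransP => x v; apply: addNr. Qed.
HB.instance Definition _ :=
  GRing.isZmodule.Build (nattrans F G) nt_addA nt_addC nt_add0 nt_addN.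

Lemma nt_scaleA c d a : nt_scale c (nt_scale d a) = nt_scale (c * d) a.
Proof. by apply: nattransP => x v; apply: scalerA. Qed.
Lemma nt_scale1 : left_id 1 nt_scale.
Proof. by move=> a; apply: nattransP => x v; apply: scale1r. Qed.
Lemma nt_scaleDr : right_distributive nt_scale +%R.
Proof. by move=> c a b; apply: nattransP => x v; apply: scalerDr. Qed.
Lemma nt_scaleDl a : {morph nt_scale^~ a : c d / c + d}.
Proof. by move=> c d; apply: nattransP => x v; apply: scalerDl. Qed.
HB.instance Definition _ := GRing.Zmodule_isLmodule.Build k (nattrans F G)
  nt_scaleA nt_scale1 nt_scaleDr nt_scaleDl.
End Hom.

Definition nat_iso (F G : functor k C) :=
  exists a : nattrans F G, forall x, bijective (a x).

Definition precomp F F' G (a : nattrans F' F) (b : nattrans F G) :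
  nattrans F' G := ntcomp b a.
Lemma precomp_linear F F' G (a : nattrans F' F) : linear (@precomp F F' G a).
Proof. by move=> c b b'; apply: nattransP. Qed.
HB.instance Definition _ F F' G (a : nattrans F' F) :=
  GRing.isLinear.Build k (nattrans F G) (nattrans F' G) _ (@precomp F F' G a)
    (@precomp_linear F F' G a).

(* Epimorphisms of k[C]-Mod are the pointwise surjections. *)
Definition projective (P : functor k C) :=
  forall (M N : functor k C) (g : nattrans M N) (f : nattrans P N),
    (forall x (w : N x), exists v, g x v = w) ->
    exists h : nattrans P M, ntcomp g h = f.

End NaturalTransformations.

Section RestrictNat.
Variables (k : comPzRingType) (C D : category) (phi : cfunctor C D).
Variables F G : functor k D.

Definition nt_restr (a : nattrans F G) : nattrans (restr phi F) (restr phi G).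
Proof.
refine (@NatTrans k C (restr phi F) (restr phi G) (fun x v => a (phi x) v) _ _).
- by move=> x; exact: (@component_linear _ _ _ _ a (phi x)).
- by move=> x y u v; exact: (naturality a (cf_hom phi u) v).
Defined.

Lemma nt_restr_linear : linear nt_restr.
Proof. by move=> c a b; apply: nattransP. Qed.
HB.instance Definition _ := GRing.isLinear.Build k (nattrans F G)
  (nattrans (restr phi F) (restr phi G)) _ nt_restr nt_restr_linear.
End RestrictNat.

Section Resolutions.
Variables (k : comPzRingType) (C : category).

Record resolution (F : functor k C) := Resolution {
  res_obj :> nat -> functor k C;
  res_d : forall n, nattrans (res_obj n.+1) (res_obj n);
  res_aug : nattrans (res_obj 0) F;
  res_surj : forall x (w : F x), exists v, res_aug x v = w;
  res_exact0 : forall x (w : res_obj 0 x),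
    res_aug x w = 0 <-> exists v, res_d 0 x v = w;
  res_exactS : forall n x (w : res_obj n.+1 x),
    res_d n x w = 0 <-> exists v, res_d n.+1 x v = w }.

Definition res_projective F (P : resolution F) := forall n, projective (P n).

Section Kernel.
Variables (F G : functor k C) (a : nattrans F G).

Lemma ker_fmap_subproof x y (u : hom x y) (v : cycles (a x)) :
  fmap F u (cycle_val v) \in cycle (a y).
Proof.
by apply/eqP; rewrite /= naturality (eqP (cycleP v)) linear0.
Qed.

Definition ker_functor : functor k C.
Proof.
refine (@Functor k C (fun x => cycles (a x))
  (fun x y u v => Cycle (ker_fmap_subproof u v)) _ _ _).
- by move=> x y u c v w; apply/val_inj; rewrite /= linearP.
- by move=> x v; apply/val_inj; rewrite /= fmap1.
- by move=> x y z g f v; apply/val_inj; rewrite /= fmapM.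
Defined.

Definition ker_incl : nattrans ker_functor F :=
  @NatTrans k C ker_functor F (fun x v => cycle_val v)
    (fun x c v w => erefl) (fun x y u v => erefl).

Lemma ker_corestr (E : functor k C) (b : nattrans E F) :
  (forall x v, a x (b x v) = 0) -> exists b' : nattrans E ker_functor, ntcomp ker_incl b' = b.
Proof.
move=> ab.
have abP x v : b x v \in cycle (a x) by apply/eqP; apply: ab.
unshelve eexists (@NatTrans k C E ker_functor (fun x v => Cycle (abP x v)) _ _).
- by move=> x c v w; apply/val_inj; rewrite /= linearP.
- by move=> x y u v; apply/val_inj; rewrite /= naturality.
- exact: nattransP.
Qed.
End Kernel.

Lemma projective_lift (P M N E : functor k C) (d : nattrans M N) (e : nattrans N E)
    (f : nattrans P N) : projective P ->
  (forall x (w : N x), e x w = 0 <-> exists v, d x v = w) ->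
  (forall x v, e x (f x v) = 0) -> exists h : nattrans P M, ntcomp d h = f.
Proof.
move=> projP de ef.
have [f' ef'] := ker_corestr ef.
have ed x v : e x (d x v) = 0 by apply/de; exists v.
have [d' ed'] := ker_corestr ed.
have d'surj x (w : ker_functor e x) : exists v, d' x v = w.
  have /eqP/de[v ev] := cycleP w; exists v; apply/val_inj.
  by rewrite -[LHS]/(ntcomp (ker_incl e) d' x v) ed'.
have [h eh] := projP _ _ d' f' d'surj.
by exists h; rewrite -ed' -ef' -eh; apply: nattransP.
Qed.

(* The direct sum of the representables k[C(c,-)] over all c and s in F(c). *)
Section Cover.
Variable F : functor k C.

Definition cover_gen (x : C) : Type := {c : C & (F c * hom c x)%type}.
Definition cover_push x y (u : hom x y) (t : cover_gen x) : cover_gen y :=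
  existT _ (projT1 t) ((projT2 t).1, u \* (projT2 t).2).

Definition cover_fmap x y (u : hom x y) :
    free k (cover_gen x) -> free k (cover_gen y) :=
  lin_ext (fun t => delta k (cover_push u t)).
HB.instance Definition _ x y (u : hom x y) := GRing.Linear.on (cover_fmap u).

Lemma cover_fmap_delta x y (u : hom x y) t :
  cover_fmap u (delta k t) = delta k (cover_push u t).
Proof. exact: lin_ext_delta. Qed.

Lemma cover_push1 x (t : cover_gen x) : cover_push (idm x) t = t.
Proof. by case: t => c [s f]; rewrite /cover_push /= comp1m. Qed.
Lemma cover_pushM x y z (g : hom y z) (f : hom x y) (t : cover_gen x) :
  cover_push (g \* f) t = cover_push g (cover_push f t).
Proof. by case: t => c [s h]; rewrite /cover_push /= compmA. Qed.

Lemma cover_fmap1 x v : cover_fmap (idm x) v = v.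
Proof.
rewrite [RHS]free_delta /cover_fmap; congr (lin_ext _ v).
by apply/funext => t; rewrite cover_push1.
Qed.

Lemma cover_fmapM x y z (g : hom y z) (f : hom x y) v :
  cover_fmap (g \* f) v = cover_fmap g (cover_fmap f v).
Proof.
apply: (free_ext (f := cover_fmap (g \* f))
  (g := cover_fmap g \o cover_fmap f)) => t /=.
by rewrite !cover_fmap_delta cover_pushM.
Qed.

Definition cover : functor k C :=
  @Functor k C (fun x => free k (cover_gen x)) cover_fmap
    (fun x y u => lin_ext_linear _) cover_fmap1 cover_fmapM.

Section Map.
Variables (G : functor k C) (h : forall c, F c -> G c).
Definition cover_map_fun x : cover x -> G x :=
  lin_ext (fun t : cover_gen x => fmap G (projT2 t).2 (h (projT2 t).1)).

Lemma cover_map_natural x y (u : hom x y) v :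
  cover_map_fun (fmap cover u v) = fmap G u (cover_map_fun v).
Proof.
apply: (free_ext (f := lin_ext _ \o cover_fmap u)
  (g := fmap G u \o lin_ext _)) => t /=.
by rewrite cover_fmap_delta !lin_ext_delta fmapM.
Qed.

Definition cover_map : nattrans cover G :=
  @NatTrans k C cover G cover_map_fun (fun x => lin_ext_linear _)
    cover_map_natural.

Lemma cover_mapE c s : cover_map c (delta k (existT _ c (s, idm c))) = h s.
Proof. by rewrite [LHS]lin_ext_delta fmap1. Qed.
End Map.

Lemma cover_nat_eq G (a b : nattrans cover G) :
  (forall c s, a c (delta k (existT _ c (s, idm c))) =
               b c (delta k (existT _ c (s, idm c)))) -> a = b.
Proof.
move=> ab; apply: nattransP => x v.
pose a' : {linear cover x -> G x} := a x.
pose b' : {linear cover x -> G x} := b x.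
refine (@free_ext k (cover_gen x) (G x) a' b' _ v) => -[c [s f]]; rewrite /a' /b' /=.
have -> : delta k (existT _ c (s, f) : cover_gen x) =
    fmap cover f (delta k (existT _ c (s, idm c))).
  by rewrite [RHS]cover_fmap_delta /cover_push /= compm1.
by rewrite [LHS]naturality [RHS]naturality ab.
Qed.

Lemma cover_projective : projective cover.
Proof.
move=> M N g f gsurj.
pose h c (s : F c) := projT1 (cid (gsurj c (f c (delta k (existT _ c (s, idm c)))))).
exists (cover_map h); apply: cover_nat_eq => c s.
transitivity (g c (h c s)); first by congr (g c _); exact: cover_mapE.
by rewrite /h; case: cid.
Qed.

Definition cover_epi : nattrans cover F := cover_map (fun c s => s).
Lemma cover_epi_surj x (w : F x) : exists v, cover_epi x v = w.
Proof. by exists (delta k (existT _ x (w, idm x))); apply: cover_mapE. Qed.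
End Cover.

Section FreeResolution.
Variable F : functor k C.

Fixpoint syzygy n : functor k C :=
  if n is m.+1 then ker_functor (cover_epi (syzygy m)) else F.

Definition free_res_d n : nattrans (cover (syzygy n.+1)) (cover (syzygy n)) :=
  ntcomp (ker_incl (cover_epi (syzygy n))) (cover_epi (syzygy n.+1)).

Lemma free_res_exact n x (w : cover (syzygy n) x) :
  cover_epi (syzygy n) x w = 0 <-> exists v, free_res_d n x v = w.
Proof.
split=> [w0|[v <-]]; last exact/eqP/cycleP.
have wc : w \in cycle (cover_epi (syzygy n) x) by apply/eqP.
by have [v ev] := cover_epi_surj (F := syzygy n.+1) (Cycle wc);
   exists v; rewrite -[RHS]/(cycle_val (Cycle wc)) -ev.
Qed.

Lemma free_res_exactS n x (w : cover (syzygy n.+1) x) :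
  free_res_d n x w = 0 <-> exists v, free_res_d n.+1 x v = w.
Proof.
rewrite -free_res_exact; split=> [w0|]; last by rewrite /free_res_d /= => ->.
by apply/val_inj.
Qed.

Definition free_resolution : resolution F :=
  @Resolution F (fun n => cover (syzygy n)) free_res_d (cover_epi F)
    (@cover_epi_surj F) (@free_res_exact 0) free_res_exactS.

Lemma free_resolution_projective : res_projective free_resolution.
Proof. by move=> n; apply: cover_projective. Qed.
End FreeResolution.

(* Chain maps over the identity of F. *)
Record chain_map F (Q R : resolution F) := ChainMap {
  chain_fun :> forall n, nattrans (Q n) (R n);
  chain_aug : ntcomp (res_aug R) (chain_fun 0) = res_aug Q;
  chain_d : forall n,
    ntcomp (res_d R n) (chain_fun n.+1) = ntcomp (chain_fun n) (res_d Q n) }.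

Section Comparison.
Variables (F : functor k C) (Q R : resolution F).
Hypothesis projQ : res_projective Q.

Definition liftable n (f : nattrans (Q n) (R n)) :=
  exists g : nattrans (Q n.+1) (R n.+1),
    ntcomp (res_d R n) g = ntcomp f (res_d Q n).

Lemma lift0 : exists f : nattrans (Q 0) (R 0),
  ntcomp (res_aug R) f = res_aug Q /\ liftable f.
Proof.
have [f ef] := projQ (res_aug Q) (@res_surj F R).
exists f; split=> //; apply: (projective_lift (e := res_aug R)) => //.
  exact: res_exact0.
move=> x v; rewrite -[LHS]/(ntcomp (res_aug R) f x (res_d Q 0 x v)) ef.
by apply/res_exact0; exists v.
Qed.

Lemma liftS n (f : nattrans (Q n) (R n)) : liftable f ->
  exists g : nattrans (Q n.+1) (R n.+1),
    ntcomp (res_d R n) g = ntcomp f (res_d Q n) /\ liftable g.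
Proof.
move=> [g eg]; exists g; split=> //.
apply: (projective_lift (e := res_d R n)) => //; first exact: res_exactS.
move=> x v; rewrite -[LHS]/(ntcomp (res_d R n) g x (res_d Q n.+1 x v)) eg /=.
have -> : res_d Q n x (res_d Q n.+1 x v) = 0 by apply/res_exactS; exists v.
by rewrite linear0.
Qed.

Fixpoint lift_seq n : {f : nattrans (Q n) (R n) | liftable f} :=
  match n with
  | 0 => let: exist f p := cid lift0 in exist _ f p.2
  | m.+1 => let: exist f p := lift_seq m in
            let: exist g q := cid (liftS p) in exist _ g q.2
  end.

Lemma chain_map_exists : inhabited (chain_map Q R).
Proof.
constructor; exists (fun n => sval (lift_seq n)).
  by rewrite /=; case: cid => f [].
by move=> n /=; case: lift_seq => f p /=; case: cid => g [].
Qed.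

Definition comparison : chain_map Q R :=
  projT1 (cid (let: inhabits f := chain_map_exists in
               ex_intro (fun=> True) f I)).
End Comparison.
End Resolutions.

Section RestrictResolution.
Variables (k : comPzRingType) (C D : category) (phi : cfunctor C D).
Variables (F : functor k D) (P : resolution F).

Definition restr_resolution : resolution (restr phi F) :=
  @Resolution k C (restr phi F) (fun n => restr phi (P n))
    (fun n => nt_restr phi (res_d P n)) (nt_restr phi (res_aug P))
    (fun x => @res_surj _ _ _ P (phi x)) (fun x => @res_exact0 _ _ _ P (phi x))
    (fun n x => @res_exactS _ _ _ P n (phi x)).
End RestrictResolution.

Section Ext.
Variables (k : comPzRingType).

Section Def.
Variables (C : category) (F : functor k C) (P : resolution F) (G : functor k C).

Definition ext_out n : {linear nattrans (P n) G -> nattrans (P n.+1) G} :=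
  precomp (res_d P n).
Definition ext_in n : {linear nattrans (P n.-1) G -> nattrans (P n) G} :=
  match n with 0 => \0 | m.+1 => ext_out m end.

Definition ext_of n : lmodType k := homology (ext_in n) (ext_out n).
End Def.

Definition Ext (C : category) n (F G : functor k C) : lmodType k :=
  ext_of (free_resolution F) G n.

Section Res.
Variables (C D : category) (phi : cfunctor C D) (F G : functor k D).
Variables (P : resolution F) (Q : resolution (restr phi F)).
Variable f : chain_map Q (restr_resolution phi P).

Definition ext_res_cochain n :
    {linear nattrans (P n) G -> nattrans (Q n) (restr phi G)} :=
  @precomp k C _ _ (restr phi G) (f n) \o @nt_restr k C D phi (P n) G.

Lemma ext_res_d n b : ext_res_cochain n.+1 (ext_out P G n b) =
  ext_out Q (restr phi G) n (ext_res_cochain n b).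
Proof.
apply: nattransP => x v /=; congr (b (phi x) _).
have /(congr1 (fun a : nattrans (Q n.+1) (restr phi (P n)) => a x v)) := chain_d f n.
by [].
Qed.

Lemma ext_res_cocycle n b : ext_out P G n b = 0 ->
  ext_out Q (restr phi G) n (ext_res_cochain n b) = 0.
Proof. by rewrite -ext_res_d => ->; rewrite linear0. Qed.

Lemma ext_res_coboundary n b : exists b',
  ext_in Q (restr phi G) n b' = ext_res_cochain n (ext_in P G n b).
Proof.
case: n b => [|n] b; first by exists 0; rewrite !linear0.
by exists (ext_res_cochain n b); rewrite ext_res_d.
Qed.

Definition ext_res_of n :
    {linear ext_of P G n -> ext_of Q (restr phi G) n} :=
  homology_map (@ext_res_cocycle n) (@ext_res_coboundary n).
End Res.

(* The comparison chain map from the chosen resolution of phi^*F to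
   phi^* of that of F is unique up to homotopy; phi^* need not preserve
   projectives. *)
Definition ext_res (C D : category) (phi : cfunctor C D) n (F G : functor k D) :
    {linear Ext n F G -> Ext n (restr phi F) (restr phi G)} :=
  ext_res_of G (comparison (restr_resolution phi (free_resolution F))
    (@free_resolution_projective k C (restr phi F))) n.
End Ext.

Section TensorOverCategory.
Variable k : comPzRingType.

Section Def.
Variables (C : category) (F : functor k (op C)) (G : functor k C).

Definition coend_gen : Type := {c : C & tensor (F c) (G c)}.
Definition coend_tag (c : C) (t : tensor (F c) (G c)) : coend_gen := existT _ c t.
Local Notation "[: c , t ]" := (delta k (@coend_tag c t)) (at level 0).

(* The coend of F(-) (x) G(-): the direct sum over c of the F(c) (x) G(c), with
   F(f)(u) (x) v and u (x) G(f)(v) identified for f : c -> d. *)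
Inductive coend_rel : free k coend_gen -> Prop :=
| CoendLinear (c : C) (a : k) (t t' : tensor (F c) (G c)) :
    coend_rel ([: c, a *: t + t'] - (a *: [: c, t] + [: c, t']))
| CoendDinatural (c d : C) (f : hom c d) (u : F d) (v : G c) :
    coend_rel ([: c, tens (fmap F (f : @hom (op C) d c) u) v] -
               [: d, tens u (fmap G f v)]).

Definition tensorC : lmodType k := presented coend_rel.
Definition coend_in (c : C) (t : tensor (F c) (G c)) : tensorC :=
  gen coend_rel (coend_tag t).

Lemma coend_in_linear c : linear (@coend_in c).
Proof.
move=> a t t'; apply/eqP; rewrite -subr_eq0 -!linearP -linearB; apply/eqP.
by apply: presented_rel; exact: CoendLinear.
Qed.
HB.instance Definition _ c := GRing.isLinear.Build k (tensor (F c) (G c)) tensorC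
  _ (@coend_in c) (@coend_in_linear c).

Lemma coend_in_dinatural (c d : C) (f : hom c d) (u : F d) (v : G c) :
  coend_in (tens (fmap F (f : @hom (op C) d c) u) v) =
  coend_in (tens u (fmap G f v)).
Proof.
apply/eqP; rewrite -subr_eq0 /coend_in /gen -linearB; apply/eqP.
by apply: presented_rel; exact: CoendDinatural.
Qed.

Section Ext.
Variables (M : lmodType k) (h : forall c : C, {linear tensor (F c) (G c) -> M}).
Hypothesis hD : forall (c d : C) (f : hom c d) (u : F d) (v : G c),
  h c (tens (fmap F (f : @hom (op C) d c) u) v) = h d (tens u (fmap G f v)).

Lemma tensorC_ext_subproof r : coend_rel r ->
  lin_ext (fun t : coend_gen => h (projT1 t) (projT2 t)) r = 0.
Proof.
case=> [c a t t'|c d f u v].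
  by rewrite linearB linearP /= !lin_ext_delta /= linearP subrr.
by rewrite linearB /= !lin_ext_delta /= hD subrr.
Qed.
Definition tensorC_ext : {linear tensorC -> M} :=
  presented_ext tensorC_ext_subproof.
Lemma tensorC_extE c t : tensorC_ext (coend_in t) = h c t.
Proof. exact: presented_extE. Qed.
End Ext.
End Def.

Section Map.
Variables (C : category) (F F' : functor k (op C)) (G : functor k C).
Variable a : nattrans F F'.

Definition tensorC_map_at (c : C) : {linear tensor (F c) (G c) -> tensorC F' G} :=
  @coend_in _ F' G c \o tensor_mapl (G c) (a c).

Lemma tensorC_map_atE (c : C) (u : F c) (v : G c) :
  tensorC_map_at c (tens u v) = coend_in (tens (a c u) v).
Proof. by congr (coend_in _); exact: tensor_maplE. Qed.

Lemma tensorC_map_subproof (c d : C) (f : hom c d) (u : F d) (v : G c) :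
  tensorC_map_at c (tens (fmap F (f : @hom (op C) d c) u) v) =
  tensorC_map_at d (tens u (fmap G f v)).
Proof. by rewrite !tensorC_map_atE naturality coend_in_dinatural. Qed.

Definition tensorC_map : {linear tensorC F G -> tensorC F' G} :=
  tensorC_ext tensorC_map_subproof.
Lemma tensorC_mapE (c : C) (u : F c) (v : G c) :
  tensorC_map (coend_in (tens u v)) = coend_in (tens (a c u) v).
Proof. by rewrite [LHS]tensorC_extE tensorC_map_atE. Qed.
End Map.
End TensorOverCategory.

Lemma tensorC_eq (k : comPzRingType) (C : category) (F : functor k (op C))
    (G : functor k C) (M : lmodType k) (a b : {linear tensorC F G -> M}) :
  (forall (c : C) (u : F c) (v : G c),
     a (coend_in (tens u v)) = b (coend_in (tens u v))) -> a =1 b.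
Proof.
move=> ab; apply: presented_eq => -[c t].
pose ac := a \o @coend_in k C F G c; pose bc := b \o @coend_in k C F G c.
by apply: (presented_eq (f := ac) (g := bc)) => -[u v]; apply: ab.
Qed.

Section Tor.
Variable k : comPzRingType.

Section Def.
Variables (C : category) (F : functor k (op C)) (P : resolution F).
Variable G : functor k C.

Definition tor_in n : {linear tensorC (P n.+1) G -> tensorC (P n) G} :=
  tensorC_map G (res_d P n).
Definition tor_out n : {linear tensorC (P n) G -> tensorC (P n.-1) G} :=
  match n with 0 => \0 | m.+1 => tor_in m end.

Definition tor_of n : lmodType k := homology (tor_in n) (tor_out n).
End Def.

(* The left derived functors of the tensor product over k[C], computed by
   resolving the contravariant variable. *)
Definition Tor (C : category) n (F : functor k (op C)) (G : functor k C) :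
    lmodType k :=
  tor_of (free_resolution F) G n.

Section Restr.
Variables (C D : category) (phi : cfunctor C D).
Variables (F : functor k (op D)) (G : functor k D).

Definition tensorC_restr_at (c : C) :
    {linear tensor (restr (op_cfunctor phi) F c) (restr phi G c) -> tensorC F G} :=
  (@coend_in k D F G (phi c) :
     {linear tensor (F (phi c)) (G (phi c)) -> tensorC F G}).

Lemma tensorC_restr_subproof (c d : C) (f : hom c d)
    (u : restr (op_cfunctor phi) F d) (v : restr phi G c) :
  tensorC_restr_at c (tens (fmap (restr (op_cfunctor phi) F)
                              (f : @hom (op C) d c) u) v) =
  tensorC_restr_at d (tens u (fmap (restr phi G) f v)).
Proof. exact: coend_in_dinatural. Qed.

Definition tensorC_restr :
    {linear tensorC (restr (op_cfunctor phi) F) (restr phi G) -> tensorC F G} :=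
  tensorC_ext tensorC_restr_subproof.

Lemma tensorC_restrE (c : C) (u : restr (op_cfunctor phi) F c) (v : restr phi G c) :
  tensorC_restr (@coend_in k C _ (restr phi G) c (tens u v)) =
  @coend_in k D F G (phi c) (tens u v).
Proof. by rewrite [LHS]tensorC_extE. Qed.
End Restr.

Section Res.
Variables (C D : category) (phi : cfunctor C D).
Variables (F : functor k (op D)) (G : functor k D).
Variables (P : resolution F) (Q : resolution (restr (op_cfunctor phi) F)).
Variable f : chain_map Q (restr_resolution (op_cfunctor phi) P).

Definition tor_res_chain n :
    {linear tensorC (Q n) (restr phi G) -> tensorC (P n) G} :=
  tensorC_restr phi (P n) G \o tensorC_map (restr phi G) (f n).

Lemma tor_res_chainE n (c : C) (u : Q n c) (v : restr phi G c) :
  tor_res_chain n (@coend_in k C (Q n) (restr phi G) c (tens u v)) =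
  @coend_in k D (P n) G (phi c) (tens (f n c u) v).
Proof.
transitivity (tensorC_restr phi (P n) G
    (@coend_in k C _ (restr phi G) c (tens (f n c u) v))).
  by congr (tensorC_restr _ _ _ _); exact: tensorC_mapE.
exact: tensorC_restrE.
Qed.

Lemma tor_res_d n t : tor_res_chain n (tor_in Q (restr phi G) n t) =
  tor_in P G n (tor_res_chain n.+1 t).
Proof.
pose a := tor_res_chain n \o tor_in Q (restr phi G) n.
pose b := tor_in P G n \o tor_res_chain n.+1.
apply: (tensorC_eq (a := a) (b := b)) => c u v; rewrite /a /b /=.
have E1 : tor_in Q (restr phi G) n (coend_in (tens u v)) =
    coend_in (tens (res_d Q n c u) v) by exact: tensorC_mapE.
have E2 (w : P n.+1 (phi c)) : tor_in P G n (coend_in (tens w v)) =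
    @coend_in k D _ G (phi c) (tens (res_d P n (phi c) w) v).
  exact: tensorC_mapE.
transitivity (tor_res_chain n
    (@coend_in k C _ (restr phi G) c (tens (res_d Q n c u) v))).
  by congr (tor_res_chain _ _).
rewrite tor_res_chainE; transitivity (@coend_in k D _ G (phi c)
    (tens (res_d P n (phi c) (f n.+1 c u)) v)); last first.
  rewrite -E2; congr (tor_in _ _ _ _); apply/esym; exact: tor_res_chainE.
congr (coend_in (tens _ _)).
have /(congr1 (fun a : nattrans (Q n.+1) (restr (op_cfunctor phi) (P n)) =>
  a c u)) := chain_d f n.
by [].
Qed.

Lemma tor_res_cycle n t : tor_out Q (restr phi G) n t = 0 ->
  tor_out P G n (tor_res_chain n t) = 0.
Proof.
case: n t => [|n] t // t0.
transitivity (tor_res_chain n (tor_in Q (restr phi G) n t)).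
  by rewrite tor_res_d.
by have -> : tor_in Q (restr phi G) n t = 0; [exact: t0 | rewrite linear0].
Qed.

Lemma tor_res_boundary n t : exists t',
  tor_in P G n t' = tor_res_chain n (tor_in Q (restr phi G) n t).
Proof. by exists (tor_res_chain n.+1 t); rewrite tor_res_d. Qed.

Definition tor_res_of n : {linear tor_of Q (restr phi G) n -> tor_of P G n} :=
  homology_map (@tor_res_cycle n) (@tor_res_boundary n).
End Res.

Definition tor_res (C D : category) (phi : cfunctor C D) n
    (F : functor k (op D)) (G : functor k D) :
    {linear Tor n (restr (op_cfunctor phi) F) (restr phi G) -> Tor n F G} :=
  tor_res_of G
    (comparison (restr_resolution (op_cfunctor phi) (free_resolution F))
      (@free_resolution_projective k (op C) (restr (op_cfunctor phi) F))) n.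
End Tor.

(* Direct sums of finite families are part of the data; the empty family gives
   the zero object. *)
Record additive := Additive {
  add_obj : Type;
  add_hom : add_obj -> add_obj -> zmodType;
  add_id : forall x, add_hom x x;
  add_comp : forall x y z, add_hom y z -> add_hom x y -> add_hom x z;
  add_comp1m : forall x y (f : add_hom x y), add_comp (add_id y) f = f;
  add_compm1 : forall x y (f : add_hom x y), add_comp f (add_id x) = f;
  add_compA : forall x y z t (h : add_hom z t) (g : add_hom y z)
    (f : add_hom x y), add_comp h (add_comp g f) = add_comp (add_comp h g) f;
  add_compDl : forall x y z (g g' : add_hom y z) (f : add_hom x y),
    add_comp (g + g') f = add_comp g f + add_comp g' f;
  add_compDr : forall x y z (g : add_hom y z) (f f' : add_hom x y),
    add_comp g (f + f') = add_comp g f + add_comp g f';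
  dsum : forall n, ('I_n -> add_obj) -> add_obj;
  dinj : forall n (x : 'I_n -> add_obj) i, add_hom (x i) (dsum x);
  dproj : forall n (x : 'I_n -> add_obj) i, add_hom (dsum x) (x i);
  dproj_inj : forall n (x : 'I_n -> add_obj) i,
    add_comp (dproj x i) (dinj x i) = add_id (x i);
  dproj_inj0 : forall n (x : 'I_n -> add_obj) i j, i <> j ->
    add_comp (dproj x j) (dinj x i) = 0;
  dsum_id : forall n (x : 'I_n -> add_obj),
    \sum_i add_comp (dinj x i) (dproj x i) = add_id (dsum x) }.

Definition add_cat (A : additive) : category :=
  Category (@add_comp1m A) (@add_compm1 A) (@add_compA A).
Coercion add_cat : additive >-> category.

Section AdditiveTheory.
Variable A : additive.

Lemma add_comp0m (x y z : A) (f : add_hom x y) :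
  add_comp (0 : add_hom y z) f = 0.
Proof. by apply: (addrI (add_comp 0 f)); rewrite -add_compDl !addr0. Qed.
Lemma add_compm0 (x y z : A) (g : add_hom y z) :
  add_comp g (0 : add_hom x y) = 0.
Proof. by apply: (addrI (add_comp g 0)); rewrite -add_compDr !addr0. Qed.
Lemma add_compNm (x y z : A) (g : add_hom y z) (f : add_hom x y) :
  add_comp (- g) f = - add_comp g f.
Proof. by apply/eqP; rewrite -addr_eq0 -add_compDl addNr add_comp0m. Qed.
Lemma add_compmN (x y z : A) (g : add_hom y z) (f : add_hom x y) :
  add_comp g (- f) = - add_comp g f.
Proof. by apply/eqP; rewrite -addr_eq0 -add_compDr addNr add_compm0. Qed.
Lemma add_comp_suml (x y z : A) I r (P : pred I) (g : I -> add_hom y z)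
    (f : add_hom x y) :
  add_comp (\sum_(i <- r | P i) g i) f = \sum_(i <- r | P i) add_comp (g i) f.
Proof.
by apply: (big_morph (fun g => add_comp g f)) => [g1 g2|];
   rewrite ?add_compDl ?add_comp0m.
Qed.
Lemma add_comp_sumr (x y z : A) I r (P : pred I) (g : add_hom y z)
    (f : I -> add_hom x y) :
  add_comp g (\sum_(i <- r | P i) f i) = \sum_(i <- r | P i) add_comp g (f i).
Proof.
by apply: (big_morph (add_comp g)) => [f1 f2|];
   rewrite ?add_compDr ?add_compm0.
Qed.

Definition is_zero (x : A) :=
  (forall (y : A) (f : add_hom x y), f = 0) /\
  (forall (y : A) (f : add_hom y x), f = 0).

Definition zero_obj : A :=
  dsum (fun i : 'I_0 => False_rect (add_obj A) (notF (ltn_ord i))).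

Lemma zero_objP : is_zero zero_obj.
Proof.
have id0 : add_id zero_obj = 0 by rewrite -dsum_id big_ord0.
by split=> y f; [rewrite -[f]add_compm1 | rewrite -[f]add_comp1m];
   rewrite id0 ?add_compm0 ?add_comp0m.
Qed.

Definition dsum_fmap n (x y : 'I_n -> A) (f : forall i, add_hom (x i) (y i)) :
    add_hom (dsum x) (dsum y) :=
  \sum_i add_comp (dinj y i) (add_comp (f i) (dproj x i)).

Lemma dsum_fmap1 n (x : 'I_n -> A) :
  dsum_fmap (fun i => add_id (x i)) = add_id (dsum x).
Proof. by rewrite -dsum_id; apply: eq_bigr => i _; rewrite add_comp1m. Qed.

Lemma dsum_fmapM n (x y z : 'I_n -> A) (g : forall i, add_hom (y i) (z i))
    (f : forall i, add_hom (x i) (y i)) :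
  dsum_fmap (fun i => add_comp (g i) (f i)) =
  add_comp (dsum_fmap g) (dsum_fmap f).
Proof.
rewrite add_comp_suml; apply: eq_bigr => i _.
rewrite add_comp_sumr (bigD1 i) //= big1 ?addr0 => [|j ji].
  rewrite -!add_compA; congr (add_comp _ (add_comp _ _)).
  by rewrite !add_compA dproj_inj add_comp1m.
rewrite -!add_compA [X in add_comp (g i) X]add_compA dproj_inj0; last exact/eqP.
by rewrite add_comp0m !add_compm0.
Qed.

Definition dsum_functor n : cfunctor (powC 'I_n A) A :=
  @CFunctor (powC 'I_n A) A (@dsum A n) (@dsum_fmap n) (@dsum_fmap1 n)
    (@dsum_fmapM n).
End AdditiveTheory.

Definition opA (A : additive) : additive.
Proof.
refine (@Additive (add_obj A) (fun x y => @add_hom A y x) (@add_id A)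
  (fun x y z g f => @add_comp A z y x f g) _ _ _ _ _ (@dsum A)
  (@dproj A) (@dinj A) _ _ _).
- by move=> x y f; apply: add_compm1.
- by move=> x y f; apply: add_comp1m.
- by move=> x y z t h g f; rewrite add_compA.
- by move=> x y z g g' f; apply: add_compDr.
- by move=> x y z g f f'; apply: add_compDl.
- by move=> n x i; apply: dproj_inj.
- by move=> n x i j ij; apply: dproj_inj0 => ji; apply: ij.
- by move=> n x; apply: dsum_id.
Defined.

Section Ideals.
Variable A : additive.

Record ideal := Ideal {
  ideal_mem :> forall x y : A, zmodClosed (add_hom x y);
  idealMl : forall (x y z : A) (g : add_hom y z) (f : add_hom x y),
    f \in ideal_mem x y -> add_comp g f \in ideal_mem x z;
  idealMr : forall (x y z : A) (g : add_hom y z) (f : add_hom x y),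
    g \in ideal_mem y z -> add_comp g f \in ideal_mem x z }.

Variable I : ideal.

Definition iquot (x y : A) : zmodType := Quotient.quot (I x y).
Definition ipi (x y : A) (f : add_hom x y) : iquot x y := \pi f.

Lemma ipiE x y (f g : add_hom x y) : ipi f = ipi g <-> f - g \in I x y.
Proof. by rewrite Quotient.idealrBE; split=> /eqP. Qed.
Lemma ipi_surj x y (q : iquot x y) : exists f, q = ipi f.
Proof. by exists (repr q); rewrite /ipi reprK. Qed.
Lemma ipiD x y : {morph @ipi x y : f g / f + g}.
Proof. by move=> f g; rewrite /ipi !piE. Qed.
Lemma ipi0 x y : @ipi x y 0 = 0.
Proof. by rewrite /ipi !piE. Qed.

Definition iquot_comp (x y z : A) (q : iquot y z) (r : iquot x y) : iquot x z :=
  ipi (add_comp (repr q) (repr r)).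

Lemma iquot_compE (x y z : A) (g : add_hom y z) (f : add_hom x y) :
  iquot_comp (ipi g) (ipi f) = ipi (add_comp g f).
Proof.
set g' := repr (ipi g); set f' := repr (ipi f); apply/ipiE.
rewrite -[_ - _](subrKA (add_comp g' f)) -/g' -/f'.
rewrite -add_compmN -add_compDr -add_compNm -add_compDl rpredD //.
  by apply/idealMl/ipiE; rewrite /f' /ipi reprK.
by apply/idealMr/ipiE; rewrite /g' /ipi reprK.
Qed.

Definition quotA : additive.
Proof.
refine (@Additive (add_obj A) iquot (fun x => ipi (add_id x)) iquot_comp
  _ _ _ _ _ (@dsum A) (fun n x i => ipi (dinj x i))
  (fun n x i => ipi (dproj x i)) _ _ _).
- by move=> x y q; have [f ->] := ipi_surj q; rewrite iquot_compE add_comp1m.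
- by move=> x y q; have [f ->] := ipi_surj q; rewrite iquot_compE add_compm1.
- move=> x y z t q r s; have [h ->] := ipi_surj q; have [g ->] := ipi_surj r.
  by have [f ->] := ipi_surj s; rewrite !iquot_compE add_compA.
- move=> x y z q r s; have [h ->] := ipi_surj q; have [g ->] := ipi_surj r.
  by have [f ->] := ipi_surj s; rewrite -ipiD !iquot_compE -ipiD add_compDl.
- move=> x y z q r s; have [h ->] := ipi_surj q; have [g ->] := ipi_surj r.
  by have [f ->] := ipi_surj s; rewrite -ipiD !iquot_compE -ipiD add_compDr.
- by move=> n x i; rewrite iquot_compE dproj_inj.
- by move=> n x i j ij; rewrite iquot_compE dproj_inj0 // ipi0.
- move=> n x; rewrite -dsum_id; under eq_bigr do rewrite iquot_compE.
  by rewrite (big_morph (@ipi _ _) (@ipiD _ _) (@ipi0 _ _)).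
Defined.

Definition quot_functor : cfunctor A quotA :=
  @CFunctor A quotA (fun x => x) (fun x y f => ipi f) (fun x => erefl)
    (fun x y z g f => esym (iquot_compE g f)).
End Ideals.

Definition k_trivial (k : comPzRingType) (B : additive) := forall x y : B,
  finite_set [set: add_hom x y]%classic /\
  forall t : tensor (zmodule k : lmodType int)
                    (zmodule (add_hom x y) : lmodType int), t = 0.

Definition k_cotrivial (k : comPzRingType) (A : additive) (I : ideal A) :=
  k_trivial k (quotA I).

(* Factorizations through the quotient functor are taken up to natural
   isomorphism. *)
Definition antipolynomial (k : comPzRingType) (A : additive) (F : functor k A) :=
  exists I : ideal A, k_cotrivial k I /\
  exists F' : functor k (quotA I), nat_iso F (restr (quot_functor I) F').

Section Polynomial.
Variables (k : comPzRingType) (A : additive) (F : functor k A).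

Definition nonempty_set d := {sigma : {set 'I_d} | sigma != finset.set0}.
Definition indices d (sigma : nonempty_set d) := {i : 'I_d | i \in val sigma}.

(* F(x_1 + ... + x_d) = F(0) + sum over sigma of F_sigma(x_i, i in sigma),
   naturally in x, with each F_sigma vanishing as soon as one x_i is zero. *)
Record cross_decomposition d := CrossDecomposition {
  ce_part : forall sigma : nonempty_set d, functor k (powC (indices sigma) A);
  ce_reduced : forall sigma (x : powC (indices sigma) A) i,
    is_zero (x i) -> forall v : ce_part sigma x, v = 0;
  ce_incl0 : nattrans (const_functor (powC 'I_d A) (F (zero_obj A)))
                      (restr (dsum_functor A d) F);
  ce_incl : forall sigma : nonempty_set d,
    nattrans (restr (pow_restr (fun i : indices sigma => val i) A) (ce_part sigma))
             (restr (dsum_functor A d) F);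
  ce_bij : forall x : powC 'I_d A, bijective
    (fun w : (F (zero_obj A) *
              (forall sigma, ce_part sigma (fun i => x (val i))))%type =>
       ce_incl0 x w.1 + \sum_sigma ce_incl sigma x (w.2 sigma)) }.

Lemma setT_nonempty d : [set: 'I_d.+1]%SET != finset.set0.
Proof. by apply/set0Pn; exists ord0; rewrite inE. Qed.

Definition cross_effect d (D : cross_decomposition d.+1) :=
  ce_part D (exist _ [set: 'I_d.+1]%SET (setT_nonempty d)).

(* F is of degree less than d.+1. The decomposition exists and is unique up to
   isomorphism, so the choice of D is immaterial. *)
Definition degree_le d := exists D : cross_decomposition d.+1,
  forall x (v : cross_effect D x), v = 0.

Definition polynomial := exists d, degree_le d.
End Polynomial.

Definition AP_type (k : comPzRingType) (A : additive) (B : functor k (prodC A A)) :=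
  (forall x : A, antipolynomial (restr (insl A x) B)) /\
  (forall x : A, polynomial (restr (insr A x) B)).

Definition op_bifunctor (k : comPzRingType) (A : additive)
    (B : functor k (prodC (opA A) (opA A))) : functor k (op (prodC A A)) :=
  @Functor k (op (prodC A A)) (fun x => B x) (fun x y u => fmap B u)
    (fun x y u => @fmap_linear _ _ B x y u) (fun x => @fmap1 _ _ B x)
    (fun x y z g f => @fmapM _ _ B x y z g f).

(* Main.v *)
(** The direct sum functor is both left and right adjoint to the diagonal, so
    Ext(Delta^* B, Delta^* C) is Ext(B, C(x + y, x + y)) and the restriction is
    induced by the split inclusion of C(x, y) in C(x + y, x + y). One has to show
    that Ext from B to the complement vanishes. The complement is filtered by
    ker (C(x + y, x + y) -> C(x, x + y)) and ker (C(x, x + y) -> C(x, y)); fixing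
    one variable and using the adjunction again, this comes down to
    Ext_A(F, G) = 0 when one of F and G is polynomial, the other one factors
    through A/I with I cotrivial, and G(0) = 0.

    A polynomial p = sum p_j X^j with integer coefficients acts on every functor
    by sum p_j F(j id), naturally in F. If F(N id) = F(0) the ideal of X^N - 1 acts
    by zero; if F has degree at most d the ideal of (X - 1)^(d+1) does. As N is
    invertible in k, X - 1 is a sum of elements of these two ideals up to a unit,
    and it acts by the identity on reduced functors: Ext is killed by a unit. The
    exponent N depends on the object, so antipolynomial functors are first
    resolved by sums of k[(A/I)(x, -)], or coresolved by products of functors of
    maps from (A/I)(-, x) to a module; for each of these N is fixed.

    The statement on Tor follows by duality: Hom(F (x)_C G, M) is the module of
    natural transformations from F to Hom(G, M), and a chain map is a
    quasi-isomorphism as soon as its duals with values in every M are. *)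

From HB Require Import structures.
From mathcomp Require Import all_boot all_algebra finmap.
From mathcomp Require Import generic_quotient ring_quotient ring.
From mathcomp Require Import boolp classical_sets functions cardinality fsbigop.

Set Implicit Arguments.
Unset Strict Implicit.
Unset Printing Implicit Defensive.

Import GRing.Theory.
Require Import Defs.
Local Open Scope quotient_scope.
Local Open Scope ring_scope.
Local Open Scope cat_scope.

(** * Lifting chain maps *)

(** Polynomials do not act here through a ring structure: [p] is evaluated on the sequence j -> F(j
    id) v, and multiplication by X shifts that sequence, whereas composing two such actions would
    multiply the arguments. What is used is only that the polynomials killing all shifts of a
    sequence form an ideal. Since the j id commute with every morphism, additivity of F is
    irrelevant to naturality.

    Reducedness of G cannot be avoided: constant functors are at once polynomial and antipolynomial,
    and there are nonzero maps between them. This is why the complement is cut into kernels of two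
    projections that each alter a single slot: the zero map in the added variable factors through
    the projection and so kills the kernel.

    That N is invertible in k is the arithmetic content of cotriviality. Let N be the order of the
    identity in (A/I)(x, x) and p a prime dividing N. Then the identity is not a multiple of p, so
    (A/I)(x, x) maps onto Z/p, and k/pk is a quotient of the zero module k (x) (A/I)(x, x). *)

Lemma dependent_choice_nat (T : nat -> Type) (I : forall n, T n -> Prop)
    (Q : forall n, T n -> T n.+1 -> Prop) :
  (exists t, I 0 t) ->
  (forall n t, I n t -> exists t', Q n t t' /\ I n.+1 t') ->
  exists s : forall n, T n, I 0 (s 0) /\ forall n, Q n (s n) (s n.+1).
Proof.
move=> /cid[t0 I0] step.
pose next n (t : {t | I n t}) : {t' | I n.+1 t'} :=
  exist _ _ (proj2 (projT2 (cid (step n (sval t) (svalP t))))).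
pose s n : {t | I n t} := nat_rect (fun n => {t | I n t}) (exist _ t0 I0) next n.
exists (fun n => sval (s n)); split=> // n /=.
by rewrite /next /=; case: cid => t' [].
Qed.

Section NatTransLemmas.
Variables (k : comPzRingType) (C : category).
Implicit Types F G H : functor k C.

Lemma ntcompE F G H (b : nattrans G H) (a : nattrans F G) x v :
  ntcomp b a x v = b x (a x v).
Proof. by []. Qed.

Lemma ntcompA F G H K (c : nattrans H K) (b : nattrans G H) (a : nattrans F G) :
  ntcomp c (ntcomp b a) = ntcomp (ntcomp c b) a.
Proof. exact: nattransP. Qed.

Lemma nt_addE F G (a b : nattrans F G) x v : (a + b) x v = a x v + b x v.
Proof. by []. Qed.
Lemma nt_subE F G (a b : nattrans F G) x v : (a - b) x v = a x v - b x v.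
Proof. by []. Qed.

Definition nt_id F : nattrans F F :=
  @NatTrans k C F F (fun x v => v) (fun x c v w => erefl) (fun x y u v => erefl).

Lemma nt_ap F G (a b : nattrans F G) x v : a = b -> a x v = b x v.
Proof. by move=> ->. Qed.

End NatTransLemmas.
Arguments nt_ap {k C F G a b} x v _.

Section Lifting.
Variables (k : comPzRingType) (C : category).
Variables (F F' : functor k C) (P : resolution F) (R : resolution F').
Hypothesis projP : res_projective P.

Definition is_chain_map (f : forall n, nattrans (P n) (R n)) :=
  forall n, ntcomp (res_d R n) (f n.+1) = ntcomp (f n) (res_d P n).

Lemma res_augd x v : res_aug P x (res_d P 0 x v) = 0.
Proof. by apply/res_exact0; exists v. Qed.

Lemma res_dd n x v : res_d P n x (res_d P n.+1 x v) = 0.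
Proof. by apply/res_exactS; exists v. Qed.

Lemma lift_exists (u : nattrans F F') :
  exists f, is_chain_map f /\
    ntcomp (res_aug R) (f 0) = ntcomp u (res_aug P).
Proof.
(* The invariant records that the next lift exists, which is what each step of the dependent choice
   consumes; the condition on augmentations is imposed in degree 0 only. *)
pose I n (f : nattrans (P n) (R n)) :=
  (exists g : nattrans (P n.+1) (R n.+1),
     ntcomp (res_d R n) g = ntcomp f (res_d P n)) /\
  match n return nattrans (P n) (R n) -> Prop with
  | 0 => fun f => ntcomp (res_aug R) f = ntcomp u (res_aug P)
  | n.+1 => fun=> True end f.
have [||f [[_ f0] fS]] := @dependent_choice_nat (fun n => nattrans (P n) (R n)) I
  (fun n f g => ntcomp (res_d R n) g = ntcomp f (res_d P n)).
- have [f ef] := projP (ntcomp u (res_aug P)) (@res_surj _ _ F' R).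
  exists f; split=> //; apply: (projective_lift (e := res_aug R)) => //.
    exact: res_exact0.
  by move=> x v; rewrite -ntcompE ntcompA ef /= res_augd linear0.
- move=> n f [[g eg] _]; exists g; split=> //; split=> //.
  apply: (projective_lift (e := res_d R n)) => //; first exact: res_exactS.
  by move=> x v; rewrite -ntcompE ntcompA eg /= res_dd linear0.
by exists f; split.
Qed.

Lemma lift_null_homotopic (f : forall n, nattrans (P n) (R n)) :
  is_chain_map f -> (forall x v, res_aug R x (f 0 x v) = 0) ->
  exists h : forall n, nattrans (P n) (R n.+1),
    f 0 = ntcomp (res_d R 0) (h 0) /\
    forall n, f n.+1 = ntcomp (res_d R n.+1) (h n.+1) + ntcomp (h n) (res_d P n).
Proof.
move=> fd f0.
pose Q n (h : nattrans (P n) (R n.+1)) (h' : nattrans (P n.+1) (R n.+2)) :=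
  f n.+1 = ntcomp (res_d R n.+1) h' + ntcomp h (res_d P n).
pose I n (h : nattrans (P n) (R n.+1)) := (exists h', Q n h h') /\
  match n return nattrans (P n) (R n.+1) -> Prop with
  | 0 => fun h => f 0 = ntcomp (res_d R 0) h
  | n.+1 => fun=> True end h.
have lift n (h : nattrans (P n) (R n.+1)) :
    (forall x v, res_d R n x (h x (res_d P n x v)) = res_d R n x (f n.+1 x v)) ->
    exists h', Q n h h'.
  move=> eh; have [||h' eh'] := @projective_lift k C (P n.+1) (R n.+2) (R n.+1)
    (R n) (res_d R n.+1) (res_d R n) (f n.+1 - ntcomp h (res_d P n)) (@projP n.+1).
  - by move=> x w; exact: res_exactS.
  - by move=> x v; rewrite nt_subE ntcompE linearB /= eh subrr.
  by exists h'; rewrite /Q eh' subrK.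
have [||h [[_ h0] hS]] := @dependent_choice_nat _ I Q.
- have [||h eh] := @projective_lift k C (P 0) (R 1) (R 0)
    F' (res_d R 0) (res_aug R) (f 0) (@projP 0); [exact: res_exact0|exact: f0|].
  exists h; split; last by [].
  apply: lift => x v; rewrite -[LHS]/(ntcomp (res_d R 0) h x _) eh.
  by rewrite -[RHS]/(ntcomp (res_d R 0) (f 1) x v) fd.
- move=> n h [[h' eh'] _]; exists h'; split=> //; split=> //.
  apply: lift => x v.
  rewrite -[RHS]/(ntcomp (res_d R n.+1) (f n.+2) x v) fd ntcompE eh'.
  by rewrite nt_addE !ntcompE res_dd linear0 addr0.
by exists h.
Qed.

(** With f = d h + h d, the term b d h dies because [b] is a cocycle, and b h d is a coboundary.
    Used for the difference of two lifts of one map, and for a polynomial acting by zero on [F]. *)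
Lemma lift_null_ext (f : forall n, nattrans (P n) (R n)) G n (b : nattrans (R n) G) :
  is_chain_map f -> (forall x v, res_aug R x (f 0 x v) = 0) ->
  ext_out R G n b = 0 -> exists c, ext_in P G n c = ntcomp b (f n).
Proof.
move=> fd f0 b0; have [h [h0 hS]] := lift_null_homotopic fd f0.
have bd x v : b x (res_d R n x v) = 0 by rewrite -ntcompE (nt_ap x v b0).
case: n b b0 bd => [|n] b b0 bd.
  by exists 0; rewrite linear0 h0; apply: nattransP => x v; rewrite !ntcompE bd.
exists (ntcomp b (h n)); rewrite hS; apply: nattransP => x v.
by rewrite ntcompE nt_addE linearD /= bd add0r.
Qed.

End Lifting.

(** * Vanishing of Ext in one degree, independently of the resolution *)

Section Vanishing.
Variables (k : comPzRingType) (C : category).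
Implicit Types F G : functor k C.

(** Vanishing of Ext^n(F, G) in terms of cochains, which avoids the quotient module. In degree 0,
    where [ext_in] is zero, it says that there is no nonzero map from [F] to [G]. *)
Definition exact_at F (P : resolution F) G n := forall b : nattrans (P n) G,
  ext_out P G n b = 0 -> exists c, ext_in P G n c = b.

Lemma ext_outE F (P : resolution F) G n (b : nattrans (P n) G) :
  ext_out P G n b = 0 <-> forall x v, b x (res_d P n x v) = 0.
Proof.
split=> [b0 x v|b0]; first by rewrite -ntcompE (nt_ap x v b0).
by apply: nattransP => x v; rewrite -[LHS]/(b x (res_d P n x v)) b0.
Qed.

Lemma ext_in_comp F (P : resolution F) G G' n (q : nattrans G G') c :
  ntcomp q (ext_in P G n c) = ext_in P G' n (ntcomp q c).
Proof. by case: n c => [|n] c; apply: nattransP => x v //=; rewrite linear0. Qed.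

Lemma ext_in_chain F (P : resolution F) F' (Q : resolution F')
    (f : forall n, nattrans (Q n) (P n)) G n c : is_chain_map f ->
  exists c', ntcomp (ext_in P G n c) (f n) = ext_in Q G n c'.
Proof.
move=> fd; case: n c => [|n] c; first by exists 0; apply: nattransP.
exists (ntcomp c (f n)); apply: nattransP => x v.
by rewrite -[LHS]/(c x (res_d P n x (f n.+1 x v))) -[in LHS]ntcompE fd.
Qed.

(** The chain map g f - id lifts the zero map of [F], hence is null-homotopic. *)
Lemma chain_map_homotopic F (Q R : resolution F)
    (f : chain_map Q R) (g : chain_map R Q) G n (b : nattrans (Q n) G) :
  res_projective Q -> ext_out Q G n b = 0 ->
  exists c, ext_in Q G n c = ntcomp (ntcomp b (g n)) (f n) - b.
Proof.
move=> projQ b0.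
pose u n : nattrans (Q n) (Q n) := ntcomp (g n) (f n) - nt_id (Q n).
have ud : is_chain_map u.
  move=> m; apply: nattransP => x v; rewrite !ntcompE !nt_subE /= linearB /=.
  have := nt_ap x (f m.+1 x v) (chain_d g m).
  rewrite !ntcompE => ->.
  by have := nt_ap x v (chain_d f m); rewrite !ntcompE => ->.
have u0 x v : res_aug Q x (u 0 x v) = 0.
  rewrite /u nt_subE linearB /=; have := nt_ap x (f 0 x v) (chain_aug g).
  by have := nt_ap x v (chain_aug f); rewrite !ntcompE => -> ->; rewrite subrr.
have [c ec] := lift_null_ext projQ ud u0 b0.
by exists c; rewrite ec; apply: nattransP => x v; rewrite !ntcompE nt_subE linearB.
Qed.

Lemma exact_at_indep F (P Q : resolution F) G n :
  res_projective P -> res_projective Q -> exact_at P G n -> exact_at Q G n.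
Proof.
move=> projP projQ exP b b0.
have [f] := chain_map_exists P projQ; have [g] := chain_map_exists Q projP.
have bg : ext_out P G n (ntcomp b (g n)) = 0.
  apply/ext_outE => x v; rewrite ntcompE -[g n x _]ntcompE -chain_d ntcompE.
  by move/ext_outE: b0 => ->.
have [c ec] := exP _ bg.
have [c' ec'] := chain_map_homotopic f g projQ b0.
have [c'' ec''] := ext_in_chain c (chain_d f).
exists (c'' - c'); rewrite linearB /= -ec'' ec' ec.
by rewrite opprB addrC subrK.
Qed.

(** Existential in the resolution, so that it can be proved with a mapping cone or a direct sum of
    resolutions; [ext_zeroP] carries it to any projective resolution. *)
Definition ext_zero n F G := exists P : resolution F, res_projective P /\ exact_at P G n.

Lemma ext_zeroP n F G (P : resolution F) : res_projective P ->
  ext_zero n F G -> exact_at P G n.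
Proof. by move=> projP [Q [projQ exQ]]; apply: (exact_at_indep projQ). Qed.

Definition ext_zeros F G := forall n, ext_zero n F G.

End Vanishing.

(** * Vanishing of Ext in the second argument *)

Section ShortExact.
Variables (k : comPzRingType) (C : category).

Record short_exact (G' G G'' : functor k C) (i : nattrans G' G)
    (q : nattrans G G'') : Prop := ShortExact {
  ses_inj : forall x v, i x v = 0 -> v = 0;
  ses_surj : forall x w, exists v, q x v = w;
  ses_exact : forall x v, q x v = 0 <-> exists w, i x w = v }.

Lemma ker_short_exact (G H : functor k C) (q : nattrans G H) :
  (forall x w, exists v, q x v = w) -> short_exact (ker_incl q) q.
Proof.
move=> qsurj; split=> // [x v v0|x v]; first exact/val_inj.
split=> [q0|[w <-]]; last exact/eqP/(cycleP w).
have vc : v \in cycle (q x) by apply/eqP.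
by exists (Cycle vc).
Qed.

Variables (F : functor k C) (P : resolution F).
Hypothesis projP : res_projective P.

Lemma ext_out_in G n (c : nattrans (P n.-1) G) : ext_out P G n (ext_in P G n c) = 0.
Proof.
case: n c => [|n] c; apply/ext_outE => x v //.
by rewrite -[LHS]/(c x (res_d P n x (res_d P n.+1 x v))) res_dd linear0.
Qed.

Variables (G' G G'' : functor k C) (i : nattrans G' G) (q : nattrans G G'').
Hypothesis ses : short_exact i q.

Lemma ses_qi x v : q x (i x v) = 0.
Proof. by apply/(ses_exact ses); exists v. Qed.

Lemma ses_lift_sub n (b : nattrans (P n) G) : (forall x v, q x (b x v) = 0) ->
  exists b', ntcomp i b' = b.
Proof. by apply: projective_lift => //; exact: (ses_exact ses). Qed.

Lemma ses_lift_quot n (b : nattrans (P n) G'') : exists b', ntcomp q b' = b.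
Proof. by apply: projP; exact: (ses_surj ses). Qed.

Lemma ses_cocycle_sub n (b : nattrans (P n) G') :
  (forall x v, i x (b x (res_d P n x v)) = 0) -> ext_out P G' n b = 0.
Proof. by move=> ib; apply/ext_outE => x v; apply: (ses_inj ses). Qed.

(** The stretch Ext^n(F, G'') -> Ext^(n+1)(F, G') -> Ext^(n+1)(F, G) of the long exact sequence. A
    cochain [c] bounding [b] in [G] becomes a cocycle in [G''], hence a coboundary there;
    subtracting a lift of that coboundary pushes [c] into [G']. *)
Lemma ses_exact_sub n : exact_at P G'' n -> exact_at P G n.+1 -> exact_at P G' n.+1.
Proof.
move=> ex'' ex b /ext_outE b0.
have [|c ec] := ex (ntcomp i b).
  by apply/ext_outE => x v; rewrite ntcompE b0 linear0.
have ecE x v : c x (res_d P n x v) = i x (b x v) by rewrite -[RHS]/(ntcomp i b x v) -ec.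
have [|e ee] := ex'' (ntcomp q c).
  by apply/ext_outE => x v; rewrite ntcompE ecE ses_qi.
have [e1 ee1] := ses_lift_quot e.
have [|c' ec'] := @ses_lift_sub n (c - ext_in P G n e1).
  move=> x v; rewrite nt_subE linearB /= -[q x (c x v)]/(ntcomp q c x v) -ee.
  by rewrite -[X in _ - X]/(ntcomp q (ext_in P G n e1) x v) ext_in_comp ee1 subrr.
exists c'; apply: nattransP => x v; apply/eqP; rewrite -subr_eq0; apply/eqP.
apply: (ses_inj ses); rewrite linearB /= -ecE.
rewrite -[X in X - _]/(ntcomp i c' x (res_d P n x v)) ec' nt_subE.
by have /ext_outE -> := ext_out_in e1; rewrite subr0 subrr.
Qed.

Lemma ses_exact_sub0 : exact_at P G 0 -> exact_at P G' 0.
Proof.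
move=> ex b /ext_outE b0; have [|c ec] := ex (ntcomp i b).
  by apply/ext_outE => x v; rewrite ntcompE b0 linear0.
exists 0; rewrite linear0; apply: nattransP => x v; apply/esym/(ses_inj ses).
by rewrite -[LHS]/(ntcomp i b x v) -ec.
Qed.

(** The stretch Ext^n(F, G) -> Ext^n(F, G'') -> Ext^(n+1)(F, G'): the coboundary of a lift of [b] to
    [G] lies in [G'], is bounded there by [c], and the lift minus [c] is a cocycle of [G]. *)
Lemma ses_exact_quot n : exact_at P G' n.+1 -> exact_at P G n -> exact_at P G'' n.
Proof.
move=> ex' ex b /ext_outE b0; have [b1 eb1] := ses_lift_quot b.
have [|b' eb'] := @ses_lift_sub n.+1 (ntcomp b1 (res_d P n)).
  by move=> x v; rewrite -[LHS]/(ntcomp q b1 x (res_d P n x v)) eb1.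
have [|c ec] := ex' b'.
  apply: ses_cocycle_sub => x v; rewrite -[LHS]/(ntcomp i b' x (res_d P n.+1 x v)).
  by rewrite eb' ntcompE res_dd linear0.
have [|e ee] := ex (b1 - ntcomp i c).
  apply/ext_outE => x v; rewrite nt_subE -[X in X - _]/(ntcomp b1 (res_d P n) x v) -eb'.
  by rewrite -ec subrr.
exists (ntcomp q e); rewrite -ext_in_comp ee -eb1; apply: nattransP => x v.
by rewrite ntcompE nt_subE linearB /= ses_qi subr0.
Qed.

End ShortExact.

Section SecondArgument.
Variables (k : comPzRingType) (C : category).
Implicit Types F G : functor k C.

Lemma ext_zero_retract F G G1 n (s : nattrans G G1) (r : nattrans G1 G) :
  (forall x v, r x (s x v) = v) -> ext_zero n F G1 -> ext_zero n F G.
Proof.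
move=> rs [P [projP ex]]; exists P; split=> // b /ext_outE b0.
have [|c ec] := ex (ntcomp s b).
  by apply/ext_outE => x v; rewrite ntcompE b0 linear0.
exists (ntcomp r c); rewrite -ext_in_comp ec; apply: nattransP => x v.
exact: rs.
Qed.

Lemma ext_zeros_retract F G G1 (s : nattrans G G1) (r : nattrans G1 G) :
  (forall x v, r x (s x v) = v) -> ext_zeros F G1 -> ext_zeros F G.
Proof. by move=> rs V n; apply: ext_zero_retract (V n). Qed.

End SecondArgument.

(** Dimension shifting: Ext^(n+1)(F, G) is controlled by Ext^n(F, G'), and the cokernel [G'] is
    again in the class [K]. Degree 0 only needs that [i] is injective. *)
Lemma ext_zeros_coresolve (k : comPzRingType) (C : category) (F : functor k C)
    (K : functor k C -> Prop) :
  (forall G, K G -> exists (R G' : functor k C) (i : nattrans G R) (q : nattrans R G'),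
     [/\ short_exact i q, ext_zeros F R & K G']) ->
  forall G, K G -> ext_zeros F G.
Proof.
move=> step G KG n; exists (free_resolution F).
have projP := @free_resolution_projective k C F; split=> //.
elim: n G KG => [|n IHn] G /step[R [G' [i [q [ses VR KG']]]]].
  exact/(ses_exact_sub0 ses)/(ext_zeroP projP)/VR.
by apply: (ses_exact_sub projP ses); [exact: IHn|exact/(ext_zeroP projP)/VR].
Qed.

Section LinearImage.
Variables (k : comPzRingType) (U V : lmodType k) (L : {linear U -> V}).

Definition range_pred : {pred V} := fun w => `[< exists u, L u = w >].
Lemma range_submod : submod_closed range_pred.
Proof.
split=> [|a v w /asboolP[v' <-] /asboolP[w' <-]]; apply/asboolP.
  by exists 0; rewrite linear0.
by exists (a *: v' + w'); rewrite linearP.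
Qed.
HB.instance Definition _ :=
  GRing.isSubmodClosed.Build k V range_pred range_submod.

Lemma coker_eq0 v : quot_pi range_pred v = 0 <-> exists u, L u = v.
Proof.
have <- : quot_pi range_pred 0 = 0 by rewrite linear0.
apply: (iff_trans (quot_piE _ _ _)); rewrite subr0.
by split=> [/asboolP|/asboolP].
Qed.
End LinearImage.

Section Cokernel.
Variables (k : comPzRingType) (C : category) (G R : functor k C) (i : nattrans G R).

Lemma coker_fmap_subproof x y (u : hom x y) v : v \in range_pred (i x) ->
  (quot_pi (range_pred (i y)) \o fmap R u) v = 0.
Proof.
move=> /asboolP[w <-]; rewrite /= -(linear0 (quot_pi (range_pred (i y)))).
by apply/quot_piE; rewrite subr0; apply/asboolP; exists (fmap G u w); exact: naturality.
Qed.

Lemma coker_fmapE x y (u : hom x y) v :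
  quot_ext (@coker_fmap_subproof x y u) (quot_pi (range_pred (i x)) v) =
  quot_pi (range_pred (i y)) (fmap R u v).
Proof. exact: quot_extE. Qed.

Definition coker_functor : functor k C.
Proof.
refine (@Functor k C (fun x => quotmod (range_pred (i x)))
  (fun x y u => quot_ext (@coker_fmap_subproof x y u)) _ _ _).
- by move=> x y u; apply: linearP.
- by move=> x q; have [v ->] := quot_surj q; rewrite coker_fmapE fmap1.
- move=> x y z g f q; have [v ->] := quot_surj q.
  by rewrite !coker_fmapE fmapM.
Defined.

Definition coker_proj : nattrans R coker_functor.
Proof.
refine (@NatTrans k C R coker_functor (fun x => quot_pi (range_pred (i x))) _ _).
- by move=> x; apply: linearP.
- by move=> x y u v; rewrite [RHS]coker_fmapE.
Defined.

Lemma coker_proj_surj x w : exists v, coker_proj x v = w.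
Proof. by have [v ->] := quot_surj w; exists v. Qed.

Lemma coker_proj0 x v : coker_proj x v = 0 <-> exists w, i x w = v.
Proof. exact: coker_eq0. Qed.

Lemma coker_short_exact : (forall x v, i x v = 0 -> v = 0) -> short_exact i coker_proj.
Proof. by split=> //; [exact: coker_proj_surj|exact: coker_proj0]. Qed.

End Cokernel.

Section DependentProduct.
Variables (k : comPzRingType) (T : Type) (H : T -> lmodType k).

Definition dprod := forall t, H t.
Implicit Types f g : dprod.

HB.instance Definition _ := gen_eqMixin dprod.
HB.instance Definition _ := gen_choiceMixin dprod.

Let add f g : dprod := fun t => f t + g t.
Let opp f : dprod := fun t => - f t.
Let zero : dprod := fun t => 0.
Let scale a f : dprod := fun t => a *: f t.

Lemma dprodP f g : (forall t, f t = g t) -> f = g.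
Proof. exact: functional_extensionality_dep. Qed.

Let addA : associative add.
Proof. by move=> f g h; apply: dprodP => t; apply: addrA. Qed.
Let addC : commutative add.
Proof. by move=> f g; apply: dprodP => t; apply: addrC. Qed.
Let add0 : left_id zero add.
Proof. by move=> f; apply: dprodP => t; apply: add0r. Qed.
Let addN : left_inverse zero opp add.
Proof. by move=> f; apply: dprodP => t; apply: addNr. Qed.
HB.instance Definition _ := GRing.isZmodule.Build dprod addA addC add0 addN.

Let scaleA a b f : scale a (scale b f) = scale (a * b) f.
Proof. by apply: dprodP => t; apply: scalerA. Qed.
Let scale1 : left_id 1 scale.
Proof. by move=> f; apply: dprodP => t; apply: scale1r. Qed.
Let scaleDr : right_distributive scale +%R.
Proof. by move=> a f g; apply: dprodP => t; apply: scalerDr. Qed.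
Let scaleDl f : {morph scale^~ f : a b / a + b}.
Proof. by move=> a b; apply: dprodP => t; apply: scalerDl. Qed.
HB.instance Definition _ := GRing.Zmodule_isLmodule.Build k dprod
  scaleA scale1 scaleDr scaleDl.

Lemma dprodDE f g t : (f + g) t = f t + g t. Proof. by []. Qed.
Lemma dprodZE a f t : (a *: f) t = a *: f t. Proof. by []. Qed.
Lemma dprod0E t : (0 : dprod) t = 0. Proof. by []. Qed.

End DependentProduct.

Section Submodule.
Variables (k : comPzRingType) (M : lmodType k) (N : submodClosed M).

Record submod := Submod { submod_val : M; submodP : submod_val \in N }.
HB.instance Definition _ := [isSub for submod_val].
HB.instance Definition _ := [Choice of submod by <:].
HB.instance Definition _ := [SubChoice_isSubLmodule of submod by <:].

End Submodule.

Section ProductFunctor.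
Variables (k : comPzRingType) (C : category) (T : Type) (H : T -> functor k C).

Definition prod_functor : functor k C.
Proof.
refine (@Functor k C (fun x => dprod (fun t => H t x))
  (fun x y u f t => fmap (H t) u (f t)) _ _ _).
- by move=> x y u a f g; apply: dprodP => t; rewrite linearP.
- by move=> x f; apply: dprodP => t; rewrite fmap1.
- by move=> x y z g f h; apply: dprodP => t; rewrite fmapM.
Defined.

Definition prod_proj t : nattrans prod_functor (H t).
Proof.
by refine (@NatTrans k C prod_functor (H t) (fun x f => f t) _ _).
Defined.

Definition prod_pair G (b : forall t, nattrans G (H t)) : nattrans G prod_functor.
Proof.
refine (@NatTrans k C G prod_functor (fun x v t => b t x v) _ _).
- by move=> x a v w; apply: dprodP => t; rewrite linearP.
- by move=> x y u v; apply: dprodP => t; rewrite naturality.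
Defined.

Lemma ext_zeros_prod F : (forall t, ext_zeros F (H t)) -> ext_zeros F prod_functor.
Proof.
move=> V n; exists (free_resolution F).
have projP := @free_resolution_projective k C F; split=> // b /ext_outE b0.
have {V} V t := ext_zeroP projP (V t n).
have exc t : exists c, ext_in (free_resolution F) (H t) n c = ntcomp (prod_proj t) b.
  by apply: V; apply/ext_outE => x v; rewrite ntcompE b0.
pose c t := projT1 (cid (exc t)).
exists (prod_pair c); apply: nattransP => x v; apply: dprodP => t.
rewrite -[RHS]/(ntcomp (prod_proj t) b x v) -(projT2 (cid (exc t))) -/(c t).
rewrite -[LHS]/(ntcomp (prod_proj t) (ext_in _ prod_functor n (prod_pair c)) x v).
by rewrite ext_in_comp; congr (ext_in _ _ n _ x v); apply: nattransP.
Qed.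

End ProductFunctor.

(** * Vanishing of Ext in the first argument *)

Section DirectSum.
Variables (k : comPzRingType) (C : category).

Definition sum_functor (F G : functor k C) : functor k C.
Proof.
refine (@Functor k C (fun x => (F x * G x)%type)
  (fun x y u v => (fmap F u v.1, fmap G u v.2)) _ _ _).
- by move=> x y u a v w; rewrite !linearP.
- by move=> x [v w]; rewrite /= !fmap1.
- by move=> x y z g f v; rewrite !fmapM.
Defined.

Section Maps.
Variables (F G H : functor k C).

Definition sum_inl : nattrans F (sum_functor F G).
Proof.
refine (@NatTrans k C F (sum_functor F G) (fun x v => (v, 0)) _ _).
- by move=> x a v w; congr pair; rewrite -[RHS]/(a *: 0 + 0) scaler0 addr0.
- by move=> x y u v; rewrite /= linear0.
Defined.

Definition sum_inr : nattrans G (sum_functor F G).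
Proof.
refine (@NatTrans k C G (sum_functor F G) (fun x v => (0, v)) _ _).
- by move=> x a v w; congr pair; rewrite -[RHS]/(a *: 0 + 0) scaler0 addr0.
- by move=> x y u v; rewrite /= linear0.
Defined.

Definition sum_copair (a : nattrans F H) (b : nattrans G H) :
  nattrans (sum_functor F G) H.
Proof.
refine (@NatTrans k C (sum_functor F G) H (fun x v => a x v.1 + b x v.2) _ _).
- by move=> x c v w; rewrite !linearP scalerDr addrACA.
- by move=> x y u v; rewrite /= !naturality linearD.
Defined.

Lemma sum_copair_eta (b : nattrans (sum_functor F G) H) :
  sum_copair (ntcomp b sum_inl) (ntcomp b sum_inr) = b.
Proof.
apply: nattransP => x [v w] /=; rewrite -linearD; congr (b x _).
by congr pair; rewrite /= ?addr0 ?add0r.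
Qed.
End Maps.

Definition sum_pair (F G H : functor k C) (a : nattrans H F) (b : nattrans H G) :
  nattrans H (sum_functor F G).
Proof.
refine (@NatTrans k C H (sum_functor F G) (fun x v => (a x v, b x v)) _ _).
- by move=> x c v w; rewrite !linearP.
- by move=> x y u v; rewrite /= !naturality.
Defined.

Lemma sum_projective F G : projective F -> projective G ->
  projective (sum_functor F G).
Proof.
move=> projF projG M N g f gsurj.
have [a ea] := projF _ _ g (ntcomp f (sum_inl F G)) gsurj.
have [b eb] := projG _ _ g (ntcomp f (sum_inr F G)) gsurj.
exists (sum_copair a b); rewrite -[RHS]sum_copair_eta -ea -eb.
by apply: nattransP => x v; rewrite /= linearD.
Qed.

End DirectSum.

Section MappingCone.
Variables (k : comPzRingType) (C : category).
Variables (S L F : functor k C) (i : nattrans S L) (q : nattrans L F).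
Hypothesis ses : short_exact i q.
Variables (Q : resolution S) (R : resolution L).
Variable f : forall n, nattrans (Q n) (R n).
Hypothesis fd : is_chain_map f.
Hypothesis faug : ntcomp (res_aug R) (f 0) = ntcomp i (res_aug Q).

Let fdE n x v : res_d R n x (f n.+1 x v) = f n x (res_d Q n x v).
Proof. exact: (nt_ap x v (fd n)). Qed.
Let faugE x v : res_aug R x (f 0 x v) = i x (res_aug Q x v).
Proof. exact: (nt_ap x v faug). Qed.

(** The mapping cone of the lift of [i], with the resolution of [S] shifted up by one: a resolution
    of the quotient [F] built from given ones of [S] and [L]. *)
Definition cone_obj n : functor k C :=
  if n is m.+1 then sum_functor (R m.+1) (Q m) else R 0.

Definition cone_d n : nattrans (cone_obj n.+1) (cone_obj n) :=
  match n return nattrans (cone_obj n.+1) (cone_obj n) with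
  | 0 => sum_copair (res_d R 0) (f 0)
  | m.+1 => sum_copair (ntcomp (sum_inl _ _) (res_d R m.+1))
              (sum_pair (f m.+1) (- res_d Q m))
  end.

Lemma cone_dSE m x (v : cone_obj m.+2 x) : cone_d m.+1 x v =
  (res_d R m.+1 x v.1 + f m.+1 x v.2, - res_d Q m x v.2).
Proof. by rewrite /=; congr pair; rewrite /= add0r. Qed.

Lemma cone_surj x w : exists v, ntcomp q (res_aug R) x v = w.
Proof.
have [u <-] := ses_surj ses w; have [v <-] := @res_surj _ _ _ R _ u.
by exists v.
Qed.

Lemma cone_exact0 x w :
  ntcomp q (res_aug R) x w = 0 <-> exists v, cone_d 0 x v = w.
Proof.
rewrite ntcompE (ses_exact ses); split=> [[s es]|[[r s] <-]].
  have [t et] := @res_surj _ _ _ Q _ s.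
  have /res_exact0[r er] : res_aug R x (w - f 0 x t) = 0.
    by rewrite linearB /= faugE et es subrr.
  by exists (r, t); rewrite /= er subrK.
by exists (res_aug Q x s); rewrite /= linearD /= res_augd add0r faugE.
Qed.

Lemma cone_exactS n x w : cone_d n x w = 0 <-> exists v, cone_d n.+1 x v = w.
Proof.
split=> [|[v <-]]; last first.
  rewrite cone_dSE; clear w; case: n v => [|n] v.
    by rewrite /= linearD /= res_dd add0r fdE linearN /= subrr.
  rewrite cone_dSE /= linearD /= res_dd add0r fdE !linearN /= subrr res_dd.
  by apply: injective_projections; rewrite /= ?oppr0.
case: w => r s w0.
(* Once the component [s] is a boundary, adding f t to [r] gives a cycle of [R], and exactness of
   [R] finishes. *)
suff [t et] : exists t, res_d Q n x t = s.
  have rf : res_d R n x (r + f n.+1 x t) = 0.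
    rewrite linearD /= fdE et; case: n r s t et w0 => [|n] r s t et //.
    by rewrite cone_dSE => -[].
  have [u eu] := proj1 (res_exactS _) rf.
  exists (u, - t); rewrite cone_dSE /= eu !linearN /= addrK et opprK.
  by [].
case: n r s w0 => [|n] r s w0.
  (* Only here is injectivity of [i] used: the image of [s] in [S] is zero because it is zero in
     [L]. *)
  apply/res_exact0/(ses_inj ses); rewrite -faugE.
  have : res_aug R x (res_d R 0 x r + f 0 x s) = 0.
    by rewrite -[X in res_aug R x X]/(cone_d 0 x (r, s)) w0 linear0.
  by rewrite linearD /= res_augd add0r.
apply/res_exactS; move: w0; rewrite cone_dSE => -[_ /eqP].
by rewrite oppr_eq0 => /eqP.
Qed.

Definition cone_resolution : resolution F :=
  @Resolution k C F cone_obj cone_d (ntcomp q (res_aug R))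
    cone_surj cone_exact0 cone_exactS.

Lemma cone_projective : res_projective Q -> res_projective R ->
  res_projective cone_resolution.
Proof.
move=> projQ projR [|n]; first exact: (@projR 0).
by apply: sum_projective; [exact: (@projR n.+1)|exact: (@projQ n)].
Qed.

Lemma cone_exact_at0 G : exact_at R G 0 -> exact_at cone_resolution G 0.
Proof.
move=> ex b /ext_outE b0; apply: ex; apply/ext_outE => x v.
have := b0 x (v, 0); rewrite -[res_d _ _ _ _]/(res_d R 0 x v + f 0 x 0).
by rewrite linear0 addr0.
Qed.

(** The stretch Ext^n(S, G) -> Ext^(n+1)(F, G) -> Ext^(n+1)(L, G). The component [bR] is bounded by
    some [c]; then bQ - c f is a cocycle, bounded by some [e], and the pair (c, - e) bounds [b]. *)
Lemma cone_exact_atS G n : exact_at Q G n -> exact_at R G n.+1 ->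
  exact_at cone_resolution G n.+1.
Proof.
move=> exQ exR b /ext_outE b0.
pose bR := ntcomp b (sum_inl _ _) : nattrans (R n.+1) G.
pose bQ := ntcomp b (sum_inr _ _) : nattrans (Q n) G.
have bE x r s : b x (r, s) = bR x r + bQ x s by rewrite -[in LHS](sum_copair_eta b).
have b0' x r s : bR x (res_d R n.+1 x r) + bR x (f n.+1 x s) = bQ x (res_d Q n x s).
  have : b x (cone_d n.+1 x (r, s)) = 0 := b0 x (r, s).
  by rewrite cone_dSE bE linearN linearD /= => /eqP; rewrite subr_eq0 => /eqP.
have [|c ec] := exR bR.
  by apply/ext_outE => x v; have := b0' x v 0; rewrite !linear0 addr0.
have ecE x v : c x (res_d R n x v) = bR x v by rewrite -ec.
have [|e ee] := exQ (bQ - ntcomp c (f n)).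
  apply/ext_outE => x v; rewrite nt_subE ntcompE -fdE ecE.
  by have := b0' x 0 v; rewrite !linear0 add0r => ->; rewrite subrr.
suff [c' ec'] : exists c' : nattrans (cone_obj n) G,
    forall x v, c' x (cone_d n x v) = bR x v.1 + bQ x v.2.
  exists c'; apply: nattransP => x v.
  by rewrite -[LHS]/(c' x (cone_d n x v)) ec' -bE -surjective_pairing.
clearbody bR bQ; clear b b0 bE exQ exR.
(* For n = 0 the cone has no [Q] component in the degree of the bounding cochain; there [ext_in] is
   zero, so [ee] already says that bQ = c f. *)
case: n bR bQ b0' c ec ecE e ee => [|n] bR bQ b0' c _ ecE e ee.
  exists c => x v; rewrite -[cone_d 0 x v]/(res_d R 0 x v.1 + f 0 x v.2).
  rewrite linearD /= ecE; congr (_ + _); apply/esym/eqP.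
  by rewrite -subr_eq0 -[_ - _]/((bQ - ntcomp c (f 0)) x v.2) -ee.
exists (sum_copair c (- e)) => x v; rewrite cone_dSE /= linearD /= ecE -addrA.
congr (_ + _); rewrite linearN opprK /=.
by rewrite -[e x (res_d Q n x v.2)]/(ext_in Q G n.+1 e x v.2) ee nt_subE ntcompE addrC subrK.
Qed.

End MappingCone.

Section FirstArgument.
Variables (k : comPzRingType) (C : category).

Lemma ext_zero_ses_quot (S L F : functor k C) (i : nattrans S L) (q : nattrans L F)
    G n : short_exact i q -> ext_zero n S G -> ext_zero n.+1 L G ->
  ext_zero n.+1 F G.
Proof.
move=> ses VS VL.
have projQ := @free_resolution_projective k C S.
have projR := @free_resolution_projective k C L.
have [f [fd faug]] := lift_exists (free_resolution L) projQ i.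
exists (cone_resolution ses fd faug); split; first exact: cone_projective.
by apply: cone_exact_atS; apply: ext_zeroP.
Qed.

Lemma ext_zero_ses_quot0 (S L F : functor k C) (i : nattrans S L) (q : nattrans L F)
    G : short_exact i q -> ext_zero 0 L G -> ext_zero 0 F G.
Proof.
move=> ses VL.
have projQ := @free_resolution_projective k C S.
have projR := @free_resolution_projective k C L.
have [f [fd faug]] := lift_exists (free_resolution L) projQ i.
exists (cone_resolution ses fd faug); split; first exact: cone_projective.
by apply: cone_exact_at0; apply: ext_zeroP.
Qed.

(** Dimension shifting in the first argument: Ext^(n+1)(F, G) is controlled by Ext^n(S, G) with [S]
    again in [K], and a map out of [F] is determined by its composite with [q]. *)
Lemma ext_zeros_resolve (K : functor k C -> Prop) G :
  (forall F, K F -> exists (S L : functor k C) (i : nattrans S L) (q : nattrans L F),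
     [/\ short_exact i q, ext_zeros L G & K S]) ->
  forall F, K F -> ext_zeros F G.
Proof.
move=> step F KF n.
elim: n F KF => [|n IHn] F /step[S [L [i [q [ses VL KS]]]]].
  exact: ext_zero_ses_quot0 ses (VL 0).
exact: ext_zero_ses_quot ses (IHn _ KS) (VL n.+1).
Qed.

End FirstArgument.

(** * Direct sums of families of modules and of functors *)

Section DirectSumModule.
Variables (k : comPzRingType) (T : Type) (H : T -> lmodType k).

Definition dsum_supp : {pred dprod H} :=
  fun f => `[< exists A : {fset {classic T}}, forall t, t \notin A -> f t = 0 >].

Lemma dsum_supp_submod : submod_closed dsum_supp.
Proof.
split=> [|a f g /asboolP[A fA] /asboolP[B gB]]; apply/asboolP.
  by exists fset0.
exists (A `|` B)%fset => t; rewrite inE negb_or => /andP[tA tB].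
by rewrite dprodDE dprodZE fA // gB // scaler0 addr0.
Qed.
HB.instance Definition _ :=
  GRing.isSubmodClosed.Build k (dprod H) dsum_supp dsum_supp_submod.

Definition dsumM : lmodType k := submod dsum_supp.
Definition dsum_val (f : dsumM) : dprod H := submod_val f.

Lemma dsumMP (f : dsumM) :
  exists A : {fset {classic T}}, forall t, t \notin A -> dsum_val f t = 0.
Proof. by have /asboolP := submodP f. Qed.

Lemma dsumM_eq (f g : dsumM) : (forall t, dsum_val f t = dsum_val g t) -> f = g.
Proof. by move=> fg; apply/val_inj/dprodP. Qed.

Definition dsum_eval t (f : dsumM) : H t := dsum_val f t.
Lemma dsum_eval_linear t : linear (dsum_eval t).
Proof. by []. Qed.
HB.instance Definition _ t :=
  GRing.isLinear.Build k dsumM (H t) _ (dsum_eval t) (@dsum_eval_linear t).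

Section Out.
Variables (M : lmodType k) (b : forall t, {linear H t -> M}).

Definition dsum_out (f : dsumM) : M :=
  \sum_(t \in [set: {classic T}]) b t (dsum_eval t f).

Lemma dsum_outE (A : {fset {classic T}}) (f : dsumM) :
  (forall t, t \notin A -> dsum_val f t = 0) ->
  dsum_out f = \sum_(t <- A) b t (dsum_eval t f).
Proof. by move=> fA; apply: fsbigTE => t /fA e; rewrite /dsum_eval e linear0. Qed.

Lemma dsum_out_linear : linear dsum_out.
Proof.
move=> a f g; have [A fA] := dsumMP f; have [B gB] := dsumMP g.
have fAB t : t \notin (A `|` B)%fset -> dsum_val f t = 0.
  by rewrite inE negb_or => /andP[/fA].
have gAB t : t \notin (A `|` B)%fset -> dsum_val g t = 0.
  by rewrite inE negb_or => /andP[_ /gB].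
rewrite (dsum_outE fAB) (dsum_outE gAB) (@dsum_outE (A `|` B)%fset).
  by rewrite scaler_sumr -big_split; apply: eq_bigr => t _; rewrite !linearP.
move=> t tAB; rewrite -[LHS]/(a *: dsum_val f t + dsum_val g t).
by rewrite fAB // gAB // scaler0 addr0.
Qed.
HB.instance Definition _ := GRing.isLinear.Build k dsumM M _ dsum_out dsum_out_linear.
End Out.

Section In.
Variables (t : T).

Definition dsum_in_fun (v : H t) : dprod H := fun s =>
  if pselect (t = s) is left e then eq_rect t H v s e else 0.

Lemma dsum_in_supp v : dsum_in_fun v \in dsum_supp.
Proof.
apply/asboolP; exists [fset (t : {classic T})]%fset => s; rewrite inE => /eqP st.
by rewrite /dsum_in_fun; case: pselect => // e; case: st; rewrite e.
Qed.

Definition dsum_in v : dsumM := Submod (dsum_in_supp v).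

Lemma dsum_in_linear : linear dsum_in.
Proof.
move=> a v w; apply: dsumM_eq => s; rewrite -[RHS]/(a *: dsum_in_fun v s + dsum_in_fun w s).
rewrite -[LHS]/(dsum_in_fun _ s) /dsum_in_fun; case: pselect => [e|_]; last first.
  by rewrite scaler0 addr0.
by case: s / e.
Qed.
HB.instance Definition _ := GRing.isLinear.Build k (H t) dsumM _ dsum_in dsum_in_linear.

Lemma dsum_in_fun_eq v : dsum_in_fun v t = v.
Proof.
by rewrite /dsum_in_fun; case: pselect => // e; rewrite (Prop_irrelevance e erefl).
Qed.

Lemma dsum_in_fun_neq s v : t <> s -> dsum_in_fun v s = 0.
Proof. by rewrite /dsum_in_fun; case: pselect. Qed.

Lemma dsum_eval_in v : dsum_eval t (dsum_in v) = v.
Proof. exact: dsum_in_fun_eq. Qed.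
End In.

Lemma dsumM_expand (A : {fset {classic T}}) (f : dsumM) :
  (forall t, t \notin A -> dsum_val f t = 0) ->
  f = \sum_(t <- A) dsum_in (dsum_eval t f).
Proof.
move=> fA; apply: dsumM_eq => s; rewrite -[RHS]/(dsum_eval s _) raddf_sum /=.
have [sA|sA] := boolP ((s : {classic T}) \in A); last first.
  rewrite fA // big1_fset // => t tA _; apply: dsum_in_fun_neq => ts.
  by move: tA; rewrite ts (negPf sA).
rewrite (big_fsetD1 _ sA) /= dsum_in_fun_eq big1_fset ?addr0 // => t.
by rewrite !inE => /andP[/eqP ts _] _; apply: dsum_in_fun_neq.
Qed.

Lemma dsum_out_in (M : lmodType k) (b : forall t, {linear H t -> M}) t v :
  dsum_out b (dsum_in v) = b t v.
Proof.
rewrite (@dsum_outE _ _ [fset (t : {classic T})]%fset).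
  by rewrite big_seq_fset1 dsum_eval_in.
by move=> s; rewrite inE => /eqP st; apply: dsum_in_fun_neq => ts; case: st; rewrite ts.
Qed.

Lemma dsumM_ext (M : lmodType k) (a b : {linear dsumM -> M}) :
  (forall t v, a (dsum_in (t := t) v) = b (dsum_in v)) -> a =1 b.
Proof.
move=> ab f; have [A fA] := dsumMP f; rewrite (dsumM_expand fA) !raddf_sum.
by apply: eq_bigr => t _; exact: ab.
Qed.

End DirectSumModule.
Arguments dsum_supp {k T} H _.

Section DirectSumFunctor.
Variables (k : comPzRingType) (C : category) (T : Type).
Implicit Types H : T -> functor k C.

Lemma dsum_map_supp (H H' : T -> lmodType k) (a : forall t, H t -> H' t) (f : dsumM H) :
  (forall t, a t 0 = 0) ->
  (fun t => a t (dsum_val f t)) \in dsum_supp H'.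
Proof.
move=> a0; have [A fA] := dsumMP f; apply/asboolP; exists A => t tA.
by rewrite fA // a0.
Qed.

Definition coprod_functor_fmap H x y (u : hom x y) (f : dsumM (H^~ x)) : dsumM (H^~ y) :=
  Submod (dsum_map_supp (a := fun t => fmap (H t) u) f (fun t => linear0 _)).

Definition coprod_functor H : functor k C.
Proof.
refine (@Functor k C (fun x => dsumM (H^~ x)) (@coprod_functor_fmap H) _ _ _).
- by move=> x y u a f g; apply: dsumM_eq => t; apply: linearP.
- by move=> x f; apply: dsumM_eq => t; apply: fmap1.
- by move=> x y z g f v; apply: dsumM_eq => t; apply: fmapM.
Defined.

Definition dsum_map H H' (a : forall t, nattrans (H t) (H' t)) :
  nattrans (coprod_functor H) (coprod_functor H').
Proof.
refine (@NatTrans k C (coprod_functor H) (coprod_functor H')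
  (fun x f => Submod (dsum_map_supp (a := fun t => a t x) f (fun t => linear0 _))) _ _).
- by move=> x c f g; apply: dsumM_eq => t; apply: linearP.
- by move=> x y u f; apply: dsumM_eq => t; apply: naturality.
Defined.

Definition dsum_inj H t : nattrans (H t) (coprod_functor H).
Proof.
refine (@NatTrans k C (H t) (coprod_functor H) (fun x v => dsum_in (H := H^~ x) v) _ _).
- by move=> x; exact: (@dsum_in_linear k T (H^~ x) t).
- move=> x y u v; apply: dsumM_eq => s.
  rewrite -[RHS]/(fmap (H s) u (dsum_in_fun (H := H^~ x) v s)).
  rewrite -[LHS]/(dsum_in_fun (H := H^~ y) _ s) /dsum_in_fun.
  by case: pselect => [e|_]; [case: s / e|rewrite linear0].
Defined.

Section Copair.
Variables (H : T -> functor k C) (G : functor k C) (b : forall t, nattrans (H t) G).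

Definition dsum_copair_at x : {linear coprod_functor H x -> G x} :=
  @dsum_out k T (H^~ x) (G x) (fun t => b t x : {linear H t x -> G x}).

Lemma dsum_copair_at_in t x v :
  dsum_copair_at x (dsum_in (H := H^~ x) (t := t) v) = b t x v.
Proof. exact: (dsum_out_in (H := H^~ x)). Qed.

Lemma dsum_copair_natural x y (u : hom x y) v :
  dsum_copair_at y (fmap (coprod_functor H) u v) = fmap G u (dsum_copair_at x v).
Proof.
pose l : {linear coprod_functor H x -> G y} := dsum_copair_at y \o fmap (coprod_functor H) u.
pose r : {linear coprod_functor H x -> G y} := fmap G u \o dsum_copair_at x.
apply: (dsumM_ext (H := H^~ x) (a := l) (b := r)) => t w; rewrite /l /r /=.
rewrite dsum_copair_at_in -naturality -dsum_copair_at_in.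
by congr (dsum_copair_at _ _); apply/esym; exact: (naturality (dsum_inj H t) u w).
Qed.

Definition dsum_copair : nattrans (coprod_functor H) G :=
  @NatTrans k C (coprod_functor H) G dsum_copair_at
    (fun x => linearP (dsum_copair_at x)) dsum_copair_natural.

Lemma dsum_copairE t x v : dsum_copair x (dsum_inj H t x v) = b t x v.
Proof. exact: dsum_copair_at_in. Qed.
End Copair.

Lemma dsum_nat_eq H G (a b : nattrans (coprod_functor H) G) :
  (forall t x v, a x (dsum_inj H t x v) = b x (dsum_inj H t x v)) -> a = b.
Proof.
move=> ab; apply: nattransP => x f.
pose ax : {linear coprod_functor H x -> G x} := a x.
pose bx : {linear coprod_functor H x -> G x} := b x.
by apply: (@dsumM_ext _ _ (H^~ x) _ ax bx) => t v; apply: ab.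
Qed.

Lemma dsum_projective H : (forall t, projective (H t)) -> projective (coprod_functor H).
Proof.
move=> projH M N g f gsurj.
have lift t : exists h, ntcomp g h = ntcomp f (dsum_inj H t) by exact: projH.
exists (dsum_copair (fun t => projT1 (cid (lift t)))).
apply: dsum_nat_eq => t x v; rewrite ntcompE dsum_copairE; case: cid => h /= eh.
exact: (nt_ap x v eh).
Qed.

Lemma dsum_map_inj H H' (a : forall t, nattrans (H t) (H' t)) t x v :
  dsum_map a x (dsum_inj H t x v) = dsum_inj H' t x (a t x v).
Proof.
apply: dsumM_eq => s; rewrite -[LHS]/(a s x (dsum_in_fun (H := H^~ x) v s)).
rewrite -[RHS]/(dsum_in_fun (H := H'^~ x) (a t x v) s) /dsum_in_fun.
by case: pselect => [e|_]; [case: s / e|rewrite linear0].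
Qed.

Lemma dsum_map_surj H H' (a : forall t, nattrans (H t) (H' t)) :
  (forall t x w, exists v, a t x v = w) ->
  forall x (w : coprod_functor H' x), exists v, dsum_map a x v = w.
Proof.
move=> asurj x w.
(* Preimages are chosen to be 0 where [w] vanishes; arbitrary choices would not have finite
   support. *)
pose v t := if dsum_val w t == 0 then 0 else projT1 (cid (asurj t x (dsum_val w t))).
have vS : v \in dsum_supp (H^~ x).
  have [A wA] := dsumMP w; apply/asboolP; exists A => t /wA e.
  by rewrite /v e eqxx.
exists (Submod vS); apply: dsumM_eq => t; rewrite -[LHS]/(a t x (v t)) /v.
by case: eqP => [->|_]; [rewrite linear0|case: cid].
Qed.

Lemma dsum_map_exact H H' H'' (a : forall t, nattrans (H t) (H' t))
    (e : forall t, nattrans (H' t) (H'' t)) :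
  (forall t x w, e t x w = 0 <-> exists v, a t x v = w) ->
  forall x (w : coprod_functor H' x),
    dsum_map e x w = 0 <-> exists v, dsum_map a x v = w.
Proof.
move=> ex x w; split=> [w0|[v <-]]; last first.
  apply: dsumM_eq => t; rewrite -[LHS]/(e t x (a t x (dsum_val v t))).
  by apply/ex; exists (dsum_val v t).
have wv t : exists v, a t x v = dsum_val w t.
  by apply/ex; have := congr1 (fun f : dsumM _ => dsum_val f t) w0.
pose v t := if dsum_val w t == 0 then 0 else projT1 (cid (wv t)).
have vS : v \in dsum_supp (H^~ x).
  have [A wA] := dsumMP w; apply/asboolP; exists A => t /wA e0.
  by rewrite /v; case: eqP.
exists (Submod vS); apply: dsumM_eq => t; rewrite -[LHS]/(a t x (v t)) /v.
case: eqP => [e0|_]; last by case: cid.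
by rewrite linear0; exact: esym e0.
Qed.

(** The sum of projective resolutions of the summands is a projective resolution of the sum, and its
    cochains are families of cochains, which are bounded one index at a time. *)
Lemma ext_zeros_dsum H G : (forall t, ext_zeros (H t) G) -> ext_zeros (coprod_functor H) G.
Proof.
move=> V n; pose P t := free_resolution (H t).
pose D := @Resolution k C (coprod_functor H) (fun m => coprod_functor (fun t => P t m))
  (fun m => dsum_map (fun t => res_d (P t) m)) (dsum_map (fun t => res_aug (P t)))
  (dsum_map_surj (fun t => @res_surj _ _ _ (P t)))
  (dsum_map_exact (fun t => @res_exact0 _ _ _ (P t)))
  (fun m => dsum_map_exact (fun t => @res_exactS _ _ _ (P t) m)).
exists D; split.
  by move=> m; apply: dsum_projective => t; exact: free_resolution_projective.
move=> b b0.
have exc t : exists c, ext_in (P t) G n c = ntcomp b (dsum_inj (fun t => P t n) t).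
  apply: ext_zeroP (V t n) _ _; first exact: free_resolution_projective.
  apply/ext_outE => x v; move/ext_outE: b0 => /(_ x (dsum_inj (fun t => P t n.+1) t x v)).
  rewrite ntcompE => e; rewrite -[RHS]e; congr (b x _).
  pose d t := res_d (P t) n; rewrite -[RHS]/(dsum_map d x (dsum_inj (fun t => P t n.+1) t x v)).
  by rewrite dsum_map_inj.
pose c t := projT1 (cid (exc t)); have ec t : _ := projT2 (cid (exc t)) : _ (c t) = _.
exists (dsum_copair c); apply: dsum_nat_eq => t x v.
rewrite -[RHS]/(ntcomp b (dsum_inj (fun t => P t n) t) x v) -ec; clearbody c.
clear b b0 exc ec; case: n c v => [|n] c v //.
transitivity (dsum_copair c x (dsum_inj (fun t => P t n) t x (res_d (P t) n x v))).
  by congr (dsum_copair c x _); exact: (dsum_map_inj (fun t => res_d (P t) n)).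
exact: dsum_copairE.
Qed.

End DirectSumFunctor.

(** * Adjunctions and fibres *)

Section Adjunction.
Variables (k : comPzRingType) (C D : category).

(* [psi] is left adjoint to [phi], so that [phi^*] is left adjoint to [psi^*]. *)
Record adjunction (psi : cfunctor D C) (phi : cfunctor C D) := Adjunction {
  adj_unit : forall d, hom d (phi (psi d));
  adj_counit : forall c, hom (psi (phi c)) c;
  adj_unit_nat : forall d d' (u : hom d d'),
    cf_hom phi (cf_hom psi u) \* adj_unit d = adj_unit d' \* u;
  adj_counit_nat : forall c c' (u : hom c c'),
    adj_counit c' \* cf_hom psi (cf_hom phi u) = u \* adj_counit c;
  adj_phi : forall c, cf_hom phi (adj_counit c) \* adj_unit (phi c) = idm (phi c);
  adj_psi : forall d, adj_counit (psi d) \* cf_hom psi (adj_unit d) = idm (psi d) }.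

Variables (psi : cfunctor D C) (phi : cfunctor C D) (adj : adjunction psi phi).

Section Transpose.
Variables (F : functor k D) (G : functor k C).

Definition adj_up (b : nattrans (restr phi F) G) : nattrans F (restr psi G).
Proof.
refine (@NatTrans k D F (restr psi G)
  (fun d v => b (psi d) (fmap F (adj_unit adj d) v)) _ _).
- by move=> x a v w; rewrite !linearP.
- move=> x y u v; rewrite -[RHS](naturality b (cf_hom psi u)) /=.
  by rewrite -!fmapM adj_unit_nat.
Defined.

Definition adj_down (a : nattrans F (restr psi G)) : nattrans (restr phi F) G.
Proof.
refine (@NatTrans k C (restr phi F) G
  (fun c v => fmap G (adj_counit adj c) (a (phi c) v)) _ _).
- by move=> x c v w; rewrite linearP; exact: linearP.
- move=> x y u v; rewrite [a _ _](naturality a (cf_hom phi u)) /=.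
  by rewrite -!fmapM adj_counit_nat.
Defined.

Lemma adj_upK b : adj_down (adj_up b) = b.
Proof.
apply: nattransP => c v; rewrite /= -naturality /= -fmapM adj_phi; congr (b c _).
exact: (@fmap1 _ _ F).
Qed.

Lemma adj_downK a : adj_up (adj_down a) = a.
Proof.
apply: nattransP => d v; rewrite /= naturality /= -fmapM adj_psi; exact: (@fmap1 _ _ G).
Qed.
End Transpose.

(** [phi^*] is left adjoint to [psi^*], which preserves pointwise surjections. *)
Lemma restr_projective (P : functor k D) : projective P -> projective (restr phi P).
Proof.
move=> projP M N g f gsurj.
have [h eh] := projP _ _ (nt_restr psi g) (adj_up f) (fun x => gsurj (psi x)).
exists (adj_down h); rewrite -[RHS]adj_upK -eh; apply: nattransP => x v.
by rewrite /= naturality.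
Qed.

(** [phi^*] turns a projective resolution of [F] into one of its restriction, and transposition
    matches the cochains. *)
Lemma adj_ext_zero n (F : functor k D) (G : functor k C) :
  ext_zero n (restr phi F) G -> ext_zero n F (restr psi G).
Proof.
move=> V; have [P projP] : exists P : resolution F, res_projective P.
  by exists (free_resolution F); apply: free_resolution_projective.
exists P; split=> // b /ext_outE b0.
have [||c ec] := @ext_zeroP _ _ n _ _ (restr_resolution phi P) _ V (adj_down b).
- by move=> m; apply/restr_projective/projP.
- by apply/ext_outE => x v; rewrite /= b0 linear0.
exists (adj_up c); rewrite -[RHS]adj_downK -ec; apply: nattransP => x v.
by case: n {b b0 ec V} c v => [|n] c v //=; congr (c _ _); rewrite naturality.
Qed.

End Adjunction.

(** * Bifunctors with one variable fixed *)

Section Fibre.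
Variables (k : comPzRingType) (C D : category).

Section CoinducedFunctor.
Variables (x : C) (K : functor k D).

(* Right adjoint to the restriction to the fibre over [x]. *)
Definition coind_obj (ab : prodC C D) : lmodType k := dprod (fun _ : hom ab.1 x => K ab.2).

Definition coind : functor k (prodC C D).
Proof.
refine (@Functor k (prodC C D) coind_obj
  (fun ab ab' uv (h : coind_obj ab) (w : hom ab'.1 x) => fmap K uv.2 (h (w \* uv.1))) _ _ _).
- by move=> ab ab' uv c g h; apply: dprodP => w; rewrite linearP.
- by move=> ab h; apply: dprodP => w; rewrite fmap1 compm1.
- by move=> a b c g f h; apply: dprodP => w; rewrite fmapM compmA.
Defined.

Definition coind_up F (a : nattrans (restr (insr D x) F) K) : nattrans F coind.
Proof.
refine (@NatTrans k (prodC C D) F coind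
  (fun ab v w => a ab.2 (fmap F ((w, idm ab.2) : @hom (prodC C D) ab (x, ab.2)) v)) _ _).
- by move=> ab c v w; apply: dprodP => t; rewrite linearP; exact: linearP.
- move=> ab ab' uv v; apply: dprodP => w.
  rewrite -[RHS](naturality a) /=; congr (a _ _); rewrite -!fmapM.
  congr (fmap F _ v); congr pair; last by rewrite comp1m compm1.
  by rewrite /= comp1m.
Defined.

Definition coind_down F (b : nattrans F coind) : nattrans (restr (insr D x) F) K.
Proof.
refine (@NatTrans k D (restr (insr D x) F) K (fun y v => b (x, y) v (idm x)) _ _).
- by move=> y c v w; rewrite [b _ _]linearP.
- by move=> y y' u v; rewrite [b _ _]naturality /= comp1m.
Defined.

Lemma coind_upK F (a : nattrans (restr (insr D x) F) K) : coind_down (coind_up a) = a.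
Proof. by apply: nattransP => y v; congr (a y _); exact: fmap1. Qed.

Lemma coind_downK F (b : nattrans F coind) : coind_up (coind_down b) = b.
Proof.
apply: nattransP => ab v; apply: dprodP => w.
by rewrite -[LHS]/(b (x, ab.2) _ (idm x)) naturality /= fmap1 comp1m.
Qed.
End CoinducedFunctor.

Definition coind_map x (M N : functor k D) (g : nattrans M N) :
  nattrans (coind x M) (coind x N).
Proof.
refine (@NatTrans k (prodC C D) (coind x M) (coind x N)
  (fun ab (h : coind_obj x M ab) w => g ab.2 (h w)) _ _).
- by move=> ab c h h'; apply: dprodP => w; apply: linearP.
- by move=> ab ab' uv h; apply: dprodP => w; apply: naturality.
Defined.

(** Restriction to the fibre has the right adjoint [coind x], which preserves surjections by
    choosing preimages for each morphism to [x]. *)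
Lemma fibre_projective x (P : functor k (prodC C D)) :
  projective P -> projective (restr (insr D x) P).
Proof.
move=> projP M N g f gsurj.
have [|h eh] := projP _ _ (coind_map x g) (coind_up f).
  move=> ab h; exists (fun w => projT1 (cid (gsurj _ (h w)))).
  by apply: dprodP => w /=; case: cid.
exists (coind_down h); rewrite -[RHS]coind_upK -eh; exact: nattransP.
Qed.

Lemma ext_zeros_coind x (F : functor k (prodC C D)) (K : functor k D) :
  ext_zeros (restr (insr D x) F) K -> ext_zeros F (coind x K).
Proof.
move=> V n; have [P projP] : exists P : resolution F, res_projective P.
  by exists (free_resolution F); apply: free_resolution_projective.
exists P; split=> // b /ext_outE b0.
have [||c ec] := @ext_zeroP _ _ n _ _ (restr_resolution (insr D x) P)
    _ (V n) (coind_down b).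
- by move=> m; apply/fibre_projective/projP.
- by apply/ext_outE => y v; rewrite /= b0.
exists (coind_up c); rewrite -[RHS]coind_downK -ec; apply: nattransP => ab v.
apply: dprodP => w.
by case: n {b b0 ec} c v => [|n] c v //=; congr (c _ _); rewrite naturality.
Qed.

Lemma restr_short_exact (E E' : category) (phi : cfunctor E E')
    (G' G G'' : functor k E') (i : nattrans G' G) (q : nattrans G G'') :
  short_exact i q -> short_exact (nt_restr phi i) (nt_restr phi q).
Proof.
by case=> i0 q0 iq; split=> x; [exact: (i0 (phi x))|exact: (q0 (phi x))|exact: (iq (phi x))].
Qed.

Lemma ext_zeros_quot (E : category) (F G' G G'' : functor k E) (i : nattrans G' G)
    (q : nattrans G G'') :
  short_exact i q -> ext_zeros F G' -> ext_zeros F G -> ext_zeros F G''.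
Proof.
move=> ses V' V n; exists (free_resolution F).
have projP := @free_resolution_projective k E F; split=> //.
by apply: ses_exact_quot ses _ _ _ => //; apply: ext_zeroP.
Qed.

Definition coind_all (K : functor k (prodC C D)) : functor k (prodC C D) :=
  prod_functor (fun x => coind x (restr (insr D x) K)).

(** With the first variable set to x', [coind x] becomes a power of the fibre of [K] at [x], indexed
    by the morphisms from x' to [x]. The two maps below are the identity on vectors. *)
Lemma coind_all_fibre (E : functor k D) (K : functor k (prodC C D)) x' :
  (forall x, ext_zeros E (restr (insr D x) K)) ->
  ext_zeros E (restr (insr D x') (coind_all K)).
Proof.
move=> V.
pose R := prod_functor (fun x => prod_functor (fun _ : hom x' x => restr (insr D x) K)).
have VR : ext_zeros E R by apply: ext_zeros_prod => x; apply: ext_zeros_prod => _.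
unshelve refine (ext_zeros_retract (s := _) (r := _) _ VR).
- refine (@NatTrans k D (restr (insr D x') (coind_all K)) R (fun y h => h) _ _) => //.
  move=> y y' u h; apply: dprodP => x; apply: dprodP => w /=.
  by rewrite compm1.
- refine (@NatTrans k D R (restr (insr D x') (coind_all K)) (fun y h => h) _ _) => //.
  move=> y y' u h; apply: dprodP => x; apply: dprodP => w /=.
  by rewrite compm1.
- by [].
Qed.

(** Every bifunctor embeds in the product of the functors coinduced from its fibres, whose Ext is
    computed on fibres. The cokernel satisfies the hypothesis again, its fibres being quotients of
    acyclic functors by acyclic ones; this needs the vanishing for all pairs x, x'. *)
Lemma ext_zeros_fibre (F K : functor k (prodC C D)) :
  (forall x x', ext_zeros (restr (insr D x) F) (restr (insr D x') K)) ->
  ext_zeros F K.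
Proof.
move: K; apply: ext_zeros_coresolve => K V.
pose i : nattrans K (coind_all K) := prod_pair (fun x => coind_up (nt_id (restr (insr D x) K))).
exists (coind_all K), (coker_functor i), i, (coker_proj i).
have ses : short_exact i (coker_proj i).
  apply: coker_short_exact => -[a b] v v0.
  have : (i (a, b) v : dprod _) a (idm a) = 0 by rewrite v0.
  by move=> <-; exact: esym (@fmap1 _ _ K (a, b) v).
split=> //.
  by apply: ext_zeros_prod => x; apply: ext_zeros_coind.
move=> x x'; apply: (ext_zeros_quot (restr_short_exact (insr D x') ses)) => //.
by apply: coind_all_fibre.
Qed.

End Fibre.

(** * The centre of an additive category *)

Section PolynomialAction.
Variable M : zmodType.
Implicit Types (a : nat -> M) (p q : {poly int}).

Definition pact a p : M := \sum_(j < size p) a j *~ p`_j.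

Lemma pactE a p n : (size p <= n)%N -> pact a p = \sum_(j < n) a j *~ p`_j.
Proof.
move=> le_pn; rewrite /pact (big_ord_widen _ (fun j => a j *~ p`_j) le_pn).
rewrite big_mkcond; apply: eq_bigr => j _; case: ltnP => // le_pj.
by rewrite nth_default.
Qed.

Lemma pactD a p q : pact a (p + q) = pact a p + pact a q.
Proof.
have le_pq : (size (p + q)%R <= maxn (size p) (size q))%N by apply: size_polyD.
rewrite (pactE a le_pq) (pactE a (leq_maxl (size p) (size q))).
rewrite (pactE a (leq_maxr (size p) (size q))).
by rewrite -big_split; apply: eq_bigr => j _; rewrite coefD mulrzDr.
Qed.

Lemma pactZ a c p : pact a (c *: p) = pact a p *~ c.
Proof.
rewrite (pactE a (size_scale_leq c p)) /pact mulrz_suml.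
by apply: eq_bigr => j _; rewrite coefZ mulrC mulrzA.
Qed.

Lemma pactN a p : pact a (- p) = - pact a p.
Proof. by rewrite -scaleN1r pactZ mulrNz mulr1z. Qed.

Lemma pactC a c : pact a c%:P = a 0 *~ c.
Proof. by rewrite (pactE a (size_polyC_leq1 c)) big_ord1 coefC. Qed.

Lemma pactMX a p : pact a (p * 'X) = pact (fun j => a j.+1) p.
Proof.
have le_p : (size (p * 'X)%R <= (size p).+1)%N.
  by apply: leq_trans (size_polyMleq _ _) _; rewrite size_polyX addn2.
rewrite (pactE a le_p) big_ord_recl coefMX eqxx mulr0z add0r.
by apply: eq_bigr => j _; rewrite coefMX.
Qed.

Lemma pactXn a n : pact a 'X^n = a n.
Proof.
elim: n a => [|n IHn] a; first by rewrite expr0 -[1]/(1%:P) pactC mulr1z.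
by rewrite exprSr pactMX IHn.
Qed.

(** By induction on [q]: multiplication by X shifts the sequence, and the hypothesis is stable under
    shifts. *)
Lemma pactMl0 a p q : (forall m, pact (fun j => a (m + j)%N) p = 0) ->
  pact a (p * q) = 0.
Proof.
elim/poly_ind: q a => [|q c IHq] a a0; first by rewrite mulr0 /pact size_poly0 big_ord0.
rewrite mulrDr mulrA pactD pactMX [p * c%:P]mulrC mul_polyC pactZ.
by have := a0 0; rewrite (IHq _ (fun m => a0 m.+1)) add0r => ->; rewrite mul0rz.
Qed.

Lemma eq_pact a a' p : a =1 a' -> pact a p = pact a' p.
Proof. by move=> e; apply: eq_bigr => j _; rewrite e. Qed.

Lemma pact_periodic a N q : (forall j, a (j + N)%N = a j) ->
  pact a (('X^N - 1) * q) = 0.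
Proof.
move=> aN; apply: pactMl0 => m; rewrite pactD pactN pactXn -(expr0 'X).
by rewrite pactXn aN addn0 subrr.
Qed.

End PolynomialAction.

Lemma raddf_pact (M M' : zmodType) (f : {additive M -> M'}) a p :
  f (pact a p) = pact (f \o a) p.
Proof. by rewrite raddf_sum; apply: eq_bigr => j _; rewrite raddfMz. Qed.

(* [X - 1] divides [N - (1 + X + ... + X^(N-1))], so [N (X - 1)] lies in
   [(X^N - 1) + ((X - 1)^2)]; iterate. *)
Lemma augmentation_power (N d : nat) : exists r s : {poly int},
  ('X - 1) *+ N ^ d = ('X^N - 1) * r + ('X - 1) ^+ d.+1 * s.
Proof.
have [t et] : exists t : {poly int}, \sum_(i < N) 'X^i - N%:R = t * ('X - 1%:P).
  apply/factor_theorem; rewrite /root !hornerE horner_sum.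
  under eq_bigr do rewrite hornerXn expr1n.
  by rewrite sumr_const card_ord -polyC_natr hornerC subrr.
have eN : ('X - 1) * N%:R = ('X^N - 1) - ('X - 1) ^+ 2 * t :> {poly int}.
  rewrite subrX1; have -> : \sum_(i < N) 'X^i = t * ('X - 1) + N%:R :> {poly int}.
    by rewrite -et subrK.
  ring.
elim: d => [|d [r [s IHd]]]; first by exists 0, 1; rewrite mulr0 add0r mulr1.
exists (r * N%:R + ('X - 1) ^+ d * s), (- t * s).
rewrite expnSr mulrnA IHd -mulr_natr.
transitivity (('X^N - 1) * r * N%:R + ('X - 1) ^+ d * s * (('X - 1) * N%:R) : {poly int}).
  by rewrite !exprS; ring.
by rewrite eN !exprS; ring.
Qed.

Section Centre.
Variables (k : comPzRingType) (A : additive).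
Implicit Types (F G : functor k A) (p : {poly int}).

Lemma add_comp_mulnl (x y z : A) (g : add_hom y z) (f : add_hom x y) n :
  add_comp (g *+ n) f = add_comp g f *+ n.
Proof. by elim: n => [|n IHn]; rewrite ?mulr0n ?add_comp0m // !mulrS add_compDl IHn. Qed.
Lemma add_comp_mulnr (x y z : A) (g : add_hom y z) (f : add_hom x y) n :
  add_comp g (f *+ n) = add_comp g f *+ n.
Proof. by elim: n => [|n IHn]; rewrite ?mulr0n ?add_compm0 // !mulrS add_compDr IHn. Qed.

Definition central_fun F p (x : A) (v : F x) : F x :=
  pact (fun j => fmap F (add_id x *+ j : @hom A x x) v) p.

Definition central F p : nattrans F F.
Proof.
refine (@NatTrans k A F F (central_fun p) _ _).
- move=> x c v w; rewrite /central_fun /pact scaler_sumr -big_split.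
  apply: eq_bigr => j _; rewrite linearP /= mulrzDl; congr (_ + _).
  by rewrite -!scaler_int !scalerA mulrC.
- move=> x y u v; rewrite /central_fun raddf_pact; apply: eq_pact => j /=.
  rewrite -!fmapM /=; congr (fmap F _ v).
  by rewrite /= add_comp_mulnl add_comp_mulnr add_comp1m add_compm1.
Defined.

Lemma central_natural F G (a : nattrans F G) p x v :
  a x (central F p x v) = central G p x (a x v).
Proof.
rewrite /= /central_fun raddf_pact; apply: eq_pact => j /=; exact: naturality.
Qed.

(* The action of [p] on a resolution of [F] lifts the action 0 on [F], hence is
   null-homotopic; on cochains with values in [G] it is multiplication by [m]. *)
Lemma central_ext_zeros F G p (h : k) (m : nat) : h * m%:R = 1 ->
  (forall x v, central F p x v = 0) ->
  (forall x v, central G p x v = v *+ m) -> ext_zeros F G.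
Proof.
move=> hm F0 Gm n; have [P projP] : exists P : resolution F, res_projective P.
  by exists (free_resolution F); apply: free_resolution_projective.
exists P; split=> // b b0.
have [||c ec] := @lift_null_ext _ _ _ _ P P projP (fun i => central (P i) p) G n b _ _ b0.
- by move=> i; apply: nattransP => x v; rewrite !ntcompE central_natural.
- by move=> x v; rewrite central_natural F0.
exists (h *: c); rewrite linearZ ec; apply: nattransP => x v.
rewrite -[LHS]/(h *: b x (central (P n) p x v)) central_natural Gm.
by rewrite -scaler_nat scalerA hm scale1r.
Qed.

End Centre.

(** * Polynomial against antipolynomial functors *)

Section PolynomialAntipolynomial.
Variables (k : comPzRingType) (A : additive).
Implicit Types F G : functor k A.

(** Equivalent to F(0) = 0, since zero morphisms are those that factor through the zero object. *)
Definition reduced F := forall (x y : A) v, fmap F (0 : add_hom x y) v = 0.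

Definition periodic N F := forall (x : A) v j,
  fmap F (add_id x *+ (j + N) : @hom A x x) v = fmap F (add_id x *+ j : @hom A x x) v.

(* The [d.+1]-st finite differences of [j |-> F (f + j g)] vanish. *)
Definition deg_le d F := forall (x y : A) (f g : add_hom x y) v,
  pact (fun j => fmap F (f + g *+ j : @hom A x y) v) (('X - 1) ^+ d.+1) = 0.

Lemma central_periodic N F p x v : periodic N F -> central F (('X^N - 1) * p) x v = 0.
Proof. by move=> FN; apply: pact_periodic => j; apply: FN. Qed.

(** A shift of the sequence by [m] moves the base point [f] of [deg_le] to m id. *)
Lemma central_deg_le d F p x v : deg_le d F -> central F (('X - 1) ^+ d.+1 * p) x v = 0.
Proof.
move=> Fd; apply: pactMl0 => m.
rewrite -[RHS](Fd x x (add_id x *+ m) (add_id x) v).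
by apply: eq_pact => j; rewrite mulrnDr.
Qed.

(** X - 1 acts as F(id) - F(0), which is the identity on a reduced functor. *)
Lemma central_reduced F n x v : reduced F -> central F (('X - 1) *+ n) x v = v *+ n.
Proof.
move=> F0; rewrite -scaler_nat [LHS]/(central_fun _ v) /central_fun pactZ.
rewrite pactD pactN -['X]expr1 pactXn -(expr0 'X) pactXn mulr0n F0 subr0.
by rewrite mulr1n natz -pmulrn; congr (_ *+ n); apply: fmap1.
Qed.

Section Periodic.
Variables (N d : nat) (h : k).
Hypothesis hN : h * N%:R = 1.

Lemma expN_inv : h ^+ d * (N ^ d)%N%:R = 1.
Proof. by rewrite natrX -exprMn hN expr1n. Qed.

(** The polynomial (X^N - 1) r kills [F]; on [G] it agrees with N^d (X - 1), because the difference
    is a multiple of (X - 1)^(d+1), and so it acts by the unit N^d. The next lemma uses the other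
    summand, with the roles exchanged. *)
Lemma ext_zeros_periodic_deg_le F G :
  periodic N F -> deg_le d G -> reduced G -> ext_zeros F G.
Proof.
move=> FN Gd G0; have [r [s ers]] := augmentation_power N d.
apply: (central_ext_zeros (p := ('X^N - 1) * r) expN_inv) => x v.
  exact: central_periodic.
rewrite -(central_reduced _ _ G0) ers [in RHS]/= /central_fun pactD.
by rewrite -[X in _ = _ + X]/(central G _ x v) central_deg_le // addr0.
Qed.

Lemma ext_zeros_deg_le_periodic F G :
  deg_le d F -> periodic N G -> reduced G -> ext_zeros F G.
Proof.
move=> Fd GN G0; have [r [s ers]] := augmentation_power N d.
apply: (central_ext_zeros (p := ('X - 1) ^+ d.+1 * s) expN_inv) => x v.
  exact: central_deg_le.
rewrite -(central_reduced _ _ G0) ers [in RHS]/= /central_fun pactD.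
by rewrite -[X in _ = X + _]/(central G _ x v) central_periodic // add0r.
Qed.
End Periodic.

Variable I : ideal A.

(* What is used of a k-cotrivial ideal; the integer [N] depends on [x]. *)
Definition cotrivial := forall x : A, exists (N : nat) (h : k),
  h * N%:R = 1 /\ add_id x *+ N \in I x x.

(** Factorization through A/I as an equation on congruent morphisms: in this form it passes to
    kernels, cokernels, products and duals without any functor on the quotient category. *)
Definition factors F := forall (x y : A) (f g : add_hom x y) v,
  f - g \in I x y -> fmap F (f : @hom A x y) v = fmap F (g : @hom A x y) v.

Hypothesis cotrI : cotrivial.

Section Cofree.
Variables (x : A) (M : lmodType k).

(* The functions from [(A/I)(y, x)] to [M] vanishing at 0. *)
Definition respects (y : A) : {pred dprod (fun _ : add_hom y x => M)} := fun h =>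
  `[< (forall u u', u - u' \in I y x -> h u = h u') /\ h 0 = 0 >].
Lemma respects_submod y : submod_closed (@respects y).
Proof.
split=> [|a f g /asboolP[fI f0] /asboolP[gI g0]]; apply/asboolP; split=> //.
  by move=> u u' uu'; rewrite !dprodDE !dprodZE (fI _ _ uu') (gI _ _ uu').
by rewrite dprodDE dprodZE f0 g0 scaler0 addr0.
Qed.
HB.instance Definition _ y :=
  GRing.isSubmodClosed.Build k _ (@respects y) (@respects_submod y).

Lemma cofree_fmap_subproof (y z : A) (v : add_hom y z) (h : submod (@respects y)) :
  (fun u : add_hom z x => submod_val h (add_comp u v)) \in @respects z.
Proof.
have /asboolP[hI h0] := submodP h; apply/asboolP; split=> [u u' uu'|].
  by apply: hI; rewrite -add_compNm -add_compDl idealMr.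
by rewrite add_comp0m.
Qed.

Definition cofree : functor k A.
Proof.
refine (@Functor k A (fun y => submod (@respects y))
  (fun y z v h => Submod (cofree_fmap_subproof v h)) _ _ _).
- by move=> y z v a g h; apply/val_inj.
- by move=> y h; apply/val_inj/dprodP => u /=; rewrite add_compm1.
- by move=> y z t g f h; apply/val_inj/dprodP => u /=; rewrite add_compA.
Defined.

Lemma cofree_eq y (g h : cofree y) :
  (forall u, submod_val g u = submod_val h u) -> g = h.
Proof. by move=> gh; apply/val_inj/dprodP. Qed.

Lemma cofree_factors : factors cofree.
Proof.
move=> y z f g h fg; apply: cofree_eq => u /=.
have /asboolP[hI _] := submodP h; apply: hI.
by rewrite -add_compmN -add_compDr idealMl.
Qed.

Lemma cofree_reduced : reduced cofree.
Proof.
move=> y z h; apply: cofree_eq => u /=; rewrite add_compm0.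
by have /asboolP[] := submodP h.
Qed.

(** For u : y -> x one has N u = (N id_x) u, so the period depends on [x] alone and serves all
    [y]. *)
Lemma cofree_periodic N : add_id x *+ N \in I x x -> periodic N cofree.
Proof.
move=> xN y h j; apply: cofree_eq => u /=.
have /asboolP[hI _] := submodP h; apply: hI.
rewrite -add_compmN -add_compDr mulrnDr addrAC subrr add0r.
rewrite add_comp_mulnr add_compm1 -[u]add_comp1m -add_comp_mulnl.
exact: idealMr.
Qed.
End Cofree.

Definition cofree_all G : functor k A := prod_functor (fun x => cofree x (G x)).

Lemma cofree_unit_subproof G x y (v : G y) : factors G -> reduced G ->
  (fun u : add_hom y x => fmap G (u : @hom A y x) v) \in @respects x (G x) y.
Proof.
move=> GI G0; apply/asboolP; split=> [u u' uu'|]; last exact: G0.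
exact: GI.
Qed.

Definition cofree_unit G (GI : factors G) (G0 : reduced G) x :
  nattrans G (cofree x (G x)).
Proof.
refine (@NatTrans k A G (cofree x (G x))
  (fun y v => Submod (cofree_unit_subproof x v GI G0)) _ _).
- by move=> y a v w; apply: cofree_eq => u; apply: linearP.
- by move=> y z u v; apply: cofree_eq => w; rewrite /= -fmapM.
Defined.

(** [G] embeds in [cofree_all G] by evaluation on morphisms, the identity of [x] recovering the
    vector. A quotient of a reduced functor through A/I is again one, so the class is stable under
    this embedding and its cokernel. *)
Lemma ext_zeros_deg_le_factors d F G :
  deg_le d F -> factors G -> reduced G -> ext_zeros F G.
Proof.
move=> Fd GI G0.
apply: (@ext_zeros_coresolve _ _ F (fun G => factors G /\ reduced G)) => // {GI G0}G [GI G0].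
pose i : nattrans G (cofree_all G) := prod_pair (cofree_unit GI G0).
exists (cofree_all G), (coker_functor i), i, (coker_proj i); split.
- apply: coker_short_exact => x v v0.
  have : submod_val ((i x v : dprod _) x) (add_id x) = 0 by rewrite v0.
  by move=> <-; exact: esym (@fmap1 _ _ G x v).
- apply: ext_zeros_prod => x; have [N [h [hN xN]]] := cotrI x.
  apply: (ext_zeros_deg_le_periodic hN Fd); last exact: cofree_reduced.
  exact: cofree_periodic.
split=> [x y f g v fg|x y v]; have [w <-] := coker_proj_surj v.
  rewrite -!naturality; congr (coker_proj i y _); apply: dprodP => z.
  exact: cofree_factors.
rewrite -!naturality; have -> : fmap (cofree_all G) (0 : add_hom x y) w = 0.
  by apply: dprodP => z; apply: cofree_reduced.
exact: linear0.
Qed.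

Section FreeOn.
Variable c : A.

Definition iquot_act (x y : A) (v : add_hom x y) (q : iquot I c x) : iquot I c y :=
  ipi I (add_comp v (repr q)).

Lemma iquot_actE x y (v : add_hom x y) f :
  iquot_act v (ipi I f) = ipi I (add_comp v f).
Proof.
apply/ipiE; rewrite -add_compmN -add_compDr; apply: idealMl.
by apply/ipiE; rewrite /ipi reprK.
Qed.

Definition free_fmap (x y : A) (v : add_hom x y) :
    {linear free k (iquot I c x) -> free k (iquot I c y)} :=
  lin_ext (fun q => delta k (iquot_act v q)).

Lemma free_fmap_delta x y (v : add_hom x y) q :
  free_fmap v (delta k q) = delta k (iquot_act v q).
Proof. exact: lin_ext_delta. Qed.

Definition free_on : functor k A.
Proof.
refine (@Functor k A (fun x => free k (iquot I c x)) free_fmap _ _ _).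
- by move=> x y v; apply: linearP.
- move=> x v; apply: (free_ext (f := free_fmap (add_id x)) (g := idfun)) => q.
  by rewrite free_fmap_delta; have [f ->] := ipi_surj q; rewrite iquot_actE add_comp1m.
- move=> x y z g f v; apply: (free_ext (f := free_fmap (add_comp g f))
    (g := free_fmap g \o free_fmap f)) => q /=.
  rewrite -[RHS]/(free_fmap g (free_fmap f _)) !free_fmap_delta.
  by have [h ->] := ipi_surj q; rewrite !iquot_actE add_compA.
Defined.

Lemma free_on_eq (x y : A) (f g : add_hom x y) (v : free_on x) :
  (forall u : add_hom c x, ipi I (add_comp f u) = ipi I (add_comp g u)) ->
  fmap free_on (f : @hom A x y) v = fmap free_on (g : @hom A x y) v.
Proof.
move=> fg; apply: (free_ext (f := free_fmap f) (g := free_fmap g)) => q.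
by rewrite !free_fmap_delta; have [u ->] := ipi_surj q; rewrite !iquot_actE fg.
Qed.

Lemma free_on_factors : factors free_on.
Proof.
move=> x y f g v fg; apply: free_on_eq => u; apply/ipiE.
by rewrite -add_compNm -add_compDl idealMr.
Qed.

Lemma free_on_periodic N : add_id c *+ N \in I c c -> periodic N free_on.
Proof.
move=> cN x v j; apply: free_on_eq => u; apply/ipiE.
rewrite -add_compNm -add_compDl mulrnDr addrAC subrr add0r.
rewrite add_comp_mulnl add_comp1m -[u]add_compm1 -add_comp_mulnr.
exact: idealMl.
Qed.

Section Counit.
Variables (F : functor k A) (FI : factors F) (s : F c).

Definition free_on_map_at x : {linear free k (iquot I c x) -> F x} :=
  lin_ext (fun q => fmap F (repr q : @hom A c x) s).

Lemma free_on_map_atE x (f : add_hom c x) :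
  free_on_map_at x (delta k (ipi I f)) = fmap F (f : @hom A c x) s.
Proof.
rewrite [LHS]lin_ext_delta; apply: FI; apply/ipiE; by rewrite /ipi reprK.
Qed.

Lemma free_on_map_natural (x y : A) (u : @hom A x y) v :
  free_on_map_at y (fmap free_on u v) = fmap F u (free_on_map_at x v).
Proof.
pose l : {linear free k (iquot I c x) -> F y} := free_on_map_at y \o free_fmap u.
pose r : {linear free k (iquot I c x) -> F y} := fmap F u \o free_on_map_at x.
apply: (free_ext (f := l) (g := r)) => q; rewrite /l /r /=.
have [f ->] := ipi_surj q.
rewrite -[LHS]/(free_on_map_at y (free_fmap u (delta k (ipi I f)))) free_fmap_delta.
rewrite -[RHS]/(fmap F u (free_on_map_at x (delta k (ipi I f)))).
by rewrite iquot_actE !free_on_map_atE -fmapM.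
Qed.

Definition free_on_map : nattrans free_on F :=
  @NatTrans k A free_on F free_on_map_at (fun x => linearP (free_on_map_at x))
    free_on_map_natural.
End Counit.
End FreeOn.

(** The class resolved is that of all functors through A/I, reducedness being asked of [G]. The
    kernel of the cover stays in it as a subfunctor of a sum of such functors. *)
Lemma ext_zeros_factors_deg_le d F G :
  factors F -> deg_le d G -> reduced G -> ext_zeros F G.
Proof.
move=> + Gd G0; move: F; apply: ext_zeros_resolve => F FI.
pose L := coprod_functor (fun t : {c : A & F c} => free_on (projT1 t)).
pose q : nattrans L F := dsum_copair (fun t => free_on_map FI (projT2 t)).
exists (ker_functor q), L, (ker_incl q), q; split.
- apply: ker_short_exact => x s.
  exists (dsum_inj (fun t : {c : A & F c} => free_on (projT1 t)) (existT _ x s) x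
    (delta k (ipi I (add_id x)))).
  rewrite dsum_copairE [LHS]free_on_map_atE //; exact: (@fmap1 _ _ F x s).
- apply: ext_zeros_dsum => -[c s] /=; have [N [h [hN xN]]] := cotrI c.
  by apply: (ext_zeros_periodic_deg_le hN) Gd G0; apply: free_on_periodic.
move=> x y f g v fg; apply/val_inj => /=; apply: dsumM_eq => t.
exact: free_on_factors.
Qed.

End PolynomialAntipolynomial.

(** * Polynomial functors *)

(** Each [S] without [i] cancels against [S] with [i] added. *)
Lemma alternating_sum_eq0 (M : zmodType) (I : finType) (a : {set I} -> M) i :
  (forall S : {set I}, i \notin S -> a (i |: S)%SET = a S) ->
  \sum_(S : {set I}) a S *~ (-1) ^+ #|~: S|%SET = 0.
Proof.
move=> ai; rewrite (bigID (fun S : {set I} => i \in S)) /=.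
rewrite (reindex_onto (fun S => i |: S)%SET (fun S => S :\ i)%SET); last first.
  by move=> S iS; rewrite finset.setD1K.
have e (S : {set I}) : ((i \in i |: S) && ((i |: S) :\ i == S))%SET = (i \notin S).
  rewrite finset.setU11 /=; apply/eqP/idP => [<-|iS]; first by rewrite !inE eqxx.
  by rewrite finset.setU1K.
rewrite (eq_bigl _ _ e) -big_split big1 //= => S iS.
rewrite ai // -mulrzDr; have -> : #|(~: S)|%SET = #|(~: (i |: S))|%SET.+1.
  rewrite (cardsD1 i) inE iS; congr (_.+1); apply: eq_card => j.
  by rewrite !inE negb_or.
by rewrite exprS mulN1r subrr mulr0z.
Qed.

(** The expansion of (X - 1)^n is kept indexed by subsets, without collecting binomial coefficients,
    so that the d + 1 factors can be treated as d + 1 independent variables. *)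
Lemma pact_difference (M : zmodType) (a : nat -> M) n :
  pact a (('X - 1) ^+ n) = \sum_(S : {set 'I_n}) a #|S| *~ (-1) ^+ #|~: S|%SET.
Proof.
have -> : ('X - 1) ^+ n = \prod_(i < n) ('X - 1) :> {poly int}.
  by rewrite prodr_const card_ord.
rewrite bigA_distr /=.
have pact0 : pact a 0 = 0 by rewrite /pact size_poly0 big_ord0.
rewrite (big_morph (pact a) (pactD a) pact0); apply: eq_bigr => S _.
rewrite (bigID (mem S)) /= (eq_bigr (fun=> 'X)) => [|i ->//].
rewrite prodr_const [X in _ * X](eq_bigr (fun=> -1)) => [|i /negPf ->//].
rewrite prodr_const mulrC -[-1]/(- (1%:P)) -polyCN -polyC_exp mul_polyC pactZ pactXn.
by congr (_ *~ _ ^+ _); apply: eq_card => i; rewrite !inE.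
Qed.

Section FromCrossEffects.
Variables (k : comPzRingType) (A : additive) (F : functor k A) (d : nat).
Variable (D : cross_decomposition F d.+1).
Hypothesis D0 : forall x (v : cross_effect D x), v = 0.
Variables (x y : powC 'I_d.+1 A) (s t : forall i, add_hom (x i) (y i)).

Definition mixed (S : {set 'I_d.+1}) : @hom (powC 'I_d.+1 A) x y :=
  fun i => if i \in S then s i else t i.

Lemma ce_top sigma : val sigma = [set: 'I_d.+1]%SET ->
  forall x (v : ce_part D sigma x), v = 0.
Proof.
move=> e; have -> : sigma = exist _ [set: 'I_d.+1]%SET (setT_nonempty d).
  exact/val_inj.
exact: D0.
Qed.

(** Decompose [w]. The part at 0 does not depend on [S]; the part at a proper subset sigma does not
    see whether an index outside sigma lies in [S]; both alternating sums cancel. The part at the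
    full set vanishes by the degree hypothesis. *)
Lemma cross_sum_eq0 (w : F (dsum x)) :
  \sum_S fmap F (dsum_fmap (mixed S) : @hom A (dsum x) (dsum y)) w
    *~ (-1) ^+ #|~: S|%SET = 0.
Proof.
have [inv _ /(_ w) ew] := ce_bij D x; move: (inv w) ew => [w0 w1] /= <-.
under eq_bigr do rewrite linearD mulrzDl linear_sum mulrz_suml.
rewrite big_split /= exchange_big /= [X in X + _](_ : _ = 0) ?add0r; last first.
  rewrite (eq_bigr (fun S => ce_incl0 D y w0 *~ (-1) ^+ #|~: S|%SET)).
    exact: (@alternating_sum_eq0 _ _ (fun=> ce_incl0 D y w0) ord0).
  by move=> S _; congr (_ *~ _); rewrite -[LHS](naturality (ce_incl0 D) (mixed S)).
apply: big1 => sigma _; have [e|] := eqVneq (val sigma) [set: 'I_d.+1]%SET.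
  apply: big1 => S _; rewrite (_ : w1 sigma = 0) ?linear0 ?mul0rz //.
    exact: ce_top.
rewrite -finset.properT => /properP[_ [i _ iS]].
pose a (S : {set 'I_d.+1}) := fmap F (dsum_fmap (mixed S) : @hom A (dsum x) (dsum y))
  (ce_incl D sigma x (w1 sigma)).
apply: (@alternating_sum_eq0 _ _ a i) => S iS'; rewrite /a.
rewrite -![fmap F _ _](naturality (ce_incl D sigma) (mixed _)).
have em : (fun j : indices sigma => mixed (i |: S)%SET (val j)) = fun j => mixed S (val j).
  apply: functional_extensionality_dep => j.
  rewrite /mixed /= in_setU1; case: eqVneq => // ji.
  by case/negP: iS; rewrite -ji (svalP j).
congr (ce_incl D sigma y _).
exact: (congr1 (fun u : @hom (powC (indices sigma) A) (fun j => x (val j)) (fun j => y (val j))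
  => fmap (ce_part D sigma) u (w1 sigma)) em).
Qed.

End FromCrossEffects.

Section PolynomialDegree.
Variables (k : comPzRingType) (A : additive).

(** The vanishing of the cross-effect is specialised to constant families, placed between the
    diagonal of [x] and the codiagonal of [y]. *)
Lemma polynomial_deg_le (F : functor k A) : polynomial F -> exists d, deg_le d F.
Proof.
move=> [d [D D0]]; exists d => x y f g v; rewrite pact_difference.
pose X (_ : 'I_d.+1) := x; pose Y (_ : 'I_d.+1) := y.
(* The morphism [f] sits on one coordinate only, and each index in [S] adds one [g]; summing the
   coordinates of [mixed s t S] thus gives f + |S| g. *)
pose t (i : 'I_d.+1) : add_hom x y := if i == ord0 then f else 0.
pose s i : add_hom x y := t i + g.
pose a : add_hom x (dsum X) := \sum_i (dinj X i : add_hom x (dsum X)).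
pose c : add_hom (dsum Y) y := \sum_i (dproj Y i : add_hom (dsum Y) y).
have e (S : {set 'I_d.+1}) :
    f + g *+ #|S| = add_comp c (add_comp (dsum_fmap (mixed (x := X) (y := Y) s t S)) a).
  rewrite /dsum_fmap add_comp_suml add_comp_sumr.
  rewrite (eq_bigr (fun i => mixed (x := X) (y := Y) s t S i : add_hom x y)) => [|i _].
    rewrite (eq_bigr (fun i => t i + (if i \in S then g else 0))) => [|i _].
      rewrite big_split /=; congr (_ + _); last by rewrite -big_mkcond sumr_const.
      by rewrite (bigD1 ord0) //= big1 ?addr0 /t // => i /negPf ->.
    by rewrite /mixed /s; case: ifP; rewrite ?addr0.
  rewrite /a add_comp_sumr (bigD1 i) //= big1 => [|j /eqP ji].
    rewrite -!add_compA dproj_inj add_compm1 addr0 /c add_comp_suml (bigD1 i) //=.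
    rewrite big1 ?addr0 => [|j /eqP ji]; first by rewrite add_compA dproj_inj add_comp1m.
    by rewrite add_compA dproj_inj0 ?add_comp0m // => /esym.
  by rewrite -!add_compA dproj_inj0 // !add_compm0.
have := @cross_sum_eq0 k A F d D D0 X Y s t (fmap F (a : @hom A x (dsum X)) v).
move=> /(congr1 (fmap F (c : @hom A (dsum Y) y))); rewrite linear0; apply: etrans.
rewrite linear_sum; apply: eq_bigr => S _; rewrite raddfMz e; congr (_ *~ _).
rewrite -fmapM; exact: (@fmapM _ _ F _ _ _ (c : @hom A (dsum Y) y)).
Qed.
End PolynomialDegree.

(** * Antipolynomial functors *)

Section TensorZero.
Variables (k : comPzRingType) (M : zmodType) (u : M) (p : nat).
Hypotheses (p_prime : prime p) (pNu : forall m : M, m *+ p <> u).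
Hypothesis tensor0 : forall t : tensor (zmodule k : lmodType int) (zmodule M : lmodType int), t = 0.

Definition subgroup_avoiding (H : set M) :=
  [/\ forall m, H (m *+ p), forall m m', H m -> H m' -> H (m - m') & ~ H u].

(* A maximal such [H] has quotient [M / H] cyclic of order [p], generated by [u]. *)
Lemma maximal_subgroup_avoiding : exists H, subgroup_avoiding H /\
  forall H', subgroup_avoiding H' -> (forall m, H m -> H' m) -> forall m, H' m -> H m.
Proof.
(* Zorn's lemma must also cover the empty chain, whose union is empty. Adjoining the multiples of
   [p] makes the empty set stand for the subgroup pM, which avoids [u]. *)
pose adj (S : set M) : set M := fun m => S m \/ exists m', m = m' *+ p.
have adjP S : subgroup_avoiding S -> adj S = S.
  move=> [Sp _ _]; apply/funext => m; apply/propext; split=> [[//|[m' ->]]|]; last by left.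
  exact: Sp.
have [|S [PS Smax]] := @Zorn_bigcup M (fun S => subgroup_avoiding (adj S)).
  move=> F FP totF; split=> [m|m m'|]; first by right; exists m.
  - have sub S : F S -> forall m, adj S m -> adj (\bigcup_(X in F) X)%classic m.
      by move=> FS m1 [Sm|]; [left; exists S|right].
    have adj_sub S S' : (S `<=` S')%classic -> forall m, adj S m -> adj S' m.
      by move=> SS' m1 [/SS'|]; [left|right].
    have [S0|noS] := pselect (exists S, F S); last first.
      have no m1 : ~ (\bigcup_(X in F) X)%classic m1 by move=> [S FS]; case: noS; exists S.
      move=> [/no//|[n ->]] [/no//|[n' ->]]; right; exists (n - n').
      by rewrite mulrnBl.
    have inS m1 : adj (\bigcup_(X in F) X)%classic m1 -> exists2 S, F S & adj S m1.
      move=> [[S FS Sm]|[n ->]]; first by exists S => //; left.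
      by case: S0 => S FS; exists S => //; right; exists n.
    move=> /inS[S FS Sm] /inS[S' FS' Sm'].
    have [SS'|S'S] := totF _ _ FS FS'.
      apply: (sub S') => //; have [_ sB _] := FP _ FS'; apply: sB => //.
      exact: adj_sub SS' _ Sm.
    apply: (sub S) => //; have [_ sB _] := FP _ FS; apply: sB => //.
    exact: adj_sub S'S _ Sm'.
  - move=> [[S FS Su]|[n /esym/pNu//]]; have [_ _] := FP _ FS; apply; by left.
exists (adj S); split=> // H' H'P SH' m H'm; apply: contrapT => Sm.
apply: (Smax H'); last by rewrite adjP.
by split=> [x Sx|H'S]; [apply: SH'; left|apply: Sm; left; apply: H'S].
Qed.

(** As [u] is not in pM, some hyperplane of the F_p-space M/pM misses it; the corresponding form
    [a], with a(u) = 1 modulo p, gives a map k (x) M -> k/pk, c (x) m -> a(m) c. Its source is zero,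
    so 1 lies in pk. Here [a] takes integer values chosen arbitrarily, and is additive modulo p
    only. *)
Lemma tensor0_prime_unit : exists h : k, h * p%:R = 1.
Proof.
have [H [[Hp HB Hu] Hmax]] := maximal_subgroup_avoiding.
have H0 : H 0 by rewrite -(mul0rn _ p).
have HN m : H m -> H (- m) by move=> Hm; rewrite -sub0r; apply: HB.
have HD m m' : H m -> H m' -> H (m + m').
  by move=> Hm Hm'; rewrite -[m']opprK; apply/HB/HN.
have HMn m n : H m -> H (m *+ n).
  by move=> Hm; elim: n => [|n IHn]; rewrite ?mulr0n // mulrS; apply: HD.
have HMz m (z : int) : H m -> H (m *~ z).
  by case: z => n Hm; rewrite ?NegzE -?pmulrn ?mulrNz -?pmulrn; [|apply: HN]; apply: HMn.
have HMp m (z : int) : H (m *~ (z * p)) by rewrite mulrzA -pmulrn.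
have bezout (z : int) : ~~ (p %| z)%Z -> exists w w' : int, w * z + w' * p = 1.
  move=> pz; have /coprimezP[[w w'] e] : coprimez z p.
    by rewrite coprimezE coprime_sym prime_coprime.
  by exists w, w'.
have rep m : exists a : int, H (m - u *~ a).
  have [Hm|Hm] := pselect (H m); first by exists 0; rewrite mulr0z subr0.
  (* By maximality H + Zm contains [u], say u = h + z m. As [u] is not in [H], p does not divide z,
     and an inverse w of z modulo p gives m = w u modulo [H]. *)
  pose H' : set M := fun x => exists (h : M) (z : int), H h /\ x = h + m *~ z.
  have [|H'u] := pselect (H' u).
    move=> [h [z [Hh eu]]]; have pz : ~~ (p %| z)%Z.
      apply/negP => /dvdzP[z' ez]; apply: Hu; rewrite eu; apply: HD => //.
      by rewrite ez.
    have [w [w' e]] := bezout z pz; exists w.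
    have -> : m - u *~ w = m *~ (w' * p) - h *~ w.
      rewrite -[in LHS](mulr1z m) -e mulrzDr eu mulrzDl -mulrzA [z * w]mulrC opprD.
      rewrite [m *~ _ + _]addrC -addrA; congr (_ + _).
      by rewrite addrCA subrr addr0.
    by apply: HB => //; apply: HMz.
  have H'H : forall x, H' x -> H x.
    apply: (Hmax H') => [|x Hx]; last by exists x, 0; rewrite mulr0z addr0.
    split=> [x|x x'|//]; first by exists (x *+ p), 0; rewrite mulr0z addr0.
    move=> [h [z [Hh ->]]] [h' [z' [Hh' ->]]]; exists (h - h'), (z - z'); split; first exact: HB.
    by rewrite mulrzBr opprD addrACA.
  case: Hm; apply: H'H; exists 0, 1; by rewrite mulr1z add0r.
pose a m := projT1 (cid (rep m)); have Ha m : H (m - u *~ a m) := projT2 (cid (rep m)).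
have uniq_rep (z : int) : H (u *~ z) -> (p %| z)%Z.
  move=> Hz; apply/negPn/negP => /bezout[w [w' e]]; apply: Hu.
  have -> : u = u *~ z *~ w + u *~ (w' * p) by rewrite -mulrzA [z * w]mulrC -mulrzDr e mulr1z.
  by apply: HD => //; apply: HMz.
pose N : {pred (zmodule k : lmodType int)} := fun c => `[< exists c' : k, c = c' * p%:R >].
have N_submod : submod_closed N.
  split=> [|z c c' /asboolP[d ->] /asboolP[d' ->]]; apply/asboolP.
    by exists 0; rewrite mul0r.
  by exists (d *~ z + d'); rewrite mulrDl mulrzAl.
pose Ns := HB.pack_for (submodClosed (zmodule k : lmodType int)) N
  (GRing.isSubmodClosed.Build int _ N N_submod).
pose f (cm : zmodule k * zmodule M) := quot_pi Ns ((cm.1 : k) *~ a cm.2).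
have fN (c : k) (z : int) : (p %| z)%Z -> (c *~ z : zmodule k) \in N.
  move=> /dvdzP[z' ->]; apply/asboolP; exists (c *~ z').
  by rewrite mulrzA -pmulrn mulr_natr.
have fP r : tensor_rel r -> lin_ext f r = 0.
  case=> [z c c' m|z c m m']; rewrite linearB linearP /= !lin_ext_delta /f /=.
    rewrite -linearP -linearB /= -(linear0 (quot_pi Ns)); congr quot_pi.
    by rewrite !scalezrE mulrzDl mulrzAC subrr.
  rewrite -linearP -linearB /= -(linear0 (quot_pi Ns)); apply/quot_piE; rewrite subr0.
  rewrite !scalezrE -mulrzA -mulrzDr -mulrzBr; apply: fN; apply: uniq_rep.
  have -> : u *~ (a (m *~ z + m') - (a m * z + a m')) =
      (m - u *~ a m) *~ z + (m' - u *~ a m') - (m *~ z + m' - u *~ a (m *~ z + m')).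
    rewrite mulrzBl -mulrzA addrACA opprB [RHS]addrC addrA subrK mulrzBr mulrzDr.
    by rewrite opprD.
  by apply: HB => //; apply: HD => //; apply: HMz.
have := congr1 (presented_ext fP) (tensor0 (tens (1 : zmodule k) (u : zmodule M))).
rewrite linear0 [LHS]presented_extE /f /= -(linear0 (quot_pi Ns)) => /quot_piE.
rewrite subr0 => /asboolP[c ec].
have [z ez] : exists z : int, a u = 1 + z * p.
  have /dvdzP[z ez] : (p %| a u - 1)%Z.
    apply: uniq_rep; rewrite mulrzBr mulr1z -opprB; exact/HN/Ha.
  by exists z; rewrite -ez addrC subrK.
exists (c - z%:~R); rewrite mulrBl -ec ez mulrzDr mulr1z.
by rewrite mulrzA -pmulrn mulr_natr addrK.
Qed.
End TensorZero.

Lemma natr_unit (k : comPzRingType) N : (0 < N)%N ->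
  (forall p, prime p -> (p %| N)%N -> exists h : k, h * p%:R = 1) ->
  exists h : k, h * N%:R = 1.
Proof.
have [m] := ubnP N; elim: m N => // m IHm [//|[|N]] leNm _ unitp.
  by exists 1; rewrite mulr1.
set p := pdiv N.+2; have p_prime : prime p by apply: pdiv_prime.
have pN : (p %| N.+2)%N by apply: pdiv_dvd.
have [h eh] := unitp p p_prime pN.
have [||q qp qN|h' eh'] := IHm (N.+2 %/ p)%N.
- by apply: leq_trans (ltn_Pdiv _ _) _; rewrite ?prime_gt1.
- by rewrite divn_gt0 ?prime_gt0 // dvdn_leq.
- apply: unitp => //; exact: dvdn_trans qN (dvdn_div pN).
exists (h' * h); rewrite -[in LHS](divnK pN) natrM mulrACA.
by rewrite eh' eh mulr1.
Qed.

Section Cotrivial.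
Variables (k : comPzRingType) (A : additive).

(** Finiteness gives the identity of (A/I)(x, x) a finite order N, which kills the whole group. If p
    divides N and id = p m, then (N/p) id = N m = 0 against minimality; so [tensor0_prime_unit]
    applies to every prime divisor of N. *)
Lemma k_cotrivialP (I : ideal A) : k_cotrivial k I -> cotrivial k I.
Proof.
move=> triv x; have [fin tens0] := triv x x.
pose u : iquot I x x := ipi I (add_id x).
have [N N_gt0 uN] : exists2 N, (0 < N)%N & u *+ N = 0.
  apply: contrapT => noN; apply: infinite_nat.
  rewrite -(preimage_setT (fun n : nat => u *+ n)); apply: finite_preimage fin => i j _ _.
  wlog ij : i j / (i <= j)%N => [wlg|eij].
    by case/orP: (leq_total i j) => [/wlg //|/wlg e /esym/e].
  apply/eqP; rewrite eqn_leq ij leqNgt; apply/negP => lt_ij.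
  apply: noN; exists (j - i)%N; first by rewrite subn_gt0.
  by rewrite mulrnBr // eij subrr.
have ex : exists N, (0 < N)%N && (u *+ N == 0).
  by exists N; rewrite N_gt0; apply/eqP.
case: (ex_minnP ex) => {N_gt0 uN}N /andP[N_gt0 /eqP uN] Nmin.
have killed (m : iquot I x x) : m *+ N = 0.
  have [f ->] := ipi_surj m.
  have -> : ipi I f *+ N = iquot_comp (ipi I f) (u *+ N).
    rewrite /u; have ipiMn n (g : add_hom x x) : ipi I g *+ n = ipi I (g *+ n).
      by elim: n => [|n IHn]; rewrite ?mulr0n ?ipi0 // !mulrS IHn -ipiD.
    by rewrite !ipiMn iquot_compE add_comp_mulnr add_compm1.
  by rewrite uN -(ipi0 I) iquot_compE add_compm0.
have [h hN] : exists h : k, h * N%:R = 1.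
  apply: natr_unit => // p p_prime pN.
  apply: (@tensor0_prime_unit k (iquot I x x) u p) => // m um.
  have : (N <= N %/ p)%N.
    apply: Nmin; rewrite divn_gt0 ?prime_gt0 // dvdn_leq //=.
    by rewrite -um -mulrnA mulnC divnK // killed.
  by rewrite leqNgt ltn_Pdiv // prime_gt1.
exists N, h; split=> //; rewrite -[_ *+ _]subr0; apply/ipiE.
have ipiMn n (g : add_hom x x) : ipi I g *+ n = ipi I (g *+ n).
  by elim: n => [|n IHn]; rewrite ?mulr0n ?ipi0 // !mulrS IHn -ipiD.
by rewrite -ipiMn uN ipi0.
Qed.

Definition antip (F : functor k A) := exists I : ideal A, cotrivial k I /\ factors I F.

Lemma antipolynomial_antip (F : functor k A) : antipolynomial F -> antip F.
Proof.
move=> [I [/k_cotrivialP cI [F' [a abij]]]]; exists I; split=> // x y f g v fg.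
apply: (bij_inj (abij y)); rewrite !naturality /=.
by congr (fmap F' _ _); apply/ipiE.
Qed.

End Cotrivial.

(** * Biproducts *)

Section Biproduct.
Variable A : additive.

Definition bp_family (x y : A) : 'I_2 -> A := fun i => if nat_of_ord i is 0 then x else y.
Definition ord1 : 'I_2 := @Ordinal 2 1 isT.

Definition bp (x y : A) : A := dsum (bp_family x y).
Definition in1 (x y : A) : add_hom x (bp x y) := dinj (bp_family x y) ord0.
Definition in2 (x y : A) : add_hom y (bp x y) := dinj (bp_family x y) ord1.
Definition pr1 (x y : A) : add_hom (bp x y) x := dproj (bp_family x y) ord0.
Definition pr2 (x y : A) : add_hom (bp x y) y := dproj (bp_family x y) ord1.

Lemma pr1_in1 x y : add_comp (pr1 x y) (in1 x y) = add_id x.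
Proof. exact: (@dproj_inj A 2 (bp_family x y) ord0). Qed.
Lemma pr2_in2 x y : add_comp (pr2 x y) (in2 x y) = add_id y.
Proof. exact: (@dproj_inj A 2 (bp_family x y) ord1). Qed.
Lemma pr2_in1 x y : add_comp (pr2 x y) (in1 x y) = 0.
Proof. by apply: (@dproj_inj0 A 2 (bp_family x y) ord0 ord1) => /eqP. Qed.
Lemma pr1_in2 x y : add_comp (pr1 x y) (in2 x y) = 0.
Proof. by apply: (@dproj_inj0 A 2 (bp_family x y) ord1 ord0) => /eqP. Qed.
Lemma bp_id x y :
  add_comp (in1 x y) (pr1 x y) + add_comp (in2 x y) (pr2 x y) = add_id (bp x y).
Proof.
rewrite -[RHS]dsum_id !big_ord_recl big_ord0 addr0; congr (_ + _).
by rewrite (_ : lift ord0 ord0 = ord1) //; apply/val_inj.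
Qed.

Definition bpmap (x y x' y' : A) (f : add_hom x x') (g : add_hom y y') :
    add_hom (bp x y) (bp x' y') :=
  add_comp (in1 x' y') (add_comp f (pr1 x y)) +
  add_comp (in2 x' y') (add_comp g (pr2 x y)).

Lemma bpmap_in1 x y x' y' f g : add_comp (@bpmap x y x' y' f g) (in1 x y) =
  add_comp (in1 x' y') f.
Proof.
rewrite add_compDl -!add_compA pr1_in1 pr2_in1 add_compm1 !add_compm0.
exact: addr0.
Qed.
Lemma bpmap_in2 x y x' y' f g : add_comp (@bpmap x y x' y' f g) (in2 x y) =
  add_comp (in2 x' y') g.
Proof.
rewrite add_compDl -!add_compA pr1_in2 pr2_in2 add_compm1 !add_compm0.
exact: add0r.
Qed.
Lemma pr1_bpmap x y x' y' f g : add_comp (pr1 x' y') (@bpmap x y x' y' f g) =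
  add_comp f (pr1 x y).
Proof.
rewrite add_compDr !add_compA pr1_in1 pr1_in2 add_comp1m !add_comp0m.
exact: addr0.
Qed.
Lemma pr2_bpmap x y x' y' f g : add_comp (pr2 x' y') (@bpmap x y x' y' f g) =
  add_comp g (pr2 x y).
Proof.
rewrite add_compDr !add_compA pr2_in1 pr2_in2 add_comp1m !add_comp0m.
exact: add0r.
Qed.

Lemma bpmap1 x y : bpmap (add_id x) (add_id y) = add_id (bp x y).
Proof. by rewrite /bpmap !add_comp1m bp_id. Qed.

Lemma bpmapM x y x' y' x'' y'' (f' : add_hom x' x'') (g' : add_hom y' y'')
    (f : add_hom x x') (g : add_hom y y') :
  bpmap (add_comp f' f) (add_comp g' g) = add_comp (bpmap f' g') (bpmap f g).
Proof.
rewrite [X in _ = add_comp X _]/bpmap add_compDl.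
by rewrite -!add_compA pr1_bpmap pr2_bpmap /bpmap -!add_compA.
Qed.

Lemma bpmap_addl x y x' y' (f f' : add_hom x x') (g : add_hom y y') :
  bpmap (f + f') g = bpmap f g + add_comp (in1 x' y') (add_comp f' (pr1 x y)).
Proof. by rewrite /bpmap add_compDl add_compDr addrAC. Qed.
Lemma bpmap_addr x y x' y' (f : add_hom x x') (g g' : add_hom y y') :
  bpmap f (g + g') = bpmap f g + add_comp (in2 x' y') (add_comp g' (pr2 x y)).
Proof. by rewrite /bpmap add_compDl add_compDr addrA. Qed.

Definition bp_functor : cfunctor (prodC A A) A :=
  @CFunctor (prodC A A) A (fun xy => bp xy.1 xy.2) (fun xy xy' fg => bpmap fg.1 fg.2)
    (fun xy => bpmap1 xy.1 xy.2) (fun _ _ _ g f => bpmapM g.1 g.2 f.1 f.2).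

Definition bp_diag_adj : adjunction bp_functor (diag A).
Proof.
unshelve refine (@Adjunction A (prodC A A) bp_functor (diag A)
  (fun xy => (in1 xy.1 xy.2, in2 xy.1 xy.2)) (fun c => pr1 c c + pr2 c c) _ _ _ _).
- by move=> [x y] [x' y'] [f g]; rewrite /= /prod_comp /= bpmap_in1 bpmap_in2.
- by move=> c c' u; rewrite /= add_compDl add_compDr pr1_bpmap pr2_bpmap.
- move=> c; rewrite /= /prod_comp /= !add_compDl pr1_in1 pr1_in2 pr2_in1 pr2_in2.
  by rewrite addr0 add0r.
- move=> [x y] /=; rewrite -bp_id add_compDl pr1_bpmap pr2_bpmap.
  by [].
Defined.

Definition diag_bp_adj : adjunction (diag A) bp_functor.
Proof.
unshelve refine (@Adjunction (prodC A A) A (diag A) bp_functor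
  (fun c => in1 c c + in2 c c) (fun xy => (pr1 xy.1 xy.2, pr2 xy.1 xy.2)) _ _ _ _).
- by move=> c c' u; rewrite /= add_compDl add_compDr bpmap_in1 bpmap_in2.
- by move=> [x y] [x' y'] [f g]; rewrite /= /prod_comp /= pr1_bpmap pr2_bpmap.
- move=> [x y] /=; rewrite -bp_id add_compDr bpmap_in1 bpmap_in2.
  by [].
- move=> c; rewrite /= /prod_comp /= !add_compDr pr1_in1 pr1_in2 pr2_in1 pr2_in2.
  by rewrite addr0 add0r.
Defined.
End Biproduct.

Section Swap.
Variables C D : category.

Definition swap_functor : cfunctor (prodC C D) (prodC D C) :=
  @CFunctor (prodC C D) (prodC D C) (fun x => (x.2, x.1)) (fun x y u => (u.2, u.1))
    (fun x => erefl) (fun x y z g f => erefl).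
End Swap.

Lemma swap_adj (C D : category) : adjunction (swap_functor C D) (swap_functor D C).
Proof.
unshelve refine (@Adjunction (prodC D C) (prodC C D) (swap_functor C D) (swap_functor D C)
  (fun d => (idm d.1, idm d.2)) (fun c => (idm c.1, idm c.2)) _ _ _ _).
- by move=> [x y] [x' y'] [f g]; rewrite /= /prod_comp /= !comp1m !compm1.
- by move=> [x y] [x' y'] [f g]; rewrite /= /prod_comp /= !comp1m !compm1.
- by move=> [x y]; rewrite /= /prod_comp /= !comp1m.
- by move=> [x y]; rewrite /= /prod_comp /= !comp1m.
Qed.

Lemma ext_zeros_swap (k : comPzRingType) (C D : category) (F G : functor k (prodC C D)) :
  ext_zeros (restr (swap_functor D C) F) (restr (swap_functor D C) G) ->
  ext_zeros F G.
Proof.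
move=> V.
have {}V : ext_zeros F (restr (swap_functor C D) (restr (swap_functor D C) G)).
  by move=> n; apply: (adj_ext_zero (swap_adj C D)).
pose G' := restr (swap_functor C D) (restr (swap_functor D C) G).
(* Swapping twice yields (x.1, x.2), which is not convertible to [x]; pairs of identities serve as
   the isomorphism. *)
pose i x : @hom (prodC C D) x (x.1, x.2) := (idm x.1, idm x.2).
pose j x : @hom (prodC C D) (x.1, x.2) x := (idm x.1, idm x.2).
unshelve refine (ext_zeros_retract (s := _) (r := _) _ V).
- refine (@NatTrans k _ G G' (fun x => fmap G (i x)) _ _).
    by move=> x; exact: (@fmap_linear _ _ G _ _ (i x)).
  move=> x y u v; rewrite /= -!fmapM; congr (fmap G _ v).
  by rewrite /= /prod_comp /= !comp1m !compm1.
- refine (@NatTrans k _ G' G (fun x => fmap G (j x)) _ _).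
    by move=> x; exact: (@fmap_linear _ _ G _ _ (j x)).
  move=> x y u v; rewrite /= -!fmapM; congr (fmap G _ v).
  by rewrite /= /prod_comp /= !comp1m !compm1.
- move=> x v; rewrite /= -fmapM -[RHS](@fmap1 _ _ G x v); congr (fmap G _ v).
  by rewrite /= /prod_comp /= !comp1m.
Qed.

(** * Degree and factorization after adding a fixed object *)

Section Transfer.
Variables (k : comPzRingType) (A : additive) (G' E : functor k A) (T : A -> A).
Variable Th : forall x y : A, add_hom x y -> add_hom (T x) (T y).
Variable e : forall x, {additive G' x -> E (T x)}.
Hypothesis e_inj : forall x, injective (e x).
Hypothesis eTh : forall (x y : A) (f : add_hom x y) v,
  e y (fmap G' (f : @hom A x y) v) = fmap E (Th f : @hom A (T x) (T y)) (e x v).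

(** Adding a fixed object, with its identity, is affine and not additive on morphisms; the arbitrary
    base point in [deg_le] absorbs the constant term. *)
Lemma deg_le_transfer d :
  (forall x y (f g : add_hom x y), exists h, forall j, Th (f + g *+ j) = Th f + h *+ j) ->
  deg_le d E -> deg_le d G'.
Proof.
move=> Taff Ed x y f g v; apply: (e_inj (x := y)); rewrite raddf0 raddf_pact.
have [h eh] := Taff x y f g; rewrite -[RHS](Ed _ _ (Th f) h (e x v)).
by apply: eq_pact => j /=; rewrite eTh eh.
Qed.

Lemma factors_transfer (I : ideal A) :
  (forall x y (f g : add_hom x y), f - g \in I x y -> Th f - Th g \in I (T x) (T y)) ->
  factors I E -> factors I G'.
Proof.
move=> TI EI x y f g v fg; apply: (e_inj (x := y)); rewrite !eTh.
exact/EI/TI.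
Qed.
End Transfer.

Section Affine.
Variable A : additive.

Lemma bpmap_affinel (z x y : A) (f g : add_hom x y) : exists h : add_hom (bp x z) (bp y z),
  forall j, bpmap (f + g *+ j) (add_id z) = bpmap f (add_id z) + h *+ j.
Proof.
exists (add_comp (in1 y z) (add_comp g (pr1 x z))) => j.
by rewrite bpmap_addl add_comp_mulnl add_comp_mulnr.
Qed.

Lemma bpmap_affiner (z x y : A) (f g : add_hom x y) : exists h : add_hom (bp z x) (bp z y),
  forall j, bpmap (add_id z) (f + g *+ j) = bpmap (add_id z) f + h *+ j.
Proof.
exists (add_comp (in2 z y) (add_comp g (pr2 z x))) => j.
by rewrite bpmap_addr add_comp_mulnl add_comp_mulnr.
Qed.

Lemma bpmap_ideal (I : ideal A) (z x y : A) (f g : add_hom x y) : f - g \in I x y ->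
  bpmap (add_id z) f - bpmap (add_id z) g \in I (bp z x) (bp z y).
Proof.
move=> fg; have -> : bpmap (add_id z) f = bpmap (add_id z) g +
    add_comp (in2 z y) (add_comp (f - g) (pr2 z x)).
  by rewrite -bpmap_addr [g + _]addrC subrK.
by rewrite addrAC subrr add0r; apply/idealMl/idealMr.
Qed.
End Affine.

(** * Vanishing for bifunctors of AP-type *)

Section APVanishing.
Variables (k : comPzRingType) (A : additive).

Definition ap_bifunctor (F : functor k (prodC A A)) :=
  (forall y : A, antip (restr (insl A y) F)) /\
  (forall x : A, exists d, deg_le d (restr (insr A x) F)).

Lemma AP_typeP F : AP_type F -> ap_bifunctor F.
Proof.
by move=> [Fa Fp]; split=> z; [exact/antipolynomial_antip/Fa|exact/polynomial_deg_le/Fp].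
Qed.

Lemma deg_le_shift d (E : functor k A) (x : A) : deg_le d E ->
  deg_le d (restr (insr A x) (restr (bp_functor A) E)).
Proof.
apply: (@deg_le_transfer k A (restr (insr A x) (restr (bp_functor A) E)) E
  (fun y => bp x y) (fun y z f => bpmap (add_id x) f)
  (fun y => idfun : {additive E (bp x y) -> E (bp x y)})) => //.
by move=> y z f g; apply: bpmap_affiner.
Qed.

Lemma factors_shift I (E : functor k A) (x : A) : factors I E ->
  factors I (restr (insr A x) (restr (bp_functor A) E)).
Proof.
apply: (@factors_transfer k A (restr (insr A x) (restr (bp_functor A) E)) E
  (fun y => bp x y) (fun y z f => bpmap (add_id x) f)
  (fun y => idfun : {additive E (bp x y) -> E (bp x y)})) => //.
by move=> y z f g; apply: bpmap_ideal.
Qed.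

(** As the diagonal is left adjoint to the sum, the vanishing of Ext_A(E, D(x, x)) follows from that
    of Ext(E(x + y), D(x, y)), which is tested on fibres. *)
Lemma ext_zeros_diag (E : functor k A) (D : functor k (prodC A A)) :
  (forall x x' : A, ext_zeros (restr (insr A x) (restr (bp_functor A) E))
                              (restr (insr A x') D)) ->
  ext_zeros E (restr (diag A) D).
Proof.
move=> V n; apply: (adj_ext_zero (diag_bp_adj A)); move: n.
exact: ext_zeros_fibre.
Qed.

Variable G : functor k (prodC A A).

Definition bp2 : functor k (prodC A A) := restr (bp_functor A) (restr (diag A) G).

Definition bp_right : cfunctor (prodC A A) (prodC A A) :=
  @CFunctor (prodC A A) (prodC A A) (fun xy => (xy.1, bp xy.1 xy.2))
    (fun xy xy' fg => (fg.1, bpmap fg.1 fg.2))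
    (fun xy => congr1 (pair _) (bpmap1 xy.1 xy.2))
    (fun _ _ _ g f => congr1 (pair _) (bpmapM g.1 g.2 f.1 f.2)).

Definition bp1 : functor k (prodC A A) := restr bp_right G.

Definition pr1_map (x y z : A) : @hom (prodC A A) (bp x z, y) (x, y) :=
  (pr1 x z, add_id y).

Definition retract1 : nattrans bp2 bp1.
Proof.
refine (@NatTrans k (prodC A A) bp2 bp1
  (fun xy v => fmap G (pr1_map xy.1 (bp xy.1 xy.2) xy.2) v) _ _).
- by move=> xy; exact: (@fmap_linear _ _ G _ _ (pr1_map _ _ _)).
- move=> xy xy' fg v; rewrite /= -!fmapM; congr (fmap G _ v).
  by rewrite /= /prod_comp /= pr1_bpmap add_comp1m add_compm1.
Defined.

Definition pr2_map (xy : prodC A A) z : @hom (prodC A A) (xy.1, bp z xy.2) xy :=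
  (add_id xy.1, pr2 z xy.2).

Definition retract2 : nattrans bp1 G.
Proof.
refine (@NatTrans k (prodC A A) bp1 G (fun xy v => fmap G (pr2_map xy xy.1) v) _ _).
- by move=> xy; exact: (@fmap_linear _ _ G _ _ (pr2_map xy xy.1)).
- move=> xy xy' fg v; rewrite /= -!fmapM; congr (fmap G _ v).
  by rewrite /= /prod_comp /= pr2_bpmap add_comp1m add_compm1.
Defined.

Lemma retract1_surj xy w : exists v, retract1 xy v = w.
Proof.
exists (fmap G ((in1 xy.1 xy.2, add_id (bp xy.1 xy.2)) :
    @hom (prodC A A) (xy.1, bp xy.1 xy.2) (bp xy.1 xy.2, bp xy.1 xy.2)) w).
rewrite /= -fmapM -[RHS](@fmap1 _ _ G (xy.1, bp xy.1 xy.2) w); congr (fmap G _ w).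
by rewrite /= /prod_comp /= pr1_in1 add_comp1m.
Qed.

Lemma retract2_surj xy w : exists v, retract2 xy v = w.
Proof.
exists (fmap G ((add_id xy.1, in2 xy.1 xy.2) :
    @hom (prodC A A) xy (xy.1, bp xy.1 xy.2)) w).
rewrite /= -fmapM -[RHS](@fmap1 _ _ G xy w); congr (fmap G _ w).
by rewrite /= /prod_comp /= pr2_in2 add_comp1m.
Qed.

Section FirstKernel.
Variable x : A.

(** At fixed [x], the two occurrences of y in G(x + y, x + y) become separate variables. They are
    exchanged, so that fixing the first one leaves the antipolynomial slot free, as
    [ext_zeros_fibre] requires. *)
Definition bp_bp : cfunctor (prodC A A) (prodC A A).
Proof.
refine (@CFunctor (prodC A A) (prodC A A) (fun ab => (bp x ab.2, bp x ab.1))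
  (fun ab ab' uv => (bpmap (add_id x) uv.2, bpmap (add_id x) uv.1)) _ _).
- by move=> ab; rewrite !bpmap1.
- by move=> a b c v u; congr pair; rewrite /= -?bpmapM add_comp1m.
Defined.

Definition fst_bp : cfunctor (prodC A A) (prodC A A).
Proof.
refine (@CFunctor (prodC A A) (prodC A A) (fun ab => (x, bp x ab.1))
  (fun ab ab' uv => (add_id x, bpmap (add_id x) uv.1)) _ _).
- by move=> ab; rewrite !bpmap1.
- by move=> a b c v u; congr pair; rewrite /= -?bpmapM add_comp1m.
Defined.

Definition proj_bp_bp : nattrans (restr bp_bp G) (restr fst_bp G).
Proof.
refine (@NatTrans k (prodC A A) (restr bp_bp G) (restr fst_bp G)
  (fun ab v => fmap G (pr1_map x (bp x ab.1) ab.2) v) _ _).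
- by move=> ab; exact: (@fmap_linear _ _ G _ _ (pr1_map _ _ _)).
- move=> xy xy' fg v; rewrite /= -!fmapM; congr (fmap G _ v).
  by rewrite /= /prod_comp /= pr1_bpmap !add_comp1m add_compm1.
Defined.

Definition ker_bp_bp : functor k (prodC A A) := ker_functor proj_bp_bp.

Lemma ext_zeros_ker_retract1 (E : functor k A) :
  ext_zeros E (restr (diag A) ker_bp_bp) ->
  ext_zeros E (restr (insr A x) (ker_functor retract1)).
Proof.
move=> V; unshelve refine (ext_zeros_retract (s := _) (r := _) _ V).
- refine (@NatTrans k A (restr (insr A x) (ker_functor retract1)) (restr (diag A) ker_bp_bp)
    (fun y v => @Cycle k _ _ (proj_bp_bp (y, y)) (cycle_val v) (cycleP v)) _ _).
  + by move=> y a v w; apply/val_inj.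
  + by move=> y z u v; apply/val_inj.
- refine (@NatTrans k A (restr (diag A) ker_bp_bp) (restr (insr A x) (ker_functor retract1))
    (fun y v => @Cycle k _ _ (retract1 (x, y)) (cycle_val v) (cycleP v)) _ _).
  + by move=> y a v w; apply/val_inj.
  + by move=> y z u v; apply/val_inj.
- by move=> y v; apply/val_inj.
Qed.

Lemma ker_bp_bp_factors I (y : A) : factors I (restr (insl A (bp x y)) G) ->
  factors I (restr (insr A y) ker_bp_bp).
Proof.
apply: (@factors_transfer k A (restr (insr A y) ker_bp_bp) (restr (insl A (bp x y)) G)
  (fun z => bp x z) (fun z t f => bpmap (add_id x) f)
  (fun z => ker_incl proj_bp_bp (y, z) : {additive _ -> _})).
- by move=> z v w vw; apply/val_inj.
- by move=> z t f v; rewrite /= bpmap1.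
- by move=> z t f g; apply: bpmap_ideal.
Qed.

(** The zero map on the added variable acts on x + z through the projection to [x], under which the
    kernel goes to zero. *)
Lemma ker_bp_bp_reduced (y : A) : reduced (restr (insr A y) ker_bp_bp).
Proof.
move=> z t v; apply/val_inj => /=; have /eqP v0 := cycleP v.
pose j : @hom (prodC A A) (x, bp x y) (bp x t, bp x y) := (in1 x t, add_id (bp x y)).
transitivity (fmap G j (fmap G (pr1_map x (bp x y) z) (cycle_val v))).
  rewrite -fmapM; congr (fmap G _ _); rewrite /= /prod_comp /= bpmap1 add_comp1m.
  by rewrite /bpmap add_comp0m add_compm0 addr0 add_comp1m.
by rewrite [fmap G (pr1_map _ _ _) _]v0 linear0.
Qed.

End FirstKernel.

Section SecondKernel.
Variable y : A.

(** At fixed [y], separates the two occurrences of x in G(x, x + y); the free variable of a fibre is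
    now the polynomial slot. *)
Definition right_bp : cfunctor (prodC A A) (prodC A A).
Proof.
refine (@CFunctor (prodC A A) (prodC A A) (fun ab => (ab.1, bp ab.2 y))
  (fun ab ab' uv => (uv.1, bpmap uv.2 (add_id y))) _ _).
- by move=> ab; rewrite !bpmap1.
- by move=> a b c v u; congr pair; rewrite /= -?bpmapM add_comp1m.
Defined.

Definition snd_const : cfunctor (prodC A A) (prodC A A).
Proof.
refine (@CFunctor (prodC A A) (prodC A A) (fun ab => (ab.1, y))
  (fun ab ab' uv => (uv.1, add_id y)) _ _) => //.
by move=> a b c v u; congr pair; rewrite /= add_comp1m.
Defined.

Definition proj_right_bp : nattrans (restr right_bp G) (restr snd_const G).
Proof.
refine (@NatTrans k (prodC A A) (restr right_bp G) (restr snd_const G)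
  (fun ab v => fmap G (pr2_map (ab.1, y) ab.2) v) _ _).
- by move=> ab; exact: (@fmap_linear _ _ G _ _ (pr2_map (ab.1, y) ab.2)).
- move=> ab ab' fg v; rewrite /= -!fmapM; congr (fmap G _ v).
  by rewrite /= /prod_comp /= pr2_bpmap !add_comp1m add_compm1.
Defined.

Definition ker_right_bp : functor k (prodC A A) := ker_functor proj_right_bp.

Lemma ext_zeros_ker_retract2 (E : functor k A) :
  ext_zeros E (restr (diag A) ker_right_bp) ->
  ext_zeros E (restr (insr A y) (restr (swap_functor A A) (ker_functor retract2))).
Proof.
move=> V; unshelve refine (ext_zeros_retract (s := _) (r := _) _ V).
- refine (@NatTrans k A (restr (insr A y) (restr (swap_functor A A) (ker_functor retract2)))
    (restr (diag A) ker_right_bp)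
    (fun x v => @Cycle k _ _ (proj_right_bp (x, x)) (cycle_val v) (cycleP v)) _ _).
  + by move=> x a v w; apply/val_inj.
  + by move=> x z u v; apply/val_inj.
- refine (@NatTrans k A (restr (diag A) ker_right_bp)
    (restr (insr A y) (restr (swap_functor A A) (ker_functor retract2)))
    (fun x v => @Cycle k _ _ (retract2 (x, y)) (cycle_val v) (cycleP v)) _ _).
  + by move=> x a v w; apply/val_inj.
  + by move=> x z u v; apply/val_inj.
- by move=> x v; apply/val_inj.
Qed.

Lemma ker_right_bp_deg_le d (x : A) : deg_le d (restr (insr A x) G) ->
  deg_le d (restr (insr A x) ker_right_bp).
Proof.
apply: (@deg_le_transfer k A (restr (insr A x) ker_right_bp) (restr (insr A x) G)
  (fun z => bp z y) (fun z t f => bpmap f (add_id y))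
  (fun z => ker_incl proj_right_bp (x, z) : {additive _ -> _})) => //.
- by move=> z v w vw; apply/val_inj.
- by move=> z t f g; apply: bpmap_affinel.
Qed.

Lemma ker_right_bp_reduced (x : A) : reduced (restr (insr A x) ker_right_bp).
Proof.
move=> z t v; apply/val_inj => /=; have /eqP v0 := cycleP v.
pose j : @hom (prodC A A) (x, y) (x, bp t y) := (add_id x, in2 t y).
transitivity (fmap G j (fmap G (pr2_map (x, y) z) (cycle_val v))).
  rewrite -fmapM; congr (fmap G _ _); rewrite /= /prod_comp /= add_comp1m.
  by rewrite /bpmap add_comp0m add_compm0 add0r add_comp1m.
by rewrite [fmap G (pr2_map _ _) _]v0 linear0.
Qed.
End SecondKernel.

(** [retract1] alters the antipolynomial slot only, so it is played against the polynomial variable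
    of [F]: the first variable is the one fixed. *)
Lemma ext_zeros_ker1 F : ap_bifunctor F -> ap_bifunctor G ->
  ext_zeros F (ker_functor retract1).
Proof.
move=> [_ Fp] [Ga _]; apply: ext_zeros_fibre => x x'.
apply/ext_zeros_ker_retract1/ext_zeros_diag => y y'.
have [d Fd] := Fp x; have [I [cI GI]] := Ga (bp x' y').
apply: (ext_zeros_deg_le_factors cI (deg_le_shift (x := y) Fd)).
  exact: ker_bp_bp_factors.
exact: ker_bp_bp_reduced.
Qed.

(** Here the antipolynomial variable of [F] must remain free; the swap makes the second variable the
    one fixed by [ext_zeros_fibre]. *)
Lemma ext_zeros_ker2 F : ap_bifunctor F -> ap_bifunctor G ->
  ext_zeros F (ker_functor retract2).
Proof.
move=> [Fa _] [_ Gp]; apply: ext_zeros_swap; apply: ext_zeros_fibre => y y'.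
apply/ext_zeros_ker_retract2/ext_zeros_diag => x x'.
have [I [cI FI]] := Fa y; have [d Gd] := Gp x'.
have FI' : factors I (restr (insr A y) (restr (swap_functor A A) F)) by [].
apply: (ext_zeros_factors_deg_le cI (factors_shift (x := x) FI') (ker_right_bp_deg_le Gd)).
exact: ker_right_bp_reduced.
Qed.
End APVanishing.

(** * Restriction along the diagonal: Ext *)

Lemma homology_map_bij (k : comPzRingType) (L M N L' M' N' : lmodType k)
    (f : {linear L -> M}) (g : {linear M -> N}) (f' : {linear L' -> M'})
    (g' : {linear M' -> N'}) (a : {linear M -> M'})
    (aZ : forall x, g x = 0 -> g' (a x) = 0)
    (aB : forall y, exists y', f' y' = a (f y)) :
  (forall x, g x = 0 -> (exists y', f' y' = a x) -> exists y, f y = x) ->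
  (forall x', g' x' = 0 -> exists2 x, g x = 0 & exists y', f' y' = a x - x') ->
  bijective (homology_map aZ aB).
Proof.
move=> inj surj; have mapE z : homology_map aZ aB (quot_pi (@boundary k L M N f g) z) =
    homology_map_cycles f' aZ z by exact: quot_extE.
have map_ker z : homology_map aZ aB z = 0 -> z = 0.
  have [c ->] := quot_surj z; rewrite mapE -(linear0 (quot_pi (@boundary k L' M' N' f' g'))).
  move=> /quot_piE; rewrite subr0 => /asboolP[y' ey'].
  rewrite -(linear0 (quot_pi (@boundary k L M N f g))); apply/quot_piE; rewrite subr0.
  by apply/asboolP; apply: inj; [exact/eqP/(cycleP c)|exists y'].
have map_inj : injective (homology_map aZ aB).
  move=> z1 z2 e; apply/eqP; rewrite -subr_eq0; apply/eqP/map_ker.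
  by rewrite linearB e subrr.
have map_surj z : exists w, homology_map aZ aB w = z.
  have [c ->] := quot_surj z; have /eqP c0 := cycleP c.
  have [x gx [y' ey']] := surj _ c0.
  have xP : x \in Defs.cycle g by apply/eqP.
  exists (quot_pi (@boundary k L M N f g) (Cycle xP)); rewrite mapE; apply/quot_piE.
  by apply/asboolP; exists y'.
exists (fun z => projT1 (cid (map_surj z))) => z; last by case: cid.
by apply: map_inj; case: cid.
Qed.

(** Exactness of Ext^n(F, ker q) -> Ext^n(F, G) -> Ext^n(F, H) in the middle. *)
Lemma ext_inj_of_ker (k : comPzRingType) (C : category) (F G H : functor k C)
    (P : resolution F) (projP : res_projective P) (q : nattrans G H)
    (qsurj : forall x w, exists v, q x v = w) n (b : nattrans (P n) G) :
  ext_zero n F (ker_functor q) -> ext_out P G n b = 0 ->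
  (exists c, ext_in P H n c = ntcomp q b) -> exists c, ext_in P G n c = b.
Proof.
move=> V /ext_outE b0 [c ec]; have ses := ker_short_exact qsurj.
have [c1 ec1] := ses_lift_quot projP ses c.
have [|b' eb'] := ses_lift_sub projP ses (b := b - ext_in P G n c1).
  move=> x v; rewrite nt_subE linearB /= -[q x (b x v)]/(ntcomp q b x v) -ec.
  by rewrite -[X in _ - X]/(ntcomp q (ext_in P G n c1) x v) ext_in_comp ec1 subrr.
have [|c' ec'] := ext_zeroP projP V (b := b').
  apply: (ses_cocycle_sub ses) => x v.
  rewrite -[LHS]/(ntcomp (ker_incl q) b' x (res_d P n x v)) eb'.
  by rewrite nt_subE b0; have /ext_outE -> := ext_out_in c1; exact: subrr.
exists (c1 + ntcomp (ker_incl q) c').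
by rewrite linearD /= -ext_in_comp ec' eb' addrC subrK.
Qed.

Section RestrictionAlongAdjoint.
Variables (k : comPzRingType) (C D : category).
Variables (psi : cfunctor D C) (phi : cfunctor C D) (adj : adjunction psi phi).
Variables (F G : functor k D).

(** After identifying Ext_C(phi^*F, phi^*G) with Ext_D(F, psi^*phi^*G), restriction along [phi] is
    composition with this unit, and [r] below is a retraction of it. *)
Definition adj_eta : nattrans G (restr psi (restr phi G)) := adj_up adj (nt_id (restr phi G)).

Variable r : nattrans (restr psi (restr phi G)) G.
Hypothesis r_eta : forall x v, r x (adj_eta x v) = v.

Variables (P : resolution F) (Q : resolution (restr phi F)).
Hypotheses (projP : res_projective P) (projQ : res_projective Q).
Variable f : chain_map Q (restr_resolution phi P).
Hypothesis r_inj : forall n (b : nattrans (P n) (restr psi (restr phi G))),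
  ext_out P _ n b = 0 -> (exists c, ext_in P _ n c = ntcomp r b) ->
  exists c, ext_in P _ n c = b.

Local Notation PP := (restr_resolution phi P).

Lemma adj_up_restr n (b : nattrans (P n) G) :
  adj_up adj (nt_restr phi b) = ntcomp adj_eta b.
Proof.
apply: nattransP => x v; exact: (naturality b (adj_unit adj x) v).
Qed.

Lemma adj_up_restrK n (b : nattrans (P n) G) :
  ntcomp r (adj_up adj (nt_restr phi b)) = b.
Proof. by rewrite adj_up_restr; apply: nattransP => x v; apply: r_eta. Qed.

Lemma adj_up_ext_in n H (c : nattrans (PP n.-1) H) :
  adj_up adj (ext_in PP H n c) = ext_in P (restr psi H) n (adj_up adj c).
Proof.
case: n c => [|n] c; apply: nattransP => x v //=.
by congr (c _ _); rewrite naturality.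
Qed.

Lemma adj_up_ext_out n H (c : nattrans (PP n) H) :
  ext_out P (restr psi H) n (adj_up adj c) = adj_up adj (ext_out PP H n c).
Proof. by apply: nattransP => x v; rewrite /= naturality. Qed.

Lemma adj_down_ext_in n H (c : nattrans (P n.-1) (restr psi H)) :
  adj_down adj (ext_in P (restr psi H) n c) = ext_in PP H n (adj_down adj c).
Proof. by rewrite -[c in LHS](adj_downK adj) -adj_up_ext_in adj_upK. Qed.

Lemma projPP : res_projective PP.
Proof. by move=> n; apply: restr_projective adj _ _; apply: projP. Qed.

Lemma ext_res_cochain_inj n (b : nattrans (P n) G) : ext_out P G n b = 0 ->
  (exists c, ext_in Q (restr phi G) n c = ext_res_cochain G f n b) ->
  exists c, ext_in P G n c = b.
Proof.
move=> /ext_outE b0 [c ec]; have [g] := chain_map_exists Q projPP.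
have bb0 : ext_out PP (restr phi G) n (nt_restr phi b) = 0.
  by apply/ext_outE => x v; apply: b0.
have [c2 ec2] := chain_map_homotopic g f projPP bb0.
have [c1 ec1] := ext_in_chain c (chain_d g).
exists (ntcomp r (adj_up adj (c1 - c2))).
rewrite -ext_in_comp -adj_up_ext_in linearB /= ec2 -ec1 ec opprB addrC subrK.
exact: adj_up_restrK.
Qed.

(** The transpose [b1] of [b] and the image under [adj_eta] of r b1 have the same image under [r];
    as [r] is injective on cohomology, they are cohomologous, and r b1 is a preimage. *)
Lemma ext_res_cochain_surj n (b : nattrans (Q n) (restr phi G)) :
  ext_out Q (restr phi G) n b = 0 ->
  exists2 b', ext_out P G n b' = 0 &
    exists c, ext_in Q (restr phi G) n c = ext_res_cochain G f n b' - b.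
Proof.
move=> b0; have [g] := chain_map_exists Q projPP.
pose b1 := adj_up adj (ntcomp b (g n)); pose b' := ntcomp r b1.
have b10 : ext_out P _ n b1 = 0.
  rewrite adj_up_ext_out (_ : ext_out PP _ n _ = 0); first exact: nattransP.
  apply/ext_outE => x v; rewrite ntcompE -[g n x _]ntcompE -chain_d ntcompE.
  by move/ext_outE: b0 => ->.
have b'0 : ext_out P G n b' = 0.
  by apply/ext_outE => x v; rewrite ntcompE; move/ext_outE: b10 => ->; rewrite linear0.
exists b' => //.
have [||c ec] := r_inj (b := adj_up adj (nt_restr phi b') - b1).
- by rewrite linearB /= b10 subr0 adj_up_restr; apply/ext_outE => x v;
     rewrite ntcompE; move/ext_outE: b'0 => ->; rewrite linear0.
- exists 0; rewrite linear0; apply: nattransP => x v.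
  rewrite ntcompE nt_subE linearB /= -[r x (b1 x v)]/(b' x v).
  by rewrite -[r x _]/(ntcomp r (adj_up adj (nt_restr phi b')) x v) adj_up_restrK subrr.
have [c1 ec1] := @ext_in_chain k C _ PP _ Q f (restr phi G) n (adj_down adj c) (chain_d f).
have [c2 ec2] := chain_map_homotopic f g projQ b0.
exists (c1 + c2); rewrite linearD /= -ec1 -adj_down_ext_in ec ec2.
apply: nattransP => x v; rewrite nt_addE !nt_subE !ntcompE.
have -> : adj_down adj (adj_up adj (nt_restr phi b') - b1) =
    nt_restr phi b' - ntcomp b (g n).
  rewrite -[RHS](_ : adj_down adj (adj_up adj (nt_restr phi b')) - adj_down adj b1 = _).
    by apply: nattransP => y w; rewrite /= linearB.
  by rewrite !adj_upK.
by rewrite nt_subE addrA subrK.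
Qed.

Lemma ext_res_of_bij n : bijective (ext_res_of G f n).
Proof.
apply: homology_map_bij => [b b0|b b0]; first exact: ext_res_cochain_inj.
exact: ext_res_cochain_surj.
Qed.

End RestrictionAlongAdjoint.

Section ExtDiagonal.
Variables (k : comPzRingType) (A : additive) (F G : functor k (prodC A A)).
Hypotheses (apF : ap_bifunctor F) (apG : ap_bifunctor G).

Definition retract : nattrans (bp2 G) G := ntcomp (retract2 G) (retract1 G).

Lemma retract_eta x v : retract x (adj_eta (bp_diag_adj A) G x v) = v.
Proof.
rewrite -[RHS](@fmap1 _ _ G x v) /= -!fmapM; congr (fmap G _ v).
by rewrite /= /prod_comp /= add_comp1m add_compm1 pr1_in1 pr2_in2.
Qed.

Lemma retract_inj (P : resolution F) (projP : res_projective P) n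
    (b : nattrans (P n) (bp2 G)) :
  ext_out P _ n b = 0 -> (exists c, ext_in P _ n c = ntcomp retract b) ->
  exists c, ext_in P _ n c = b.
Proof.
move=> b0 [c ec]; apply: (ext_inj_of_ker projP (@retract1_surj _ _ G)) => //.
  exact: ext_zeros_ker1.
apply: (ext_inj_of_ker projP (@retract2_surj _ _ G)); last by exists c; rewrite ec ntcompA.
  exact: ext_zeros_ker2.
apply/ext_outE => x v; move/ext_outE: b0 => b0.
by rewrite ntcompE b0 linear0.
Qed.

Lemma ext_res_diag_bij n : bijective (ext_res (diag A) n F G).
Proof.
apply: (ext_res_of_bij (adj := bp_diag_adj A) retract_eta).
- exact: free_resolution_projective.
- exact: free_resolution_projective.
- by move=> m b; apply: retract_inj; exact: free_resolution_projective.
Qed.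
End ExtDiagonal.

(** * Duality *)

Section LinearMaps.
Variables (k : comPzRingType) (U M : lmodType k).

Definition linear_pred : {pred dprod (fun _ : U => M)} := fun h => `[< linear h >].
Lemma linear_pred_submod : submod_closed linear_pred.
Proof.
split=> [|a f g /asboolP lf /asboolP lg]; apply/asboolP => c u v.
  by rewrite !dprod0E scaler0 addr0.
rewrite !dprodDE !dprodZE lf lg !scalerDr !scalerA mulrC -!addrA; congr (_ + _).
by rewrite addrCA.
Qed.
HB.instance Definition _ :=
  GRing.isSubmodClosed.Build k _ linear_pred linear_pred_submod.

Definition linmap : lmodType k := submod linear_pred.
Definition linmap_fun (h : linmap) : U -> M := submod_val h.
Lemma linmap_linear h : linear (linmap_fun h).
Proof. by have /asboolP := submodP h. Qed.
HB.instance Definition _ h := GRing.isLinear.Build k U M _ (linmap_fun h) (linmap_linear h).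

Lemma linmapP (g h : linmap) : linmap_fun g =1 linmap_fun h -> g = h.
Proof. by move=> gh; apply/val_inj/dprodP. Qed.

Lemma linmap_subproof (l : {linear U -> M}) : (l : dprod _) \in linear_pred.
Proof. by apply/asboolP; apply: linearP. Qed.
Definition to_linmap (l : {linear U -> M}) : linmap := Submod (linmap_subproof l).

Definition linmap_eval u (h : linmap) : M := linmap_fun h u.
Lemma linmap_eval_linear u : linear (linmap_eval u).
Proof. by []. Qed.
HB.instance Definition _ u :=
  GRing.isLinear.Build k linmap M _ (linmap_eval u) (linmap_eval_linear u).
End LinearMaps.

Section DualFunctor.
Variables (k : comPzRingType) (C : category) (G : functor k C) (M : lmodType k).

Definition dual_functor : functor k (op C).
Proof.
refine (@Functor k (op C) (fun x => linmap (G x) M)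
  (fun x y u h => to_linmap (linmap_fun h \o fmap G (u : @hom C y x))) _ _ _).
- by move=> x y u a g h; apply: linmapP.
- by move=> x h; apply: linmapP => v; rewrite /linmap_fun /= fmap1.
- by move=> x y z g f h; apply: linmapP => v; rewrite /linmap_fun /= fmapM.
Defined.

Variable F : functor k (op C).

Section TensOf.
Variable a : nattrans F dual_functor.

Lemma tens_of_subproof c r : tensor_rel r ->
  lin_ext (fun uv : F c * G c => linmap_fun (a c uv.1) uv.2) r = 0.
Proof.
case=> [z u u' v|z u v v']; rewrite linearB linearP /= !lin_ext_delta /=.
  by rewrite [a c _]linearP; exact: subrr.
by rewrite linearP subrr.
Qed.

Definition tens_of_at c : {linear tensor (F c) (G c) -> M} :=
  presented_ext (@tens_of_subproof c).

Lemma tens_of_atE c u v : tens_of_at c (tens u v) = linmap_fun (a c u) v.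
Proof. exact: presented_extE. Qed.

Lemma tens_of_dinatural (c d : C) (f : hom c d) (u : F d) (v : G c) :
  tens_of_at c (tens (fmap F (f : @hom (op C) d c) u) v) =
  tens_of_at d (tens u (fmap G f v)).
Proof. by rewrite !tens_of_atE naturality. Qed.

Definition tens_of : {linear tensorC F G -> M} := tensorC_ext tens_of_dinatural.

Lemma tens_ofE c u v : tens_of (@coend_in k C F G c (tens u v)) = linmap_fun (a c u) v.
Proof. by rewrite [LHS]tensorC_extE tens_of_atE. Qed.
End TensOf.

Section NatOf.
Variable l : {linear tensorC F G -> M}.

Lemma nat_of_linear c (u : F c) :
  linear (fun v : G c => l (@coend_in k C F G c (tens u v))).
Proof. by move=> z v v'; rewrite tensLr !linearP. Qed.

Lemma nat_of_subproof c (u : F c) :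
  ((fun v : G c => l (@coend_in k C F G c (tens u v))) : dprod _) \in @linear_pred k (G c) M.
Proof. exact/asboolP/nat_of_linear. Qed.

Definition nat_of : nattrans F dual_functor.
Proof.
refine (@NatTrans k (op C) F dual_functor (fun c u => Submod (nat_of_subproof u)) _ _).
- move=> c z u u'; apply: linmapP => v; rewrite /linmap_fun /= tensLl.
  by rewrite !linearP.
- move=> c d f u; apply: linmapP => v; rewrite /linmap_fun /=.
  by rewrite -coend_in_dinatural.
Defined.

Lemma tens_of_nat_of t : tens_of nat_of t = l t.
Proof. by apply: (tensorC_eq (a := tens_of nat_of) (b := l)) => c u v; rewrite tens_ofE. Qed.
End NatOf.

Lemma nat_of_tens_of a : nat_of (tens_of a) = a.
Proof.
apply: nattransP => c u; apply: linmapP => v; rewrite /linmap_fun /=.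
exact: tens_ofE.
Qed.
End DualFunctor.

Lemma nat_of_tensorC_map (k : comPzRingType) (C : category) (G : functor k C)
    (M : lmodType k) (F F' : functor k (op C)) (e : nattrans F' F)
    (l : {linear tensorC F G -> M}) :
  nat_of (l \o tensorC_map G e) = ntcomp (nat_of l) e.
Proof.
apply: nattransP => c u; apply: linmapP => v; rewrite /linmap_fun /=.
by congr (l _); apply: tensorC_mapE.
Qed.

Lemma tens_of_ntcomp (k : comPzRingType) (C : category) (G : functor k C)
    (M : lmodType k) (F F' : functor k (op C)) (e : nattrans F' F)
    (a : nattrans F (dual_functor G M)) t :
  tens_of (ntcomp a e) t = tens_of a (tensorC_map G e t).
Proof.
rewrite -[a in RHS]nat_of_tens_of.
rewrite -[RHS](tens_of_nat_of (tens_of (nat_of (tens_of a)) \o tensorC_map G e)).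
by rewrite nat_of_tensorC_map !nat_of_tens_of.
Qed.

(** * From Ext to Tor *)

Section ConeTest.
Variables (k : comPzRingType) (Y2 X1 Y1 X0 : lmodType k).
Variables (dY : {linear Y2 -> Y1}) (t : {linear X1 -> Y1}) (dX : {linear X1 -> X0}).

(** A differential of the mapping cone of [t]. Its cokernel is the test module: a pair in Y1 and X0
    is a boundary exactly when its class there is zero. *)
Definition cone_map (u : Y2 * X1) : Y1 * X0 := (dY u.1 + t u.2, - dX u.2).
Lemma cone_map_linear : linear cone_map.
Proof.
move=> z [u1 u2] [v1 v2]; apply: injective_projections.
  transitivity (z *: dY u1 + dY v1 + (z *: t u2 + t v2)).
    by congr (_ + _); exact: linearP.
  by rewrite addrACA -scalerDr.
transitivity (- (z *: dX u2 + dX v2)); first by congr (- _); exact: linearP.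
by rewrite opprD -scalerN.
Qed.
HB.instance Definition _ := GRing.isLinear.Build k (Y2 * X1)%type (Y1 * X0)%type _
  cone_map cone_map_linear.

Definition cone_quot : lmodType k := quotmod (range_pred cone_map).
Definition cone_inY_fun (y : Y1) : cone_quot := quot_pi (range_pred cone_map) (y, 0).
Definition cone_inX_fun (x : X0) : cone_quot := quot_pi (range_pred cone_map) (0, x).
Lemma cone_inY_linear : linear cone_inY_fun.
Proof.
move=> z u v; rewrite -linearP; congr quot_pi; apply: injective_projections => //=.
by rewrite scaler0 addr0.
Qed.
Lemma cone_inX_linear : linear cone_inX_fun.
Proof.
move=> z u v; rewrite -linearP; congr quot_pi; apply: injective_projections => //=.
by rewrite scaler0 addr0.
Qed.
HB.instance Definition _ := GRing.isLinear.Build k Y1 cone_quot _ cone_inY_fun cone_inY_linear.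
HB.instance Definition _ := GRing.isLinear.Build k X0 cone_quot _ cone_inX_fun cone_inX_linear.
Definition cone_inY : {linear Y1 -> cone_quot} := cone_inY_fun.
Definition cone_inX : {linear X0 -> cone_quot} := cone_inX_fun.

Lemma cone_in_dY y : cone_inY (dY y) = 0.
Proof.
by apply/coker_eq0; exists (y, 0); apply: injective_projections => /=; rewrite linear0 ?addr0 ?oppr0.
Qed.

Lemma cone_inD y x : cone_inY y + cone_inX x = quot_pi (range_pred cone_map) (y, x).
Proof.
transitivity (quot_pi (range_pred cone_map) ((y, 0) + (0, x))); first by rewrite linearD.
by congr quot_pi; apply: injective_projections; rewrite /= ?addr0 ?add0r.
Qed.

Lemma cone_in_tau x : cone_inY (t x) = cone_inX (dX x).
Proof.
apply/eqP; rewrite -subr_eq0 -linearN cone_inD; apply/eqP/coker_eq0.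
by exists (0, x); apply: injective_projections => //=; rewrite linear0 add0r.
Qed.

Lemma cone_in_eq0 y x : cone_inY y + cone_inX x = 0 ->
  exists (y' : Y2) (x' : X1), dY y' + t x' = y /\ - dX x' = x.
Proof.
rewrite cone_inD => /coker_eq0[[y' x'] [<- <-]].
by exists y', x'.
Qed.
End ConeTest.

Section TorComplexes.
Variables (k : comPzRingType) (C D : category) (phi : cfunctor C D).
Variables (F : functor k (op D)) (G : functor k D).
Variables (P : resolution F) (Q : resolution (restr (op_cfunctor phi) F)).
Variable f : chain_map Q (restr_resolution (op_cfunctor phi) P).

Local Notation XX n := (tensorC (Q n) (restr phi G)).
Local Notation YY n := (tensorC (P n) G).
Local Notation tau := (tor_res_chain G f).

Lemma nat_of_tor_out (E : category) (H : functor k (op E)) (R : resolution H)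
    (K : functor k E) (M : lmodType k) n (c : {linear tensorC (R n.-1) K -> M}) :
  nat_of (c \o tor_out R K n) = ext_in R (dual_functor K M) n (nat_of c).
Proof.
case: n c => [|n] c; last exact: nat_of_tensorC_map.
by apply: nattransP => x u; apply: linmapP => v; rewrite /linmap_fun /= linear0.
Qed.

Lemma tens_of_ext_in (E : category) (H : functor k (op E)) (R : resolution H)
    (K : functor k E) (M : lmodType k) n (c : nattrans (R n.-1) (dual_functor K M)) t :
  tens_of (ext_in R (dual_functor K M) n c) t = tens_of c (tor_out R K n t).
Proof.
rewrite -[c in LHS]nat_of_tens_of -nat_of_tor_out.
exact: (tens_of_nat_of (tens_of c \o tor_out R K n)).
Qed.

Lemma tens_ofB (E : category) (H : functor k (op E)) (K : functor k E) (M : lmodType k)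
    (a b : nattrans H (dual_functor K M)) t :
  tens_of (a - b) t = tens_of a t - tens_of b t.
Proof.
apply: (tensorC_eq (a := tens_of (a - b)) (b := tens_of a \- tens_of b)) => c u v.
by rewrite -[RHS]/(tens_of a _ - tens_of b _) !tens_ofE.
Qed.

Section Dual.
Variable M : lmodType k.
Local Notation Gd := (dual_functor G M).
Local Notation Gd' := (restr (op_cfunctor phi) Gd).
Local Notation Gr := (dual_functor (restr phi G) M).

(** The restriction of the dual and the dual of the restriction have the same values; the identity
    on vectors goes both ways. *)
Definition dual_restr : nattrans Gd' Gr :=
  @NatTrans k (op C) Gd' Gr (fun x h => h) (fun x c g h => erefl)
    (fun x y u h => linmapP (fun v => erefl)).
Definition restr_dual : nattrans Gr Gd' :=
  @NatTrans k (op C) Gr Gd' (fun x h => h) (fun x c g h => erefl)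
    (fun x y u h => linmapP (fun v => erefl)).

Lemma nat_of_tau n (l : {linear YY n -> M}) :
  nat_of (l \o tau n) = ntcomp dual_restr (ext_res_cochain Gd f n (nat_of l)).
Proof.
apply: nattransP => c u; apply: linmapP => v; rewrite /linmap_fun /=.
by congr (l _); apply: tor_res_chainE.
Qed.

Definition dual_inj := forall n (b : nattrans (P n) Gd), ext_out P Gd n b = 0 ->
  (exists c, ext_in Q Gd' n c = ext_res_cochain Gd f n b) ->
  exists c, ext_in P Gd n c = b.

Definition dual_surj := forall n (b : nattrans (Q n) Gd'), ext_out Q Gd' n b = 0 ->
  exists2 b', ext_out P Gd n b' = 0 &
    exists c, ext_in Q Gd' n c = ext_res_cochain Gd f n b' - b.

Lemma dual_restrK : ntcomp restr_dual dual_restr = nt_id Gd'.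
Proof. exact: nattransP. Qed.

(** The hypothesis on cochains transposed to [M]-valued forms on the Tor complexes; [tor_form_surj]
    does the same for surjectivity. *)
Lemma tor_form_inj : dual_inj -> forall n (l : {linear YY n -> M}) (c : {linear XX n.-1 -> M}),
  (forall y, l (tor_in P G n y) = 0) ->
  (forall t, c (tor_out Q (restr phi G) n t) = l (tau n t)) ->
  exists c' : {linear YY n.-1 -> M}, forall y, c' (tor_out P G n y) = l y.
Proof.
move=> inj n l c l0 ec; have [||c' ec'] := inj n (nat_of l).
- rewrite -[LHS](nat_of_tensorC_map (res_d P n) l).
  by apply: nattransP => x u; apply: linmapP => v; apply: l0.
- exists (ntcomp restr_dual (nat_of c)); rewrite -ext_in_comp -nat_of_tor_out.
  transitivity (ntcomp restr_dual (nat_of (l \o tau n))).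
    congr (ntcomp _ _); apply: nattransP => x u; apply: linmapP => v; apply: ec.
  by rewrite nat_of_tau ntcompA dual_restrK; apply: nattransP.
by exists (tens_of c') => y; rewrite -tens_of_ext_in ec' tens_of_nat_of.
Qed.

Lemma tor_form_surj : dual_surj -> forall n (l : {linear XX n -> M}),
  (forall t, l (tor_in Q (restr phi G) n t) = 0) ->
  exists2 l' : {linear YY n -> M}, forall y, l' (tor_in P G n y) = 0 &
    exists c : {linear XX n.-1 -> M},
      forall t, c (tor_out Q (restr phi G) n t) = l' (tau n t) - l t.
Proof.
move=> surj n l l0; have [|b' b'0 [c ec]] := surj n (ntcomp restr_dual (nat_of l)).
  apply: nattransP => x u; apply: linmapP => v; apply: etrans (l0 _); congr (l _).
  by apply/esym; exact: tensorC_mapE.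
exists (tens_of b').
  move=> y; rewrite -[LHS]tens_of_ntcomp -[ntcomp _ _]/(ext_out P Gd n b') b'0.
  by apply: (tensorC_eq (a := tens_of 0) (b := \0)) => x u v; rewrite tens_ofE.
exists (tens_of (ntcomp dual_restr c)) => t.
rewrite -tens_of_ext_in -ext_in_comp ec.
rewrite -[X in _ = X - _](tens_of_nat_of (tens_of b' \o tau n)) nat_of_tau nat_of_tens_of.
rewrite -[X in _ = _ - X]tens_of_nat_of -tens_ofB.
by congr (tens_of _ t); apply: nattransP.
Qed.
End Dual.

Hypotheses (inj : forall M, dual_inj M) (surj : forall M, dual_surj M).

(* A complex is exact as soon as all its duals are: a map to the cokernel of the
   incoming differential that extends over the outgoing one detects boundaries.
   This is applied to the mapping cone of [tau]. *)
Lemma tor_cone_exact n (y : YY n.+1) (x : XX n) : tor_out Q (restr phi G) n x = 0 ->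
  tor_in P G n y + tau n x = 0 -> exists (y' : YY n.+2) (x' : XX n.+1),
    tor_in P G n.+1 y' + tau n.+1 x' = y /\ - tor_in Q (restr phi G) n x' = x.
Proof.
move=> x0 yx0.
pose l := cone_inY (tor_in P G n.+1) (tau n.+1) (tor_in Q (restr phi G) n).
pose c := cone_inX (tor_in P G n.+1) (tau n.+1) (tor_in Q (restr phi G) n).
have [||c' ec'] := tor_form_inj (inj (M := _)) (n := n.+1) (l := l) (c := c).
- exact: cone_in_dY.
- by move=> t; apply/esym/cone_in_tau.
(* The form c - c' tau vanishes on boundaries, so up to the coboundary of [e] it comes from a form
   [l'] on the target complex that also kills boundaries. *)
have [|l' l'0 [e ee]] := tor_form_surj (surj (M := _)) (l := c \- (c' \o tau n)).
  move=> t; rewrite -[LHS]/(c (tor_in Q (restr phi G) n t) -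
    c' (tau n (tor_in Q (restr phi G) n t))) (tor_res_d f) -cone_in_tau.
  by rewrite -[X in X - _]ec' subrr.
apply: cone_in_eq0; rewrite -/l -/c.
have ex0 : e (tor_out Q (restr phi G) n x) = 0 by rewrite x0 linear0.
have taux : tau n x = - tor_in P G n y by apply/eqP; rewrite -addr_eq0 addrC yx0.
have cx : c x = l' (tau n x) + c' (tau n x).
  have := ee x : e _ = l' (tau n x) - (c x - c' (tau n x)).
  by rewrite ex0 => /esym/eqP; rewrite subr_eq0 => /eqP ->; rewrite subrK.
by rewrite cx taux !linearN /= l'0 oppr0 add0r -ec' subrr.
Qed.

Lemma tor_surj n (y : YY n) : tor_out P G n y = 0 -> exists2 x : XX n,
  tor_out Q (restr phi G) n x = 0 & exists y', tor_in P G n y' = tau n x - y.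
Proof.
case: n y => [|n] y y0.
  (* In degree 0 the cone has no source component; the zero endomorphism of [XX 0] stands in for the
     missing differential. *)
  pose L : {linear _ -> _} := cone_map (tor_in P G 0) (tau 0) (\0 : {linear XX 0 -> XX 0}).
  pose l := cone_inY (tor_in P G 0) (tau 0) (\0 : {linear XX 0 -> XX 0}).
  have [||c ec] := tor_form_inj (inj (M := _)) (n := 0) (l := l) (c := \0).
  - exact: cone_in_dY.
  - by move=> t; rewrite [RHS]cone_in_tau /= linear0.
  have [|y' [x' [e _]]] := @cone_in_eq0 _ _ _ _ _ (tor_in P G 0) (tau 0)
    (\0 : {linear XX 0 -> XX 0}) y 0.
    by rewrite linear0 addr0 -[LHS]ec linear0.
  exists x' => //; exists (- y'); rewrite linearN /= -e opprD addrCA subrr addr0.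
  by [].
have [||y' [x' [e /eqP]]] := @tor_cone_exact n y 0; rewrite ?linear0 ?addr0 //.
rewrite oppr_eq0 => /eqP x'0; exists x' => //; exists (- y').
by rewrite linearN /= -e opprD addrCA subrr addr0.
Qed.

Lemma tor_inj n (x : XX n) : tor_out Q (restr phi G) n x = 0 ->
  (exists y, tor_in P G n y = tau n x) ->
  exists x', tor_in Q (restr phi G) n x' = x.
Proof.
move=> x0 [y ey]; have [|y' [x' [_ e]]] := @tor_cone_exact n (- y) x x0.
  by rewrite -ey linearN addNr.
by exists (- x'); rewrite linearN.
Qed.

Lemma tor_res_of_bij n : bijective (tor_res_of G f n).
Proof. by apply: homology_map_bij => x x0; [exact: tor_inj|exact: tor_surj]. Qed.
End TorComplexes.

(** * Contravariant bifunctors *)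

Definition op_adj (C D : category) (psi : cfunctor D C) (phi : cfunctor C D)
  (adj : adjunction psi phi) : adjunction (op_cfunctor phi) (op_cfunctor psi) :=
  @Adjunction (op D) (op C) (op_cfunctor phi) (op_cfunctor psi)
    (adj_counit adj) (adj_unit adj)
    (fun c c' u => @adj_counit_nat _ _ _ _ adj c' c u)
    (fun d d' u => @adj_unit_nat _ _ _ _ adj d' d u)
    (adj_psi adj) (adj_phi adj).

Section OppositeProduct.
Variables (k : comPzRingType) (A : additive).
Local Notation Op := (op (prodC A A)).
Local Notation E := (prodC (opA A) (opA A)).

(* [E] and [Op] differ only in the proofs of the category laws. *)
Definition prod_to_op : cfunctor E Op :=
  @CFunctor E Op (fun x => x) (fun x y u => u) (fun x => erefl) (fun x y z g f => erefl).
Definition op_to_prod : cfunctor Op E :=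
  @CFunctor Op E (fun x => x) (fun x y u => u) (fun x => erefl) (fun x y z g f => erefl).

Definition op_prod_adj : adjunction op_to_prod prod_to_op.
Proof.
unshelve refine (@Adjunction E Op op_to_prod prod_to_op (fun x => idm x) (fun x => idm x)
  _ _ _ _).
- by move=> x y u; rewrite comp1m compm1.
- by move=> x y u; rewrite comp1m compm1.
- by move=> x; rewrite compm1.
- by move=> x; rewrite compm1.
Defined.

Lemma bpmap_op (x y x' y' : A) (f : add_hom x' x) (g : add_hom y' y) :
  @bpmap (opA A) x y x' y' f g = bpmap f g.
Proof. by rewrite /bpmap /= !add_compA. Qed.

Variable G : functor k Op.
Local Notation G2 := (restr (op_cfunctor (bp_functor A)) (restr (op_cfunctor (diag A)) G)).
Local Notation GE := (restr prod_to_op G).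

Definition in12 (x : prodC A A) : @hom Op (bp x.1 x.2, bp x.1 x.2) x :=
  (in1 x.1 x.2, in2 x.1 x.2).

Definition op_retract : nattrans G2 G.
Proof.
refine (@NatTrans k Op G2 G (fun x v => fmap G (in12 x) v) _ _).
- by move=> x; exact: (@fmap_linear _ _ G _ _ (in12 x)).
- move=> x y u v; rewrite /= -!fmapM; congr (fmap G _ v).
  by rewrite /= /prod_comp /= bpmap_in1 bpmap_in2.
Defined.

Lemma op_retract_eta x v : op_retract x (adj_eta (op_adj (diag_bp_adj A)) G x v) = v.
Proof.
rewrite -[RHS](@fmap1 _ _ G x v) /= -!fmapM; congr (fmap G _ v).
by rewrite /= /prod_comp /= pr1_in1 pr2_in2.
Qed.

Definition to_bp2 : nattrans (restr prod_to_op G2) (bp2 (A := opA A) GE).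
Proof.
refine (@NatTrans k E (restr prod_to_op G2) (bp2 (A := opA A) GE) (fun x v => v) _ _) => //.
by move=> x y u v; rewrite /= bpmap_op.
Defined.

Variables (F : functor k Op) (P : resolution F).
Hypothesis projP : res_projective P.
Hypothesis apF : @ap_bifunctor k (opA A) (restr prod_to_op F).
Hypothesis apG : @ap_bifunctor k (opA A) GE.

(** The vanishing results concern products of an additive category with itself, so the cochains are
    moved to [prodC (opA A) (opA A)], where [retract_inj] applies to [opA A], and the bounding
    cochain is moved back. *)
Lemma op_retract_inj n (b : nattrans (P n) G2) :
  ext_out P _ n b = 0 -> (exists c, ext_in P _ n c = ntcomp op_retract b) ->
  exists c, ext_in P _ n c = b.
Proof.
move=> /ext_outE b0 [c ec].
pose PE := restr_resolution prod_to_op P.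
have projPE : res_projective PE.
  by move=> m; apply: restr_projective op_prod_adj _ _; apply: projP.
pose bE : nattrans (PE n) (bp2 (A := opA A) GE) := ntcomp to_bp2 (nt_restr prod_to_op b).
have [||cE ecE] := retract_inj apF apG projPE (b := bE).
- by apply/ext_outE => x v; apply: b0.
- exists (nt_restr prod_to_op c).
  have -> : ext_in PE GE n (nt_restr prod_to_op c) = nt_restr prod_to_op (ext_in P G n c).
    by case: (n) c {ec} => [|m] c; apply: nattransP.
  rewrite ec; apply: nattransP => x v.
  rewrite /= -fmapM; congr (fmap G _ _).
  by rewrite /= /prod_comp /= add_comp1m add_compm1.
have c_nat (x y : Op) (u : hom x y) (v : P n.-1 x) :
    cE y (fmap (P n.-1) u v) = fmap G2 u (cE x v : G2 x).
  by rewrite [LHS](naturality cE (u : @hom E x y) v) /= bpmap_op.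
exists (@NatTrans k Op (P n.-1) G2 (fun x v => cE x v)
  (fun x => @component_linear _ _ _ _ cE x) c_nat).
apply: nattransP => x v; rewrite -[RHS]/(bE x v) -ecE.
clear b0 c ec bE ecE b.
case: n v cE c_nat => [|m] v cE c_nat.
  exact: (erefl (0 : G2 x)).
exact: (erefl (cE x (res_d P m x v) : G2 x)).
Qed.
End OppositeProduct.

Section DualAP.
Variables (k : comPzRingType) (A : additive).

Section OppositeIdeal.
Variable I : ideal A.

Definition op_ideal : ideal (opA A) :=
  @Ideal (opA A) (fun x y => I y x) (fun x y z g f If => @idealMr _ I _ _ _ f g If)
    (fun x y z g f Ig => @idealMl _ I _ _ _ f g Ig).

Lemma op_ideal_cotrivial : cotrivial k I -> cotrivial k op_ideal.
Proof. by []. Qed.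
End OppositeIdeal.

Variables (C : functor k (prodC A A)) (M : lmodType k).

(** [antip] and [deg_le] are equations between values on morphisms, so they pass through Hom(-, M)
    vector by vector. *)
Lemma dual_ap : ap_bifunctor C ->
  @ap_bifunctor k (opA A) (restr (prod_to_op A) (dual_functor C M)).
Proof.
move=> [Ca Cp]; split=> x.
  have [I [cI CI]] := Ca x; exists (op_ideal I); split; first exact: op_ideal_cotrivial.
  move=> y z f g h fg; apply: linmapP => v; rewrite /linmap_fun /=.
  by congr (submod_val h _); exact: CI.
have [d Cd] := Cp x; exists d => y z f g h; apply: linmapP => v.
transitivity (linmap_fun h (pact (fun j => fmap (restr (@insr A A x) C)
    (f + g *+ j : @hom A z y) v) (('X - 1) ^+ d.+1))).
  rewrite raddf_pact -[LHS]/(linmap_eval v (pact _ _)) raddf_pact.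
  exact: eq_pact.
by rewrite (Cd z y f g v) linear0.
Qed.
End DualAP.

Theorem theorem1 (k : comPzRingType) (A : additive)
    (B C : functor k (prodC A A)) (B' : functor k (prodC (opA A) (opA A)))
    (hB : AP_type B) (hC : AP_type C) (hB' : AP_type B') :
  (forall n : nat, bijective (ext_res (diag A) n B C)) /\
  (forall n : nat, bijective (tor_res (diag A) n (op_bifunctor B') C)).
Proof.
move: hB hC hB' => /AP_typeP apB /AP_typeP apC /AP_typeP apB'.
split=> n; first exact: ext_res_diag_bij.
have apF : @ap_bifunctor k (opA A) (restr (prod_to_op A) (op_bifunctor B')).
  by case: apB' => Ba Bp; split=> x; [exact: (Ba x)|exact: (Bp x)].
have projP := @free_resolution_projective k _ (op_bifunctor B').
have projQ := @free_resolution_projective k _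
  (restr (op_cfunctor (diag A)) (op_bifunctor B')).
(* By duality, Tor reduces to the Ext comparison over the opposite category with coefficients Hom(C,
   M), for every [M]; these are of AP type by [dual_ap]. *)
have eta M := @op_retract_eta k A (dual_functor C M).
have inj M := op_retract_inj projP apF (dual_ap M apC).
apply: tor_res_of_bij => M m b b0.
  by apply: (ext_res_cochain_inj (eta M) projP); exact: b0.
by apply: (ext_res_cochain_surj (eta M) projP projQ) b0 => i c; apply: inj.
Qed.
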